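(* Let $k\geq 1$ be an integer, let $U$ be an open set of the $(2k+1)$-dimensional unit sphere $\mathbb{S}^{2k+1}\subset\mathbb{R}^{2k+2}$ and let $K\subset U$ be a compact connected $(2k+1)$-dimensional submanifold with boundary of $\mathbb{S}^{2k+1}$. Let $\vec{v}$ be a smooth solenoidal (that is, divergence-free) unit vector field on $U$ which coincides with a Hopf flow $H$ along the boundary of $K$. Then $$\mathcal{E}(\vec{v})\geq\left(\frac{2k+1}{2}+k\right)\mathrm{vol}(K)=\mathcal{E}(H),$$ where the energies of $\vec{v}$ and $H$ are taken over $K$.
   Context: $\mathbb{S}^{2k+1}$ carries its standard round metric and $\mathrm{vol}(K)$ is the Riemannian volume of $K$. For a unit vector field $X$ on a compact oriented Riemannian $n$-manifold $K$ (possibly with boundary) with Levi-Civita connection $\nabla$ and volume element $d\nu$, the energy of $X$ is $$\mathcal{E}(X)=\frac{n}{2}\mathrm{vol}(K)+\frac12\int_{K}\|\nabla X\|^{2}\,d\nu,$$ where $\|\nabla X\|^2=\sum_{a}\|\nabla_{e_a}X\|^2$ for a local orthonormal frame $\{e_a\}$. Here $n=2k+1$. A Hopf flow (Hopf vector field) on $\mathbb{S}^{2k+1}$ is a unit vector field of the form $H(x)=Jx$, where $J$ is an orthogonal linear map of $\mathbb{R}^{2k+2}$ with $J^{2}=-\mathrm{Id}$. ''$\vec{v}$ coincides with $H$ along the boundary of $K$'' means $\vec{v}(x)=H(x)$ for every $x\in\partial K$. *)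

(* Defs.v *)
From HB Require Import structures.
From mathcomp Require Import all_boot all_order all_algebra.
From mathcomp Require Import all_classical all_reals all_analysis.

Set Implicit Arguments.
Unset Strict Implicit.
Unset Printing Implicit Defensive.

Import Order.TTheory GRing.Theory Num.Theory.
Import numFieldNormedType.Exports.

Local Open Scope classical_set_scope.
Local Open Scope ring_scope.

Section tuple_measure.
Context d (T : measurableType d) (R : realType).
Variable mu : {sigma_finite_measure set T -> \bar R}.
Local Open Scope ereal_scope.

Definition tuple_cons n (p : T * n.-tuple T) : n.+1.-tuple T :=
  [tuple of p.1 :: p.2].

Lemma measurable_tuple_cons n : measurable_fun setT (@tuple_cons n).
Proof. exact: measurable_cons. Qed.

Section step.
Context n (m : {sigma_finite_measure set (n.-tuple T) -> \bar R}).

Definition measure_cons : set (n.+1.-tuple T) -> \bar R :=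
  pushforward (mu \x m) (@tuple_cons n).

Let measure_cons0 : measure_cons set0 = 0.
Proof. by rewrite /measure_cons /pushforward preimage_set0 measure0. Qed.

Let measurable_preimage A : measurable A -> measurable (@tuple_cons n @^-1` A).
Proof.
by move=> mA; rewrite -[X in measurable X]setTI; exact: measurable_tuple_cons.
Qed.

Let measure_cons_ge0 A : 0 <= measure_cons A.
Proof. by rewrite /measure_cons /pushforward measure_ge0. Qed.

Let measure_cons_sigma_additive : semi_sigma_additive measure_cons.
Proof.
move=> F mF tF mUF; rewrite /measure_cons /pushforward preimage_bigcup.
apply: measure_semi_sigma_additive.
- by move=> k; exact: measurable_preimage.
- apply/trivIsetP => /= i j _ _ ij; rewrite -preimage_setI.
  by move/trivIsetP : tF => /(_ _ _ _ _ ij) ->//; rewrite preimage_set0.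
- by rewrite -preimage_bigcup; exact: measurable_preimage.
Qed.

HB.instance Definition _ := isMeasure.Build _ _ _ measure_cons
  measure_cons0 measure_cons_ge0 measure_cons_sigma_additive.

Let measure_cons_sigma_finite : sigma_finite setT measure_cons.
Proof.
have /sigma_finiteP[F [TF ndF Foo]] := sigma_finiteT mu.
have /sigma_finiteP[G [TG ndG Goo]] := sigma_finiteT m.
pose u (t : n.+1.-tuple T) : T * n.-tuple T := (thead t, [tuple of behead t]).
have mu' : measurable_fun setT u.
  apply: measurable_fun_pair => /=.
    exact: measurable_tnth.
  exact: measurable_behead.
exists (fun k => u @^-1` (F k `*` G k)).
  rewrite -preimage_bigcup (_ : \bigcup_k _ = setT) ?preimage_setT//.
  rewrite -setXTT TF TG predeqE => -[x y]; split.
    by move=> [n0 _ []/= ? ?]; split; exists n0.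
  move=> [/= [i _ Fix] [j _ Gjy]]; exists (maxn i j) => //; split.
  - by move: x Fix; exact/subsetPset/ndF/leq_maxl.
  - by move: y Gjy; exact/subsetPset/ndG/leq_maxr.
move=> k; have [mF Fk] := Foo k; have [mG Gk] := Goo k; split.
  by rewrite -[X in measurable X]setTI; apply: mu' => //; exact: measurableX.
rewrite /measure_cons /pushforward -comp_preimage (_ : u \o _ = id).
  by rewrite preimage_id product_measure1E// lte_mul_pinfty// ge0_fin_numE.
by apply/funext => -[x t]; congr (_, _); exact/val_inj.
Qed.

HB.instance Definition _ := Measure_isSigmaFinite.Build _ _ _ measure_cons
  measure_cons_sigma_finite.

End step.

(* n-fold product of the measure mu *)
Fixpoint tuple_measure n : {sigma_finite_measure set (n.-tuple T) -> \bar R} :=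
  match n with
  | 0 => dirac [tuple]
  | n'.+1 => measure_cons (tuple_measure n')
  end.

End tuple_measure.

(* Lebesgue measure on R^n, points being encoded as n-tuples because the
   library puts a measurable structure on tuples but not on row vectors. *)
Definition lebesgue_tuple {R : realType} n :
    {sigma_finite_measure set (n.-tuple (measurableTypeR R)) -> \bar R} :=
  tuple_measure (@lebesgue_measure R) n.

Section euclidean.
Context {R : realType}.

Definition rv_of_tuple n (t : n.-tuple (measurableTypeR R)) : 'rV[R]_n :=
  \row_i tnth t i.

(* The norm of the library on row vectors is the sup norm: it is used for the
   topology only, lengths are measured with [dot]. *)
Definition dot n (u v : 'rV[R]_n) : R := (u *m v^T) 0 0.

(* [Cr_on r W f]: f is of class C^r on W; meaningful for W open. *)
Fixpoint Cr_on m p (r : nat) (W : set 'rV[R]_m) (f : 'rV[R]_m -> 'rV[R]_p) :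
    Prop :=
  match r with
  | 0 => forall x, W x -> {for x, continuous f}
  | r'.+1 => (forall x, W x -> differentiable f x) /\
             (forall e, Cr_on r' W ('D_e f))
  end.

(* Smoothness on an arbitrary subset: local smooth extensions to open sets. *)
Definition smooth_on m p (A : set 'rV[R]_m) (f : 'rV[R]_m -> 'rV[R]_p) : Prop :=
  forall x, A x -> exists (W : set 'rV[R]_m) (F : 'rV[R]_m -> 'rV[R]_p),
    [/\ open W, W x, forall r, Cr_on r W F &
        forall y, (W `&` A) y -> F y = f y].

Definition diffeomorphism m p (A : set 'rV[R]_m) (B : set 'rV[R]_p)
    (f : 'rV[R]_m -> 'rV[R]_p) (g : 'rV[R]_p -> 'rV[R]_m) : Prop :=
  [/\ smooth_on A f /\ smooth_on B g,
      (forall x, A x -> B (f x)) /\ (forall y, B y -> A (g y)),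
      (forall x, A x -> g (f x) = x) &
      (forall y, B y -> f (g y) = y)].

End euclidean.

(* The sphere S^n is the unit sphere of 'rV[R]_n.+1. *)
Section sphere.
Context {R : realType}.

Definition sphere n : set 'rV[R]_n.+1 := [set x | dot x x = 1].

Definition open_in_sphere n (U : set 'rV[R]_n.+1) : Prop :=
  exists2 W, open W & U = W `&` @sphere n.

Section vector_fields.
Context (n : nat).
Implicit Types (U K : set 'rV[R]_n.+1) (X : 'rV[R]_n.+1 -> 'rV[R]_n.+1).

Definition tangent_field U X := forall x, U x -> dot x (X x) = 0.

Definition unit_field U X := forall x, U x -> dot (X x) (X x) = 1.

Definition radial (x : 'rV[R]_n.+1) : 'rV[R]_n.+1 :=
  (Num.sqrt (dot x x))^-1 *: x.

Definition tangent_proj (x w : 'rV[R]_n.+1) : 'rV[R]_n.+1 := w - dot w x *: x.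

(* Levi-Civita connection of the round metric at a point x of the sphere, in
   the direction of a vector e tangent at x: tangential part of the derivative
   of X along e. The retraction [radial] is the identity on the sphere and has
   differential e |-> e on tangent vectors, so that the derivative only
   depends on the values of X on the sphere. *)
Definition nabla X (x e : 'rV[R]_n.+1) : 'rV[R]_n.+1 :=
  tangent_proj x ('D_e (X \o radial) x).

(* The rows of E form an orthonormal basis of the tangent space at x. *)
Definition orthonormal_frame (x : 'rV[R]_n.+1) (E : 'M[R]_(n, n.+1)) : Prop :=
  E *m E^T = 1%:M /\ E *m x^T = 0.

(* Some orthonormal frame at x, see [frameP]. *)
Definition frame (x : 'rV[R]_n.+1) : 'M[R]_(n, n.+1) :=
  xget 0 [set E | orthonormal_frame x E].

Lemma frameP (x : 'rV[R]_n.+1) : dot x x = 1 -> orthonormal_frame x (frame x).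
Proof.
move=> x1; suff [E xE] : exists E, orthonormal_frame x E.
  exact: (@xgetPex _ (0 : 'M[R]_(n, n.+1)) [set E | orthonormal_frame x E]
    (ex_intro _ E xE)).
(* Householder reflection exchanging x and the first basis vector *)
suff [Q QQ Qx] : exists2 Q : 'M[R]_n.+1, Q *m Q^T = 1%:M &
    Q *m x^T = (delta_mx 0 0 : 'rV[R]_n.+1)^T.
  exists (row' 0 Q); split; apply/matrixP => i j; rewrite !mxE.
  - move/matrixP : QQ => /(_ (lift 0 i) (lift 0 j)); rewrite !mxE.
    rewrite (inj_eq (@lift_inj _ _)) => <-.
    by apply: eq_bigr => l _; rewrite !mxE.
  - move/matrixP : Qx => /(_ (lift 0 i) j); rewrite !mxE /= andbF => Hz.
    by apply: etrans Hz; apply: eq_bigr => l _; rewrite !mxE.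
pose e := delta_mx 0 0 : 'rV[R]_n.+1; pose u := x - e.
have ee : e *m e^T = 1%:M.
  rewrite trmx_delta mul_delta_mx; apply/matrixP => a b.
  by rewrite !ord1 !mxE.
have xx : x *m x^T = 1%:M.
  by apply/matrixP => a b; rewrite !ord1 [RHS]mxE -x1.
have xe : e *m x^T = x *m e^T.
  by rewrite -[LHS]trmxK trmx_mul trmxK; apply/matrixP => a b; rewrite mxE !ord1.
have [u0|u0] := eqVneq u 0.
  exists 1%:M; first by rewrite trmx1 mul1mx.
  by rewrite mul1mx; move/eqP : u0; rewrite subr_eq0 => /eqP ->.
pose s := (u *m u^T) 0 0.
have us : u *m u^T = s%:M by apply/matrixP => a b; rewrite !ord1 [RHS]mxE.
have s0 : s != 0.
  apply: contra_neq u0 => s0; apply/matrixP => a b; rewrite ord1 [RHS]mxE.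
  move: s0; rewrite /s mxE => /psumr_eq0P s0.
  have /eqP := s0 (fun l _ => ltac:(by rewrite [X in _ * X]mxE -expr2 sqr_ge0)) b isT.
  by rewrite [X in _ * X]mxE mulf_eq0 orbb => /eqP.
pose Q := 1%:M - (2 / s) *: (u^T *m u).
have QT : Q^T = Q.
  by rewrite linearB linearZ /= trmx1 trmx_mul trmxK.
have xu : x *m u^T = (s / 2)%:M.
  have xu1 : x *m u^T = 1%:M - x *m e^T by rewrite linearB /= mulmxBr xx.
  have eu : e *m u^T = - (x *m u^T).
    by rewrite xu1 linearB /= mulmxBr ee xe opprB.
  have : s%:M = x *m u^T *+ 2 by rewrite -us {1}/u mulmxBl eu opprK mulr2n.
  move=> /matrixP us2; apply/matrixP => a b; rewrite !ord1.
  have := us2 0 0; rewrite mxE mulr1n mulmxnE => s2.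
  by rewrite [RHS]mxE mulr1n s2 -[X in X / _]mulr_natr mulfK ?pnatr_eq0.
exists Q.
  have NN : (u^T *m u) *m (u^T *m u) = s *: (u^T *m u).
    by rewrite mulmxA -[u^T *m u *m u^T]mulmxA us mul_mx_scalar scalemxAl.
  rewrite QT /Q mulmxBr mulmx1 mulmxBl mul1mx -scalemxAl -scalemxAr NN !scalerA.
  by rewrite -mulrA divfK// mulr_natr mulr2n scalerDl opprB addrK subrK.
rewrite -[Q]QT -trmx_mul; congr trmx.
rewrite mulmxBr mulmx1 -scalemxAr mulmxA xu mul_scalar_mx scalerA.
by rewrite mulrA divfK// divff ?pnatr_eq0// scale1r /u opprB addrC subrK.
Qed.

(* Hence the sums over a frame below do not depend on its choice. *)
Lemma orthonormal_frame_proj (x : 'rV[R]_n.+1) (E : 'M[R]_(n, n.+1)) :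
  dot x x = 1 -> orthonormal_frame x E -> E^T *m E = 1%:M - x^T *m x.
Proof.
move=> x1 [EE Ex]; pose M : 'M[R]_(1 + n) := col_mx x E.
have xx : x *m x^T = 1%:M.
  by apply/matrixP => a b; rewrite !ord1 [RHS]mxE -x1.
have xE : x *m E^T = 0 by rewrite -[LHS]trmxK trmx_mul trmxK Ex trmx0.
have /mulmx1C : M *m M^T = 1%:M.
  by rewrite tr_col_mx mul_col_row xx EE Ex xE -scalar_mx_block.
by rewrite tr_col_mx mul_row_col => <-; rewrite [RHS]addrC addKr.
Qed.

Definition divergence X (x : 'rV[R]_n.+1) : R :=
  \sum_(a < n) dot (nabla X x (row a (frame x))) (row a (frame x)).

Definition nabla_norm2 X (x : 'rV[R]_n.+1) : R :=
  \sum_(a < n) dot (nabla X x (row a (frame x))) (nabla X x (row a (frame x))).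

Definition solenoidal U X := forall x, U x -> divergence X x = 0.

(* Graph chart of an open hemisphere over the open unit ball, c = 1 or -1. *)
Definition hemisphere (c : R) (y : 'rV[R]_n) : 'rV[R]_n.+1 :=
  row_mx (c * Num.sqrt (1 - dot y y))%:M y.

(* Riemannian density sqrt (det g_ij) of that chart; the rows of the Jacobian
   matrix are the partial derivatives of the chart. *)
Definition hemisphere_density (c : R) (y : 'rV[R]_n) : R :=
  Num.sqrt (\det ('J (hemisphere c) y *m ('J (hemisphere c) y)^T)).

Definition hemisphere_domain (c : R) K : set (n.-tuple (measurableTypeR R)) :=
  [set t | dot (rv_of_tuple t) (rv_of_tuple t) < 1 /\
           K (hemisphere c (rv_of_tuple t))].

(* Integral of f over K with respect to the Riemannian volume element, computed
   in the two hemisphere charts, which cover the sphere up to the equator (a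
   null set). *)
Definition sphere_integral K (f : 'rV[R]_n.+1 -> R) : \bar R :=
  (\sum_(c <- [:: 1%R; (- 1)%R])
    \int[lebesgue_tuple n]_(t in hemisphere_domain c K)
      (f (hemisphere c (rv_of_tuple t)) *
       hemisphere_density c (rv_of_tuple t))%:E)%E.

Definition volume K : \bar R := sphere_integral K (fun=> 1).

Definition energy K X : \bar R :=
  ((n%:R / 2)%:E * volume K + (1 / 2)%:E * sphere_integral K (nabla_norm2 X))%E.

Definition hopf_flow (H : 'rV[R]_n.+1 -> 'rV[R]_n.+1) : Prop :=
  exists J : 'M[R]_n.+1, [/\ J^T *m J = 1%:M, J *m J = - 1%:M &
    forall x, sphere x -> (H x)^T = J *m x^T].

End vector_fields.

Section submanifold.
Context (n : nat).
Implicit Type K : set 'rV[R]_n.+2.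

(* A chart phi of S^(n+1) on W `&` sphere, around p, flattening K onto the
   half-space [0 <= y_0]. *)
Definition boundary_chart K (p : 'rV[R]_n.+2)
    (phi : 'rV[R]_n.+2 -> 'rV[R]_n.+1) : Prop :=
  exists (W : set 'rV[R]_n.+2) (V : set 'rV[R]_n.+1)
         (psi : 'rV[R]_n.+1 -> 'rV[R]_n.+2),
    [/\ open W, W p, open V, diffeomorphism (W `&` @sphere n.+1) V phi psi &
        forall x, (W `&` @sphere n.+1) x -> K x <-> 0 <= phi x 0 0].

(* K is an (n+1)-dimensional submanifold with boundary of S^(n+1). *)
Definition submanifold_with_boundary K : Prop :=
  K `<=` @sphere n.+1 /\ forall p, K p -> exists phi, boundary_chart K p phi.

Definition manifold_boundary K : set 'rV[R]_n.+2 :=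
  [set p | K p /\ exists phi, boundary_chart K p phi /\ phi p 0 0 = 0].

End submanifold.

End sphere.

(* Main.v *)
Require Import Defs.
From mathcomp Require Import all_boot all_order all_algebra.
From mathcomp Require Import all_classical all_reals all_analysis.
From mathcomp Require Import measurable_realfun.
From mathcomp Require Import ring lra.

(** The energy is bounded below because of a null Lagrangian. Write N = m + 2
    for the dimension of the ambient space, with m = 2k. Let A be the
    differential at a point of K of the extension of v that is constant along
    rays, and let P be the projection onto the tangent space. The covariant
    derivative is M = PA, and tr M^2 = tr A^2. From |M + M^T|^2 >= 0 one gets the
    pointwise inequality |nabla v|^2 >= - tr A^2 ([nabla_norm2_ge]), with
    equality when M is skew, as for a Hopf flow H; its differential B satisfies
    - tr B^2 = m at every point of the sphere, so that |nabla H|^2 = m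
    ([hopf_trace_sqr], [hopf_nabla_norm2]). It remains to see that tr A^2 and
    tr B^2 have the same integral over K.

    Since v and H are solenoidal, second derivatives disappear from the
    divergence of the field Y = (A + B)(v - H), and div Y = tr A^2 - tr B^2
    ([interpolant_div]). Moreover Y is tangent to the sphere because v and H are
    tangent and unit ([interpolant_tangent]), and it is linear in v - H, which
    vanishes on the boundary of K. By the divergence theorem, div Y integrates
    to 0 over K.

    The divergence theorem is first proved on the whole sphere
    ([sphere_divergence]). In the two hemisphere charts it reduces to the fact
    that partial derivatives of compactly supported functions on R^n integrate
    to 0, provided that the fields are cut off near the equator. The terms
    created by the cutoff are estimated by applying the same fact to radial
    fields; the contributions of the two charts cancel in the limit because the
    field is continuous across the equator. For the compact set K
    ([divergence_compact]) the field Y is multiplied by a cutoff that vanishes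
    where |v - H|^2 <= e, hence near the boundary of K, and extended by 0. As e
    tends to 0, the derivative of the cutoff contributes a bounded term that
    tends to 0, since Y and the gradient of |v - H|^2 are of the order of
    |v - H|. In the limit the set where v = H is lost, but there div Y = 0 almost
    everywhere: the zeros of a function where one of its derivatives is nonzero
    form a null set ([regular_zeros_negligible]), and where v - H vanishes with
    its differential one has A = B. *)

Set Implicit Arguments.
Unset Strict Implicit.
Unset Printing Implicit Defensive.

Import Order.TTheory GRing.Theory Num.Theory.
Import numFieldNormedType.Exports.
Local Open Scope classical_set_scope.
Local Open Scope ring_scope.

(** * Partial derivatives and the chain rule *)

Notation partial i f := ('D_(delta_mx 0 i) f).

Section partial_derivatives.
Context {R : realType}.

Lemma derive_partial N (f : 'rV[R]_N -> R) x e : differentiable f x ->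
  'D_e f x = \sum_i e 0 i * partial i f x.
Proof.
move=> df; rewrite deriveE// {1}(row_sum_delta e) linear_sum.
by apply: eq_bigr => i _; rewrite linearZ deriveE.
Qed.

Lemma derive_comp_partial N M (h : 'rV[R]_M -> 'rV[R]_N) (f : 'rV[R]_N -> R)
    y e : differentiable h y -> differentiable f (h y) ->
  'D_e (f \o h) y = \sum_i 'D_e (fun z => h z 0 i) y * partial i f (h y).
Proof.
move=> dh df; rewrite deriveE; last exact: differentiable_comp.
rewrite diff_comp//= -(deriveE e dh) -(deriveE _ df) derive_partial//.
have dhe : derivable h y e by exact: diff_derivable.
by apply: eq_bigr => i _; rewrite derive_mx// mxE.
Qed.

Lemma differentiable_rowP N M (h : 'rV[R]_M -> 'rV[R]_N) y :
  (forall i, differentiable (fun z => h z 0 i) y) -> differentiable h y.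
Proof.
move=> dh.
have -> : h = \sum_i (fun z => h z 0 i *: (delta_mx 0 i : 'rV[R]_N)).
  by apply/funext => z; rewrite fct_sumE {1}(row_sum_delta (h z)).
apply: differentiable_sum => i; exact: differentiableZl.
Qed.

Lemma differentiable_entry N M (h : 'rV[R]_M -> 'rV[R]_N) y i :
  differentiable h y -> differentiable (fun z => h z 0 i) y.
Proof.
move=> dh; apply: (@differentiable_comp _ _ _ _ h (fun u : 'rV[R]_N => u 0 i)) => //.
exact: differentiable_coord.
Qed.

Lemma near_eq_differentiable (V W : normedModType R) (f g : V -> W) x :
  (\near x, f x = g x) -> differentiable f x -> differentiable g x.
Proof.
move=> fg df; suff dd : differentiable (g - f) x.
  by have := differentiableD df dd; rewrite addrC subrK.
have e : [/\ continuous (0 : V -> W) &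
    (g - f) \o shift x = cst ((g - f) x) + \0 +o_ 0 id].
  split; first exact: cst_continuous.
  apply/eqaddoP => eps eps0.
  have : \forall h \near (0 : V), f (h + x) = g (h + x).
    by move: fg; rewrite (near_shift 0 x)/= subr0; apply: filterS.
  apply: filterS => h fgh.
  rewrite /= !fctE /= fgh (nbhs_singleton fg) !subrr addr0 subrr normr0.
  by rewrite mulr_ge0// ltW.
case: e => e1 e2.
by apply/diff_locallyP; rewrite (diff_unique e1 e2).
Qed.

Lemma is_derive_comp (f g : R -> R) (a df dg : R) :
  is_derive a 1 f df -> is_derive (f a) 1 g dg ->
  is_derive a 1 (g \o f) (dg * df).
Proof.
move=> [df1 vf] [dg1 vg].
have d1 : differentiable f a by exact: (derivable1_diffP _ _).1.
have d2 : differentiable g (f a) by exact: (derivable1_diffP _ _).1.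
split; first exact: (derivable1_diffP _ _).2 (differentiable_comp d1 d2).
have e := derive1_comp df1 dg1; move: e; rewrite !derive1E vf vg => e.
exact: e.
Qed.

End partial_derivatives.

(** * The sup norm of row vectors *)

Section sup_norm.
Context {R : realType}.

Lemma norm_coord_le m n (y : 'M[R]_(m, n)) i j : `|y i j| <= `|y|.
Proof.
rewrite [leRHS]/Num.norm/= mx_normrE.
exact: (le_bigmax _ (fun ij => `|y ij.1 ij.2|) (i, j)).
Qed.

Lemma norm_rv_lt n (y : 'rV[R]_n) (e : R) : 0 < e ->
  (forall i, `|y 0 i| < e) -> `|y| < e.
Proof.
move=> e0 ye; rewrite [ltLHS]/Num.norm/= mx_normrE.
by apply/bigmax_ltP; split => // -[i j] _ /=; rewrite ord1.
Qed.

Lemma norm_rv_le n (y : 'rV[R]_n) (e : R) : 0 <= e ->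
  (forall i, `|y 0 i| <= e) -> `|y| <= e.
Proof.
move=> e0 ye; rewrite [leLHS]/Num.norm/= mx_normrE.
by apply/bigmax_leP; split => // -[i j] _ /=; rewrite ord1.
Qed.

End sup_norm.

(** * Scalar functions of class C^r *)

Section smoothness_classes.
Context {R : realType}.

(** Scalar counterpart of [Cr_on]: scalar functions can be multiplied, which
    makes the class stable under the operations used below. *)
Fixpoint Ck N (r : nat) (O : set 'rV[R]_N) (f : 'rV[R]_N -> R) : Prop :=
  match r with
  | 0 => forall x, O x -> {for x, continuous f}
  | r'.+1 => (forall x, O x -> differentiable f x) /\
             (forall e, Ck r' O ('D_e f))
  end.

Context {N : nat}.
Implicit Types (O W : set 'rV[R]_N) (f g : 'rV[R]_N -> R) (r : nat).

Lemma CkW r O f : Ck r.+1 O f -> Ck r O f.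
Proof.
elim: r f => [|r IH] f [df Df].
  by move=> x Ox; exact/differentiable_continuous/df.
by split => // e; apply: IH; exact: Df.
Qed.

Lemma Ck_continuous r O f x : Ck r O f -> O x -> {for x, continuous f}.
Proof. by elim: r => [|r IH] /= Cf Ox; [exact: Cf|apply: IH => //; exact: CkW]. Qed.

Lemma Ck_differentiable r O f x : Ck r.+1 O f -> O x -> differentiable f x.
Proof. by case=> df _; exact: df. Qed.

Lemma Ck_local r O f :
  (forall x, O x -> exists2 W, W x & Ck r W f) -> Ck r O f.
Proof.
elim: r f => [|r IH] f Cf /=.
  by move=> x /Cf[W Wx]; apply.
split=> [x /Cf[W Wx [df _]]|e]; first exact: df.
by apply: IH => x /Cf[W Wx [_ Df]]; exists W => //; exact: Df.
Qed.

Lemma Ck_sub r O W f : W `<=` O -> Ck r O f -> Ck r W f.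
Proof. by move=> WO Cf; apply: Ck_local => x /WO Ox; exists O. Qed.

(** Openness matters here: the derivatives of two functions that agree on O
    agree on O only if O is a neighbourhood of its points. *)
Lemma Ck_ext r O f g : open O -> (forall x, O x -> f x = g x) ->
  Ck r O f -> Ck r O g.
Proof.
move=> oO; have nearO x h1 h2 : O x -> (forall x, O x -> h1 x = h2 x :> R) ->
    \near x, h1 x = h2 x.
  by move=> Ox h12; have := open_nbhs_nbhs (conj oO Ox); apply: filterS.
elim: r f g => [|r IH] f g fg /=.
  move=> Cf x Ox; rewrite /prop_for /continuous_at -(fg x Ox).
  exact: cvg_trans (near_eq_cvg (F := nbhs x) (nearO _ _ _ Ox fg)) (Cf x Ox).
move=> [df Df]; split=> [x Ox|e].
  by apply: near_eq_differentiable (df x Ox); exact: nearO.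
apply: IH (Df e) => x Ox; apply: near_eq_derive; exact: nearO.
Qed.

Lemma Ck_cst r O a : Ck r O (cst a).
Proof.
elim: r a => [|r IH] a /=; first by move=> x _; exact: cst_continuous.
split=> [x _|e]; first exact: differentiable_cst.
by rewrite (_ : 'D_e _ = cst 0); [exact: IH|apply/funext => x; exact: derive_cst].
Qed.

Lemma derive_coord (i : 'I_N) (e x : 'rV[R]_N) :
  'D_e (fun z : 'rV[R]_N => z 0 i) x = e 0 i.
Proof.
have h : derivable (id : 'rV[R]_N -> 'rV[R]_N) x e by exact: derivable_id.
by have := derive_id x e; rewrite (derive_mx h) => /matrixP/(_ 0 i); rewrite mxE.
Qed.

Lemma Ck_coord r O (i : 'I_N) : Ck r O (fun z => z 0 i).
Proof.
case: r => [|r] /=; first by move=> x _; exact: coord_continuous.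
split=> [x _|e]; first exact: differentiable_coord.
rewrite (_ : 'D_e _ = cst (e 0 i)); first exact: Ck_cst.
by apply/funext => x; exact: derive_coord.
Qed.

Lemma CkD r O f g : open O -> Ck r O f -> Ck r O g -> Ck r O (f + g).
Proof.
move=> oO; elim: r f g => [|r IH] f g.
  by move=> cf cg x Ox; apply: continuousD; [exact: cf|exact: cg].
move=> [df Df] [dg Dg]; split => [x Ox|e].
  by apply: differentiableD; [exact: df|exact: dg].
apply: (Ck_ext oO _ (IH _ _ (Df e) (Dg e))) => x Ox.
by rewrite deriveD//; apply: diff_derivable; [exact: df|exact: dg].
Qed.

Lemma CkM r O f g : open O -> Ck r O f -> Ck r O g -> Ck r O (f * g).
Proof.
move=> oO; elim: r f g => [|r IH] f g.
  by move=> cf cg x Ox; apply: continuousM; [exact: cf|exact: cg].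
move=> Cf Cg; have [df Df] := Cf; have [dg Dg] := Cg; split => [x Ox|e].
  by apply: differentiableM; [exact: df|exact: dg].
have h1 := IH _ _ (CkW Cf) (Dg e); have h2 := IH _ _ (CkW Cg) (Df e).
apply: (Ck_ext oO _ (CkD oO h1 h2)) => x Ox.
by rewrite deriveM//; apply: diff_derivable; [exact: df|exact: dg].
Qed.

Lemma Ck_sum r O n (h : 'I_n -> 'rV[R]_N -> R) : open O ->
  (forall i, Ck r O (h i)) -> Ck r O (\sum_(i < n) h i).
Proof.
move=> oO Ch; elim/big_rec: _ => [|i f _ Cf]; first exact: Ck_cst.
by apply: CkD => //; exact: Ch.
Qed.

Lemma CkN r O f : open O -> Ck r O f -> Ck r O (- f).
Proof.
move=> oO Cf; rewrite (_ : - f = cst (-1) * f).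
  by apply: CkM => //; exact: Ck_cst.
by apply/funext => x; rewrite !fctE mulN1r.
Qed.

Lemma CkB r O f g : open O -> Ck r O f -> Ck r O g -> Ck r O (f - g).
Proof. by move=> oO Cf Cg; apply: CkD => //; exact: CkN. Qed.

Lemma Cr_on_Ck p r O (F : 'rV[R]_N -> 'rV[R]_p) i : open O ->
  Cr_on r O F -> Ck r O (fun x => F x 0 i).
Proof.
move=> oO; elim: r F => [|r IH] F /=.
  move=> cF x Ox; have := cF x Ox => cFx.
  by apply: (@continuous_comp _ _ _ F (fun z : 'rV[R]_p => z 0 i)) => //;
    exact: coord_continuous.
move=> [dF DF]; split => [x Ox|e]; first exact/differentiable_entry/dF.
apply: (Ck_ext oO _ (IH _ (DF e))) => x Ox.
have dFx : derivable F x e by apply: diff_derivable; exact: dF.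
by rewrite derive_mx// mxE.
Qed.

End smoothness_classes.

(** * The euclidean norm *)

Section euclidean_norm.
Context {R : realType} {N : nat}.
Implicit Types (x y e : 'rV[R]_N).

Lemma dotE x y : dot x y = \sum_i x 0 i * y 0 i.
Proof. by rewrite /dot mxE; apply: eq_bigr => i _; rewrite mxE. Qed.

Lemma dotC x y : dot x y = dot y x.
Proof. by rewrite !dotE; apply: eq_bigr => i _; rewrite mulrC. Qed.


Lemma dotZl a x y : dot (a *: x) y = a * dot x y.
Proof. by rewrite /dot -scalemxAl mxE. Qed.

Lemma dotZr a x y : dot x (a *: y) = a * dot x y.
Proof. by rewrite dotC dotZl dotC. Qed.

Lemma dot_ge0 x : 0 <= dot x x.
Proof. by rewrite dotE sumr_ge0// => i _; rewrite -expr2 sqr_ge0. Qed.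

Lemma sqr_coord_le_dot x i : x 0 i ^+ 2 <= dot x x.
Proof.
rewrite dotE (bigD1 i)//= -expr2 lerDl sumr_ge0// => j _.
by rewrite -expr2 sqr_ge0.
Qed.

Lemma dot_eq0 x : dot x x = 0 -> x = 0.
Proof.
move=> x0; apply/rowP => i; rewrite mxE; apply/eqP.
by rewrite -sqrf_eq0 eq_le sqr_ge0 andbT -[leRHS]x0 sqr_coord_le_dot.
Qed.

Lemma dot_gt0 x : x != 0 -> 0 < dot x x.
Proof.
move=> x0; rewrite lt_neqAle dot_ge0 andbT eq_sym.
by apply: contra_neq x0; exact: dot_eq0.
Qed.

Lemma dot_self_Ck r O : open O -> Ck r O (fun x => dot x x).
Proof.
move=> oO; rewrite (_ : (fun x => _) =
    \sum_(i < N) (fun x : 'rV[R]_N => x 0 i) * (fun x => x 0 i)).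
  by apply: Ck_sum => // i; apply: CkM => //; exact: Ck_coord.
by apply/funext => x; rewrite dotE fct_sumE.
Qed.

Lemma continuous_dot_self : continuous (fun x : 'rV[R]_N => dot x x).
Proof. by move=> x; exact: (@dot_self_Ck 0 setT openT). Qed.

Lemma differentiable_dot_self x : differentiable (fun x => dot x x) x.
Proof. exact: (Ck_differentiable (@dot_self_Ck 1 setT openT)). Qed.

Lemma derive_dot_self x e : 'D_e (fun x => dot x x) x = 2 * dot x e.
Proof.
pose c i := fun x : 'rV[R]_N => x 0 i.
rewrite (_ : (fun x => _) = \sum_(i < N) c i * c i); last first.
  by apply/funext => y; rewrite dotE fct_sumE.
have dc i y : derivable (c i) y e by exact/diff_derivable/differentiable_coord.
rewrite derive_sum => [|i]; last exact: derivableM.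
rewrite dotE mulr_sumr; apply: eq_bigr => i _.
by rewrite deriveM// derive_coord -mulr2n -[LHS]mulr_natl.
Qed.

Definition inv_norm x : R := (Num.sqrt (dot x x))^-1.

Definition nonzero : set 'rV[R]_N := [set x | x != 0].

Lemma open_nonzero : open nonzero.
Proof.
rewrite (_ : nonzero = ~` [set 0]).
  rewrite openC; apply: accessible_closed_set1.
  exact/hausdorff_accessible/norm_hausdorff.
by apply/seteqP; split => x /eqP.
Qed.

Lemma derivable_comp1 (f : 'rV[R]_N -> R) (g : R -> R) x :
  differentiable f x -> derivable g (f x) 1 ->
  differentiable (g \o f) x /\
  forall e, 'D_e (g \o f) x = 'D_e f x * 'D_1 g (f x).
Proof.
move=> df dg; have dg' : differentiable g (f x) by exact/derivable1_diffP.
have dgf : differentiable (g \o f) x by exact: differentiable_comp.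
split => // e; rewrite !deriveE// diff_comp//=.
by rewrite -[X in 'd g _ X]mulr1 linearZ.
Qed.

Lemma inv_norm_diff x : x != 0 -> differentiable inv_norm x /\
  forall e, 'D_e inv_norm x = - (dot x e * inv_norm x ^+ 3).
Proof.
move=> /dot_gt0 x0; have s0 : 0 < Num.sqrt (dot x x) by rewrite sqrtr_gt0.
pose g s : R := (Num.sqrt s)^-1.
have dg : is_derive (dot x x) 1 g (- (2 * Num.sqrt (dot x x) ^+ 3)^-1).
  have [dsq vsq] := is_derive1_sqrt x0.
  split; first by apply: derivableV => //; exact: lt0r_neq0.
  rewrite deriveV ?lt0r_neq0// vsq scaleNr; congr (- _).
  have inv3 (t : R) : 0 < t -> t ^- 2 * (2 * t)^-1 = (2 * t ^+ 3)^-1.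
    by move=> t0; field; exact: lt0r_neq0.
  exact: inv3.
case: dg => dg vg.
have [d1 d2] := derivable_comp1 (differentiable_dot_self x) dg.
split=> // e; rewrite -[inv_norm]/(g \o (fun x => dot x x)) d2 derive_dot_self.
rewrite vg /inv_norm mulrN; congr (- _).
have inv3 (a t : R) : 0 < t -> 2 * a * (2 * t ^+ 3)^-1 = a * t^-1 ^+ 3.
  by move=> t0; field; exact: lt0r_neq0.
exact: inv3.
Qed.

(** The derivative of the inverse norm u along e is - <x, e> u^3, a polynomial
    in u and the coordinates, which closes the induction on r. *)
Lemma inv_norm_Ck r : Ck r nonzero inv_norm.
Proof.
elim: r => [|r IH] /=.
  by move=> x /inv_norm_diff[d _]; exact: differentiable_continuous.
split=> [x /inv_norm_diff[]//|e].
pose c i := fun x : 'rV[R]_N => x 0 i.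
have oN := open_nonzero.
apply: (@Ck_ext _ _ _ _
  (- ((\sum_(i < N) c i * cst (e 0 i)) * (inv_norm * (inv_norm * inv_norm))))) => //.
  move=> x /inv_norm_diff[_ ->]; rewrite !fctE fct_sumE dotE.
  by rewrite !exprS expr0 mulr1.
apply: CkN => //; apply: CkM => //; last by do ?[apply: CkM => //].
apply: Ck_sum => // i; apply: CkM => //; [exact: Ck_coord|exact: Ck_cst].
Qed.

End euclidean_norm.

(** * Symmetry of second derivatives *)

Section mixed_partials.
Context {R : realType} {N : nat}.
Implicit Types (O W : set 'rV[R]_N) (f g : 'rV[R]_N -> R) (x e d : 'rV[R]_N).

Lemma is_derive_line f x e (t : R) : differentiable f (x + t *: e) ->
  is_derive t 1 (fun s : R => f (x + s *: e)) ('D_e f (x + t *: e)).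
Proof.
move=> df; pose h (s : R) := x + s *: e.
have dh : is_diff t h (fun s => s *: e).
  rewrite -[X in is_diff _ _ X]add0r.
  by rewrite -[h]/(cst x + (fun s : R => s *: e)); exact: is_diffD.
have dth : differentiable h t by exact: ex_diff.
have dfh : differentiable (f \o h) t by exact: differentiable_comp.
split; first exact: diff_derivable.
rewrite -[fun s => _]/(f \o h) (deriveE _ dfh) (deriveE _ df) (diff_comp dth df).
have vh : 'd h t = (fun s : R => s *: e) :> (R -> 'rV[R]_N) by exact: diff_val.
by rewrite -[LHS]/('d f (h t) ('d h t 1)) vh scale1r.
Qed.

Lemma mvt_line f x e (s : R) : 0 < s ->
  (forall t, 0 <= t <= s -> differentiable f (x + t *: e)) ->
  exists2 t, 0 <= t <= s & f (x + s *: e) - f x = s * 'D_e f (x + t *: e).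
Proof.
move=> s0 df.
have dline t : t \in `]0, s[ ->
    is_derive t 1 (fun t => f (x + t *: e)) ('D_e f (x + t *: e)).
  rewrite in_itv/= => /andP[t0 ts]; apply: is_derive_line; apply: df.
  by rewrite !ltW.
have cline : {within `[0, s], continuous (fun t : R => f (x + t *: e))}.
  apply: derivable_within_continuous => t; rewrite in_itv/= => ts.
  by have [] := is_derive_line (df _ ts).
have [t] := MVT s0 dline cline.
rewrite in_itv/= => /andP[t0 ts]; rewrite scale0r addr0 subr0 mulrC => ->.
by exists t => //; rewrite !ltW.
Qed.

Lemma derive_comp_shift f x e c : differentiable f (x + c) ->
  differentiable (f \o shift c) x /\
  'D_e (f \o shift c) x = 'D_e f (x + c).
Proof.
move=> df.
have dsh : is_diff x (shift c) id.
  rewrite -[X in is_diff _ _ X]addr0.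
  by rewrite -[shift c]/(id + cst c); exact: is_diffD.
have dsx : differentiable (shift c) x by exact: ex_diff.
have dfs : differentiable (f \o shift c) x by apply: differentiable_comp.
have vsh : 'd (shift c) x = id :> ('rV[R]_N -> 'rV[R]_N) by exact: diff_val.
split; first exact: dfs.
have e1 := deriveE e dfs.
have e2 := deriveE e df.
have /funeqP/(_ e) e3 := diff_comp dsx df.
move: e3; rewrite /= vsh => e3.
exact: etrans e1 (etrans e3 (esym e2)).
Qed.

(** Mean value theorem in the direction e for the increment along d, then in
    the direction d for the derivative along e. *)
Lemma second_difference O f x e d (s : R) : 0 < s -> Ck 2 O f ->
  (forall a b, 0 <= a <= s -> 0 <= b <= s -> O (x + a *: e + b *: d)) ->
  exists a b, [/\ 0 <= a <= s, 0 <= b <= s &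
    f (x + s *: e + s *: d) - f (x + s *: e) - f (x + s *: d) + f x =
    s ^+ 2 * 'D_d ('D_e f) (x + a *: e + b *: d)].
Proof.
move=> s0 [df Df] Oxab.
have ss : 0 <= s <= s by rewrite lexx ltW.
have s00 : 0 <= (0 : R) <= s by rewrite lexx ltW.
pose g z : R := f (z + s *: d) - f z.
have dg a : 0 <= a <= s -> differentiable g (x + a *: e) /\
    'D_e g (x + a *: e) =
    'D_e f (x + a *: e + s *: d) - 'D_e f (x + a *: e).
  move=> ia.
  have d1 : differentiable f (x + a *: e + s *: d) by exact/df/Oxab.
  have d2 : differentiable f (x + a *: e).
    by apply: df; have := Oxab a 0 ia s00; rewrite scale0r addr0.
  have [d3 v3] : differentiable (f \o shift (s *: d)) (x + a *: e) /\
      'D_e (f \o shift (s *: d)) (x + a *: e) = 'D_e f (x + a *: e + s *: d).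
    exact: derive_comp_shift.
  split; first exact: (differentiableB d3 d2).
  have h3 : derivable (f \o shift (s *: d)) (x + a *: e) e by exact: diff_derivable.
  have h2 : derivable f (x + a *: e) e by exact: diff_derivable.
  by rewrite -v3; exact: (deriveB h3 h2).
have [a ia eg] := mvt_line s0 (fun a ia => (dg a ia).1).
have [b ib ef] : exists2 b, 0 <= b <= s &
    'D_e f (x + a *: e + s *: d) - 'D_e f (x + a *: e) =
    s * 'D_d ('D_e f) (x + a *: e + b *: d).
  exact: (mvt_line (f := 'D_e f) s0 (fun b ib => (Df e).1 _ (Oxab a b ia ib))).
have eq_g : g (x + s *: e) - g x =
    s * (s * 'D_d ('D_e f) (x + a *: e + b *: d)).
  exact: etrans eg (congr1 ( *%R s) (etrans (dg a ia).2 ef)).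
exists a, b; split => //; rewrite expr2 -mulrA; apply: etrans eq_g.
by rewrite /g opprB addrA addrAC.
Qed.

Lemma continuous_eq_at (O : set 'rV[R]_N) F G x : nbhs x O ->
  {for x, continuous F} -> {for x, continuous G} ->
  (forall r, 0 < r -> ball x r `<=` O ->
    exists z z', [/\ ball x r z, ball x r z' & F z = G z' :> R]) ->
  F x = G x.
Proof.
move=> n0 cF cG FG; apply/eqP; rewrite -subr_eq0 -normr_le0.
apply/ler_addgt0Pr => eps eps0; rewrite add0r.
have e20 : 0 < eps / 2 by rewrite divr_gt0.
have n1 : \forall z \near x, `|F x - F z| < eps / 2.
  by move/cvgrPdist_lt : cF; exact.
have n2 : \forall z \near x, `|G x - G z| < eps / 2.
  by move/cvgrPdist_lt : cG; exact.
have : nbhs x [set z | [/\ O z,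
    `|F x - F z| < eps / 2 & `|G x - G z| < eps / 2]].
  by apply: filterS3 n0 n1 n2 => z; split.
move=> /nbhs_ballP[r /= r0 Hr].
have [|z [z' [/Hr[_ h1 _] /Hr[_ _ h2] E]]] := FG r r0.
  by move=> z /Hr[].
rewrite (splitr eps); apply: le_trans (ler_distD (F z) _ _) _.
by apply: lerD; [exact: ltW|rewrite distrC E ltW].
Qed.

(** Schwarz's theorem: the second difference is symmetric in the two
    directions, and divided by the area of the parallelogram it is a value of
    either mixed derivative at a nearby point. *)
Lemma derive_comm O f x e d : open O -> Ck 2 O f -> O x ->
  'D_e ('D_d f) x = 'D_d ('D_e f) x.
Proof.
move=> oO Cf Ox; have n0 := open_nbhs_nbhs (conj oO Ox).
apply: (continuous_eq_at n0 ((Cf.2 d).2 e x Ox) ((Cf.2 e).2 d x Ox)) => r r0 rO.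
pose M := 1 + `|e| + `|d|.
have M0 : 0 < M by rewrite /M -addrA ltr_pwDl// addr_ge0.
(* This side length keeps the whole parallelogram in the ball. *)
pose s := r / (2 * M); have s0 : 0 < s by rewrite divr_gt0// mulr_gt0.
have near_x a b : 0 <= a <= s -> 0 <= b <= s ->
    ball x r (x + a *: e + b *: d).
  move=> /andP[a0 as_] /andP[b0 bs].
  rewrite -ball_normE /= -addrA opprD addNKr normrN.
  apply: le_lt_trans (ler_normD _ _) _; rewrite !normrZ !ger0_norm//.
  apply: (@le_lt_trans _ _ (s * M)).
    rewrite /M -addrA !mulrDr ler_wpDl ?mulr1 ?(ltW s0)//.
    by rewrite lerD// ler_wpM2r.
  have -> : s * M = r / 2 by rewrite /s; field; rewrite lt0r_neq0.
  by rewrite ltr_pdivrMr// ltr_pMr// ltr1n.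
have near_x' a b : 0 <= a <= s -> 0 <= b <= s ->
    ball x r (x + a *: d + b *: e).
  by move=> ia ib; rewrite addrAC; exact: near_x.
have [a [b [ia ib E1]]] := second_difference s0 Cf
  (fun a b ia ib => rO _ (near_x a b ia ib)).
have [a' [b' [ia' ib' E2]]] := second_difference s0 Cf
  (fun a b ia ib => rO _ (near_x' a b ia ib)).
exists (x + a' *: d + b' *: e), (x + a *: e + b *: d).
split; [exact: near_x'|exact: near_x|].
apply: (mulfI (lt0r_neq0 (exprn_gt0 2 s0))); apply: etrans (esym E2) _.
apply: etrans E1; rewrite [x + s *: d + _]addrAC; congr (_ + _).
by rewrite [LHS]addrAC.
Qed.

End mixed_partials.

(** * Composition with the radial retraction *)

(** By the chain rule the derivatives of the composite are sums of products of
    derivatives of h with composites of one order less. *)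
Lemma Ck_comp (R : realType) M N r (O : set 'rV[R]_M) (W : set 'rV[R]_N)
    (h : 'rV[R]_M -> 'rV[R]_N) (f : 'rV[R]_N -> R) : open O ->
  (forall x, O x -> W (h x)) ->
  (forall i, Ck r O (fun x => h x 0 i)) -> Ck r W f -> Ck r O (f \o h).
Proof.
move=> oO OW; elim: r f => [|r IH] f Ch Cf.
  move=> x Ox; apply: continuous_comp; last exact/Cf/OW.
  move=> A /nbhs_ballP[e e0 eA].
  have : \forall z \near x, forall i, `|h x 0 i - h z 0 i| < e.
    apply: (filter_forall (F := nbhs x)) => i.
    by have /cvgrPdist_lt/(_ e e0) := Ch i x Ox.
  apply: filterS => z hz; apply: eA; rewrite -ball_normE /=.
  by apply: norm_rv_lt => // i; rewrite !mxE.
have [df Df] := Cf.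
have dh x : O x -> differentiable h x.
  by move=> Ox; apply: differentiable_rowP => i; exact: (Ck_differentiable (Ch i)).
split=> [x Ox|e].
  by apply: differentiable_comp; [exact: dh|exact/df/OW].
apply: (@Ck_ext _ _ _ _ (\sum_(i < N)
    'D_e (fun z => h z 0 i) * ((partial i f) \o h))) => //.
  by move=> x Ox; rewrite fct_sumE derive_comp_partial//; [exact: dh|exact/df/OW].
apply: Ck_sum => // i; apply: CkM => //; first exact: (Ch i).2.
by apply: IH => [j|]; [exact: CkW|exact: Df].
Qed.

Section radial_retraction.
Context {R : realType} {n : nat}.
Local Notation V := 'rV[R]_n.+1.
Implicit Types (O W : set V) (f g : V -> R) (x e : V).

Lemma radialE x i : radial x 0 i = inv_norm x * x 0 i.
Proof. by rewrite /radial mxE. Qed.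

Lemma inv_norm_gt0 x : x != 0 -> 0 < inv_norm x.
Proof. by move=> x0; rewrite invr_gt0 sqrtr_gt0 dot_gt0. Qed.

Lemma inv_normZ (a : R) x : 0 < a -> inv_norm (a *: x) = a^-1 * inv_norm x.
Proof.
move=> a0; rewrite /inv_norm dotZl dotZr mulrA -expr2 sqrtrM ?sqr_ge0//.
by rewrite sqrtr_sqr gtr0_norm// invfM.
Qed.

Lemma radialZ (a : R) x : 0 < a -> radial (a *: x) = radial x.
Proof.
move=> a0; rewrite /radial -![(Num.sqrt _)^-1]/(inv_norm _) inv_normZ//.
by rewrite scalerA mulrAC mulVf ?mul1r// lt0r_neq0.
Qed.

Lemma radial_sphere x : x != 0 -> sphere (radial x).
Proof.
move=> x0; have d0 := dot_gt0 x0.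
rewrite /sphere/= /radial dotZl dotZr mulrA -expr2 exprVn sqr_sqrtr ?(ltW d0)//.
by rewrite mulVf// lt0r_neq0.
Qed.

Lemma inv_norm_sphere x : sphere x -> inv_norm x = 1.
Proof. by rewrite /sphere /inv_norm/= => ->; rewrite sqrtr1 invr1. Qed.

Lemma radial_id x : sphere x -> radial x = x.
Proof.
by move=> /inv_norm_sphere x1; rewrite /radial -[(Num.sqrt _)^-1]/(inv_norm x) x1 scale1r.
Qed.

Lemma sphere_neq0 x : sphere x -> x != 0.
Proof.
rewrite /sphere/=; apply: contra_eq_neq => ->.
by rewrite /dot mul0mx mxE eq_sym oner_neq0.
Qed.

Lemma radial_coord_Ck r (i : 'I_n.+1) : Ck r nonzero (fun z : V => radial z 0 i).
Proof.
rewrite (_ : (fun z => _) = (@inv_norm R n.+1) * (fun z => z 0 i)).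
  by apply: CkM; [exact: open_nonzero|exact: inv_norm_Ck|exact: Ck_coord].
by apply/funext => z; rewrite radialE.
Qed.

Lemma differentiable_radial x : x != 0 -> differentiable (@radial R n) x.
Proof.
move=> x0; apply: differentiable_rowP => i.
exact: (Ck_differentiable (@radial_coord_Ck 1 i)).
Qed.

Definition cone O : set V := [set z | z != 0 /\ O (radial z)].

Lemma cone_nonzero O x : cone O x -> x != 0. Proof. by case. Qed.

Lemma cone_sphere O x : sphere x -> O x -> cone O x.
Proof. by move=> Sx Ox; split; [exact: sphere_neq0|rewrite radial_id]. Qed.

Lemma coneZ O (a : R) x : 0 < a -> cone O x -> cone O (a *: x).
Proof.
move=> a0 [x0 Ox]; split; last by rewrite radialZ.
by rewrite scaler_eq0 negb_or lt0r_neq0.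
Qed.

Lemma open_cone W : open W -> open (cone W).
Proof.
move=> oW; rewrite openE => x [x0 Wx].
have n1 : nbhs x nonzero by apply: open_nbhs_nbhs; split => //; exact: open_nonzero.
have n2 : nbhs x (@radial R n @^-1` W).
  apply: (differentiable_continuous (differentiable_radial x0)).
  exact: open_nbhs_nbhs.
by rewrite /interior; apply: filterS2 n1 n2 => z.
Qed.

Lemma Ck_radial r W f : open W -> Ck r W f -> Ck r (cone W) (f \o @radial R n).
Proof.
move=> oW; apply: Ck_comp; first exact: open_cone.
- by move=> x [].
- move=> i; apply: (@Ck_sub _ _ _ nonzero); first by move=> x [].
  exact: radial_coord_Ck.
Qed.

End radial_retraction.

(** * Homogeneous functions of degree 0 *)

Section homogeneous_functions.
Context {R : realType} {n : nat}.
Local Notation V := 'rV[R]_n.+1.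
Implicit Types (g : V -> R) (x e : V).

(** Euler's relation in degree 0: the function is constant along the ray of x. *)
Lemma derive_homogeneous0 g x : (forall a z, 0 < a -> g (a *: z) = g z) ->
  differentiable g x -> 'D_x g x = 0.
Proof.
move=> gZ dg.
have [_ <-] : is_derive (0 : R) 1 (fun s : R => g (x + s *: x)) ('D_x g x).
  by rewrite -[X in 'D_x g X]addr0 -[X in _ + X](scale0r x); apply: is_derive_line;
    rewrite scale0r addr0.
rewrite (@near_eq_derive _ _ _ _ (cst (g x))) ?derive_cst//.
near=> s; rewrite -[X in X + _]scale1r -scalerDl gZ//.
near: s; have : nbhs (0 : R) [set s | -1 < s].
  by apply: open_nbhs_nbhs; split; [exact: open_gt|rewrite /= ltrN10].
by apply: filterS => s /=; rewrite -subr_gt0 opprK addrC.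
Unshelve. all: by end_near. Qed.

Lemma derive_homogeneous0Z g x e (a : R) : 0 < a ->
  (forall z, g (a *: z) = g z) -> differentiable g (a *: x) ->
  'D_e g (a *: x) = a^-1 * 'D_e g x.
Proof.
move=> a0 gZ dg.
have dscl : is_diff x (fun z : V => a *: z) (fun z => a *: z) by exact: is_diffZ.
have ds : differentiable (fun z : V => a *: z) x by exact: ex_diff.
have gE : g \o (fun z => a *: z) = g by apply/funext.
have dgx : differentiable g x by rewrite -gE; exact: differentiable_comp.
have vscl : 'd (fun z : V => a *: z) x = (fun z => a *: z) :> (V -> V).
  exact: diff_val.
have eq_d : 'd g x e = 'd g (a *: x) (a *: e).
  transitivity ('d (g \o (fun z : V => a *: z)) x e); first by rewrite gE.
  have /funeqP/(_ e) E := diff_comp ds dg.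
  exact: (etrans E (congr1 (fun u => 'd g (a *: x) (u e)) vscl)).
have lin_d : 'd g (a *: x) (a *: e) = a * 'd g (a *: x) e by exact: linearZ.
have eq_D : 'D_e g x = a * 'D_e g (a *: x).
  apply: etrans (deriveE e dgx) _; apply: etrans eq_d _.
  by apply: etrans lin_d _; congr (_ * _); apply: esym; exact: deriveE.
by rewrite eq_D mulKf// lt0r_neq0.
Qed.

End homogeneous_functions.

(** * Open sets of row vectors are Borel sets of tuples *)

Section borel_tuples.
Context {R : realType}.
Local Notation tup n := (n.-tuple (measurableTypeR R)).
Local Notation rv := (@rv_of_tuple R _).

(** The measurable structure on tuples is the product one and knows nothing of
    the topology of row vectors; an open set is however the union of the boxes
    with rational centre and radius that it contains. *)
Lemma measurable_preimage_rv n (O : set 'rV[R]_n) : open O ->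
  measurable (rv @^-1` O : set (tup n)).
Proof.
move=> oO.
pose box (p : 'rV[rat]_n * rat) : set 'rV[R]_n :=
  [set y | forall i, `|y 0 i - ratr (p.1 0 i)| < ratr p.2].
pose F p : set (tup n) :=
  if `[< box p `<=` O >] then rv @^-1` box p else set0.
have -> : rv @^-1` O = \bigcup_p F p.
  apply/seteqP; split=> [t /= Ot|t [p _]]; last first.
    by rewrite /F; case: asboolP => // pO; exact: pO.
  have /nbhs_ballP[e /= e0 eO] : nbhs (rv t) O by exact: open_nbhs_nbhs.
  have e20 : 0 < e / 2 by rewrite divr_gt0.
  have [q] := rat_in_itvoo e20; rewrite in_itv/= => /andP[q0 qe].
  have /choice[c cP] i : exists c : rat, `|tnth t i - ratr c| < ratr q.
    have : tnth t i - ratr q < tnth t i + ratr q by lra.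
    move=> /rat_in_itvoo[c]; rewrite in_itv/= => cq; exists c.
    by rewrite ltr_norml; lra.
  exists (\row_i c i, q) => //; rewrite /F; case: asboolP => [_ i|].
    by have := cP i; rewrite !mxE.
  case=> y yc; apply: eO; rewrite -ball_normE /=; apply: norm_rv_lt => // i.
  have h1 := cP i; have := yc i; rewrite /= !mxE => h2.
  rewrite -[X in `|X|](subrKA (ratr (c i))) (le_lt_trans (ler_normD _ _))//.
  rewrite (splitr e) ltrD//; first exact: lt_trans h1 qe.
  by rewrite distrC; exact: lt_trans qe.
apply: countable_bigcupT_measurable => // p; rewrite /F; case: asboolP => // _.
have -> : rv @^-1` box p = \bigcap_(i in [set: 'I_n])
    ((@tnth n R ^~ i) @^-1` [set s | `|s - ratr (p.1 0 i)| < ratr p.2]).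
  apply/seteqP; split=> t h i; first by move=> _ /=; have := h i; rewrite mxE.
  by rewrite mxE; exact: h.
apply: fin_bigcap_measurable => // i _.
rewrite -[X in measurable X]setTI; apply: measurable_tnth => //.
rewrite (_ : [set s : R | _] = `]ratr (p.1 0 i) - ratr p.2,
  ratr (p.1 0 i) + ratr p.2[%classic); first exact: measurable_itv.
by apply/seteqP; split => s; rewrite /= in_itv/= ltr_distl.
Qed.

Lemma measurable_fun_rv n (O : set 'rV[R]_n) (f : 'rV[R]_n -> R) : open O ->
  (forall y, O y -> {for y, continuous f}) ->
  measurable_fun (rv @^-1` O : set (tup n)) (f \o rv).
Proof.
move=> oO cf; apply: (measurability _ (RGenOpens.measurableE R)).
move=> _ [_ [a [b ->] <-]].
have -> : rv @^-1` O `&` (f \o rv) @^-1` `]a, b[ =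
    rv @^-1` (O `&` f @^-1` `]a, b[) :> set (tup n) by [].
apply: measurable_preimage_rv; rewrite openE => y [Oy fy].
have n1 : nbhs y O by exact: open_nbhs_nbhs.
have n2 : nbhs y (f @^-1` `]a, b[).
  by apply: (cf y Oy); apply: open_nbhs_nbhs; split => //; exact: interval_open.
exact: filterI.
Qed.

Lemma measurable_closed_rv n (C : set 'rV[R]_n) : closed C ->
  measurable (rv @^-1` C : set (tup n)).
Proof.
by move=> /closed_openC/measurable_preimage_rv/measurableC; rewrite -preimage_setC setCK.
Qed.

End borel_tuples.

(** * Lebesgue measure on tuples and Fubini's theorem *)

Section lebesgue_measure_on_tuples.
Context {R : realType}.
Local Notation tup n := (n.-tuple (measurableTypeR R)).
Local Notation rv := (@rv_of_tuple R _).
Local Notation leb := (@lebesgue_measure R).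
Local Notation lebt n := (@lebesgue_tuple R n).

(* Locked, so that rewriting with the entries of a matrix does not unfold it. *)
Fact rcons0_key : unit. Proof. by []. Qed.

Definition rcons0 n (x : R) (y : 'rV[R]_n) : 'rV[R]_n.+1 :=
  locked_with rcons0_key (row_mx (x%:M : 'rV_1) y).

Lemma rcons0E n (x : R) (y : 'rV[R]_n) : rcons0 x y = row_mx (x%:M : 'rV_1) y.
Proof. by rewrite /rcons0 unlock. Qed.

Lemma rcons0_0 n (x : R) (y : 'rV[R]_n) : rcons0 x y 0 0 = x.
Proof.
have -> : (0 : 'I_n.+1) = lshift n (0 : 'I_1) by exact: val_inj.
rewrite rcons0E; apply: (etrans (row_mxEl (x%:M : 'rV_1) y 0 0)).
by rewrite mxE eqxx mulr1n.
Qed.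

Lemma rcons0_lift n (x : R) (y : 'rV[R]_n) i : rcons0 x y 0 (lift 0 i) = y 0 i.
Proof.
have -> : lift (0 : 'I_n.+1) i = rshift 1 i by exact: val_inj.
rewrite rcons0E; exact: (row_mxEr (x%:M : 'rV_1) y 0 i).
Qed.

Lemma rv_tuple_cons n (p : R * tup n) : rv (tuple_cons p) = rcons0 p.1 (rv p.2).
Proof.
apply/rowP => i; case: (unliftP 0 i) => [j|] ->.
  rewrite rcons0_lift !mxE (tnth_nth p.1) /= (tnth_nth p.1)/=.
  by [].
by rewrite rcons0_0 mxE.
Qed.

Lemma ge0_integral_tuple_cons n (f : tup n.+1 -> \bar R) :
  measurable_fun setT f -> (forall t, 0 <= f t)%E ->
  (\int[lebt n.+1]_t f t = \int[leb \x lebt n]_p f (tuple_cons p))%E.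
Proof.
move=> mf f0.
have := @ge0_integral_pushforward _ _ _ _ R _ (@measurable_tuple_cons _ (measurableTypeR R) n)
  (leb \x lebt n)%E setT f measurableT mf (fun y _ => f0 y).
by rewrite preimage_setT.
Qed.

Lemma integrable_tuple_cons n (f : tup n.+1 -> \bar R) :
  (lebt n.+1).-integrable setT f ->
  (leb \x lebt n)%E.-integrable setT (f \o @tuple_cons _ _ n).
Proof.
move=> /integrableP[mf foo]; apply/integrableP; split.
  by apply: measurableT_comp => //; exact: measurable_tuple_cons.
have := @ge0_integral_tuple_cons n (abse \o f); rewrite /= => <- //.
exact: measurableT_comp.
Qed.

Lemma integral_tuple_cons n (f : tup n.+1 -> \bar R) :
  (lebt n.+1).-integrable setT f ->
  (\int[lebt n.+1]_t f t = \int[leb \x lebt n]_p f (tuple_cons p))%E.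
Proof.
move=> fi; have := @integral_pushforward _ _ _ _ R _ (@measurable_tuple_cons _ (measurableTypeR R) n)
  (leb \x lebt n)%E setT f (measurable_int _ fi).
rewrite preimage_setT; apply => //; exact: integrable_tuple_cons.
Qed.

Definition cube n (M : R) : set (tup n) := [set t | `|rv t| <= M].

Arguments cube : clear implicits.

Lemma measurable_cube n (M : R) : measurable (cube n M).
Proof.
  apply: (@measurable_closed_rv _ _ [set y : 'rV[R]_n | `|y| <= M]).
apply: (@closed_comp _ _ (fun y : 'rV[R]_n => `|y|) [set s | s <= M]).
  by move=> y _; exact: norm_continuous.
exact: closed_le.
Qed.

Lemma lebesgue_cube n (M : R) : (lebt n (cube n M) < +oo)%E.
Proof.
elim: n => [|n IH].
  by rewrite /= /lebesgue_tuple /= diracE; case: (_ \in _); rewrite ltry.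
pose I : set (measurableTypeR R) := `[- M, M]%classic.
have mI : measurable I by exact: measurable_itv.
have sub : @tuple_cons _ (measurableTypeR R) n @^-1` cube n.+1 M `<=`
    I `*` cube n M.
  move=> p; rewrite /cube /= rv_tuple_cons => pM; split => /=.
    rewrite /I/= in_itv/= -ler_norml; apply: le_trans pM.
    by rewrite -[X in `|X|](rcons0_0 p.1 (rv p.2)); exact: norm_coord_le.
  apply: norm_rv_le; first exact: le_trans pM.
  move=> i; apply: le_trans pM; rewrite -(rcons0_lift p.1); exact: norm_coord_le.
have mA : measurable (@tuple_cons _ (measurableTypeR R) n @^-1` cube n.+1 M).
  rewrite -[X in measurable X]setTI; apply: measurable_tuple_cons => //.
  exact: measurable_cube.
have mB : measurable (I `*` cube n M).
  by apply: measurableX => //; exact: measurable_cube.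
apply: le_lt_trans (le_measure (leb \x lebt n)%E (mem_set mA) (mem_set mB) sub) _.
have E := product_measure1E leb (lebt n) mI (@measurable_cube n M).
apply: (eq_ind_r (fun z => z < +oo)%E _ E).
apply: lte_mul_pinfty => //.
apply: (eq_ind_r (fun z => z \is a fin_num) _ (lebesgue_measure_itv `[- M, M]%R)).
by case: ifP => // _; rewrite -EFinD.
Qed.

Lemma integrable_continuous n (g : 'rV[R]_n -> R) (M : R) : continuous g ->
  (forall y, M < `|y| -> g y = 0) ->
  (lebt n).-integrable setT (fun t => (g (rv t))%:E).
Proof.
move=> cg g0; pose B := cube n M.
have cB : closed [set y : 'rV[R]_n | `|y| <= M].
  apply: (@closed_comp _ _ (fun y : 'rV[R]_n => `|y|) [set s | s <= M]).
    by move=> y _; exact: norm_continuous.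
  exact: closed_le.
have mB : measurable B by exact: measurable_cube.
have mg : measurable_fun setT (g \o @rv_of_tuple R n).
  by rewrite -(preimage_setT (@rv_of_tuple R n)); apply: measurable_fun_rv => [|y _]; [exact: openT|exact: cg].
have kB : compact [set y : 'rV[R]_n | `|y| <= M].
  apply: bounded_closed_compact => //; exists M; split; first exact: num_real.
  by move=> x Mx y /= yM; apply: le_trans (ltW Mx).
have bg : [bounded (g \o @rv_of_tuple R n) t | t in B].
  have [C [Cr gC]] : bounded_set (g @` [set y : 'rV[R]_n | `|y| <= M]).
    apply/compact_bounded/continuous_compact => //.
    exact: continuous_subspaceT.
  exists C; split => // x Cx t Bt; apply: (gC x Cx); exists (rv t) => //.
have iB := measurable_bounded_integrable mB (lebesgue_cube n M) (measurable_funTS mg) bg.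
have := (integrable_mkcond _ mB).1 iB; apply: eq_integrable => // t _.
rewrite patchE; case: ifPn => // /negP tB; rewrite g0// ltNge; apply/negP => tM.
by apply: tB; rewrite inE.
Qed.

End lebesgue_measure_on_tuples.
Arguments cube {R} n M _.

(** * Integrals of partial derivatives and null sets by slicing *)

Section lines_and_slices.
Context {R : realType}.
Local Notation tup n := (n.-tuple (measurableTypeR R)).
Local Notation rv := (@rv_of_tuple R _).
Local Notation leb := (@lebesgue_measure R).
Local Notation lebt n := (@lebesgue_tuple R n).

Lemma rcons0B n (x x' : R) (y y' : 'rV[R]_n) :
  rcons0 x y - rcons0 x' y' = rcons0 (x - x') (y - y').
Proof.
apply/rowP => i; case: (unliftP 0 i) => [j|] ->; rewrite !mxE.
  by rewrite !rcons0_lift !mxE.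
by rewrite !rcons0_0.
Qed.

Lemma rcons0_delta0 n (s x : R) (y : 'rV[R]_n) :
  s *: delta_mx 0 0 + rcons0 x y = rcons0 (s + x) y.
Proof.
apply/rowP => i; case: (unliftP 0 i) => [j|] ->; rewrite !mxE.
  by rewrite !rcons0_lift /= mulr0 add0r.
by rewrite !rcons0_0 eqxx mulr1.
Qed.

Lemma rcons0_delta_lift n (s x : R) (y : 'rV[R]_n) j :
  s *: delta_mx 0 (lift 0 j) + rcons0 x y = rcons0 x (s *: delta_mx 0 j + y).
Proof.
apply/rowP => i; case: (unliftP 0 i) => [l|] ->; rewrite !mxE.
  by rewrite !rcons0_lift !mxE (inj_eq lift_inj).
by rewrite !rcons0_0 /= mulr0 add0r.
Qed.

Lemma norm_rcons0_le n (x : R) (y : 'rV[R]_n) : `|rcons0 x y| <= `|x| + `|y|.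
Proof.
apply: norm_rv_le => [|i]; first exact: addr_ge0.
case: (unliftP 0 i) => [j|] ->; rewrite ?rcons0_lift ?rcons0_0 ?lerDl//.
by apply: le_trans (norm_coord_le y 0 j) _; rewrite lerDr.
Qed.

Lemma norm_rcons0_gel n (x : R) (y : 'rV[R]_n) : `|x| <= `|rcons0 x y|.
Proof. by rewrite -[X in `|X| <= _](rcons0_0 x y); exact: norm_coord_le. Qed.

Lemma norm_rcons0_ger n (x : R) (y : 'rV[R]_n) : `|y| <= `|rcons0 x y|.
Proof.
apply: norm_rv_le => // i; rewrite -(rcons0_lift x y); exact: norm_coord_le.
Qed.

Lemma continuous_rcons0l n (y : 'rV[R]_n) : continuous (fun x => rcons0 x y).
Proof.
move=> x; apply/cvgrPdist_lt => e e0; near=> z.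
rewrite rcons0B subrr; apply: le_lt_trans (norm_rcons0_le _ _) _.
by rewrite normr0 addr0; near: z; exact: cvgr_dist_lt.
Unshelve. all: by end_near. Qed.

Lemma continuous_rcons0r n (x : R) : continuous (@rcons0 R n x).
Proof.
move=> y A /nbhs_ballP[e e0 eA]; apply/nbhs_ballP; exists e => // z yz.
apply: eA; move: yz; rewrite -!ball_normE /= rcons0B subrr => yz.
by apply: le_lt_trans (norm_rcons0_le _ _) _; rewrite normr0 add0r.
Qed.

Lemma is_derive_reparam (V W : normedModType R) (f : V -> R) (phi : W -> V)
    (a w : W) (v : V) (d : R) :
  (forall h : R, phi (h *: w + a) = h *: v + phi a) ->
  is_derive (phi a) v f d -> is_derive a w (f \o phi) d.
Proof.
move=> Hphi [df dv].
have E : (fun h : R => h^-1 *: ((f \o phi) (h *: w + a) - (f \o phi) a)) =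
         (fun h : R => h^-1 *: (f (h *: v + phi a) - f (phi a))).
  by apply/funext => h /=; rewrite Hphi.
by split; [rewrite /derivable E|rewrite /derive E].
Qed.

Lemma integral_derivative_compact (f g : R -> R) (M : R) :
  (forall x : R, is_derive x (1 : R) f (g x)) -> continuous g ->
  (forall x, M < `|x| -> f x = 0) -> (forall x, M < `|x| -> g x = 0) ->
  (\int[leb]_x (g x)%:E = 0)%E.
Proof.
move=> fg cg f0 g0; pose L : R := `|M| + 1.
have ML : M < L by rewrite (le_lt_trans (ler_norm M))// ltrDl.
have L0 : 0 < L by rewrite ltr_wpDl.
have gI : (\int[leb]_x (g x)%:E = \int[leb]_(x in `[(- L)%R, L]) (g x)%:E)%E.
  rewrite [RHS]integral_mkcond; apply: eq_integral => x _.
  rewrite patchE; case: ifPn => // /negP xL; rewrite g0//.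
  apply: lt_le_trans ML _; rewrite leNgt; apply/negP => xL'; apply: xL.
  by rewrite inE/= in_itv/= -ler_norml ltW.
have df x : derivable f x 1 by case: (fg x).
have cf x : {for x, continuous f} by apply: differentiable_continuous; exact/derivable1_diffP.
rewrite gI (@continuous_FTC2 _ g f).
- by rewrite (f0 L) ?gtr0_norm// (f0 (- L)) ?normrN ?gtr0_norm// -EFinB subrr.
- by rewrite (lt_trans _ L0)// oppr_lt0.
- exact: continuous_subspaceT.
- split=> [x _||]; first exact: df.
    by apply: cvg_at_right_filter; exact: cf.
  by apply: cvg_at_left_filter; exact: cf.
- by move=> x _; rewrite derive1E; have [_ ->] := fg x.
Qed.

(** By induction on the dimension: Fubini's theorem lets one integrate first
    along the line in direction i, where the fundamental theorem of calculus
    applies. *)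
Lemma integral_partial n (i : 'I_n) (f g : 'rV[R]_n -> R) (M : R) :
  (forall y, is_derive y (delta_mx 0 i) f (g y)) -> continuous g ->
  (forall y, M < `|y| -> f y = 0) -> (forall y, M < `|y| -> g y = 0) ->
  (\int[lebt n]_t (g (rv t))%:E = 0)%E.
Proof.
elim: n i f g => [[]//|n IH] i f g fg cg f0 g0.
have gi := integrable_continuous cg g0.
rewrite integral_tuple_cons//; have gi' := integrable_tuple_cons gi.
case: (unliftP 0 i) => [j ij|i0].
  rewrite -(integral12_prod_meas1 gi') /fubini_F; apply: integral0_eq => x _.
  under eq_integral do rewrite /= rv_tuple_cons /=.
  apply: (IH j (f \o rcons0 x) (g \o rcons0 x)).
  - move=> y; apply: (@is_derive_reparam _ _ f (rcons0 x) y _ (delta_mx 0 i)) => h.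
    by rewrite ij rcons0_delta_lift.
  - by move=> y; apply: continuous_comp; [exact: continuous_rcons0r|exact: cg].
  - by move=> y My; apply: f0; apply: lt_le_trans My (norm_rcons0_ger _ _).
  - by move=> y My; apply: g0; apply: lt_le_trans My (norm_rcons0_ger _ _).
rewrite -(integral21_prod_meas1 gi') /fubini_G; apply: integral0_eq => t _.
under eq_integral do rewrite /= rv_tuple_cons /=.
apply: (@integral_derivative_compact (f \o (fun x => rcons0 x (rv t))) (g \o (fun x => rcons0 x (rv t))) M).
- move=> x; apply: (@is_derive_reparam _ _ f (fun x => rcons0 x (rv t)) x 1 (delta_mx 0 i)) => h.
  by rewrite i0 rcons0_delta0 [h *: 1]mulr1.
- by move=> x; apply: continuous_comp; [exact: continuous_rcons0l|exact: cg].
- by move=> x Mx; apply: f0; apply: lt_le_trans Mx (norm_rcons0_gel _ _).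
- by move=> x Mx; apply: g0; apply: lt_le_trans Mx (norm_rcons0_gel _ _).
Qed.

(** Same induction, with countable sets being null on the line. *)
Lemma null_of_countable_slices n (i : 'I_n) (S : set 'rV[R]_n) :
  measurable (rv @^-1` S : set (tup n)) ->
  (forall y, countable [set s : R | S (s *: delta_mx 0 i + y)]) ->
  lebt n (rv @^-1` S) = 0%E.
Proof.
elim: n i S => [[]//|n IH] i S mS cS.
pose T := @tuple_cons _ (measurableTypeR R) n @^-1` (rv @^-1` S).
have mT : measurable T.
  by rewrite -[X in measurable X]setTI; exact: measurable_tuple_cons.
have TE p : T p = S (rcons0 p.1 (rv p.2)) by rewrite /T/= rv_tuple_cons.
change ((leb \x lebt n)%E T = 0%E).
case: (unliftP 0 i) => [j ij|i0].
  rewrite /product_measure1; apply: integral0_eq => x _ /=.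
  have xT : xsection T x = rv @^-1` (rcons0 x @^-1` S).
    by apply/seteqP; split => t; rewrite /xsection/= inE TE.
  rewrite xT; apply: (IH j).
    by rewrite -xT; exact: measurable_xsection.
  move=> y; apply: sub_countable (cS (rcons0 x y)).
  apply: subset_card_le => s /=; by rewrite ij rcons0_delta_lift.
rewrite (product_measure_unique (m1 := leb) (m2 := lebt n) (m' := (leb \x^ lebt n)%E))//.
  rewrite /product_measure2; apply: integral0_eq => t _ /=.
  apply: countable_lebesgue_measure0.
  apply: sub_countable (cS (rcons0 0 (rv t))).
  apply: subset_card_le => s /=; rewrite /ysection/= inE TE/=.
  by rewrite i0 rcons0_delta0 addr0.
by move=> A B mA mB /=; rewrite product_measure2E.
Qed.

End lines_and_slices.

(** * A step function of class C^1 *)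

Section smooth_step_function.
Context {R : realType}.
Implicit Types t : R.

Definition pos_part t : R := Num.max 0 t.

Lemma pos_partP t : 0 <= t /\ pos_part t = t \/ t <= 0 /\ pos_part t = 0.
Proof.
rewrite /pos_part; have [t0|t0] := leP 0 t; first by left.
by right; rewrite ltW.
Qed.

Lemma continuous_pos_part : continuous pos_part.
Proof. by move=> t; apply: continuous_max; [exact: cvg_cst|exact: cvg_id]. Qed.

(** The remainder of the first order expansion is at most h^2, also across 0. *)
Lemma is_derive_sqr_pos_part t :
  is_derive t 1 (fun s => pos_part s ^+ 2) (2 * pos_part t).
Proof.
have lim : (fun h : R => h^-1 *: (pos_part (h *: 1 + t) ^+ 2 - pos_part t ^+ 2))
    @ 0^' --> 2 * pos_part t.
  apply/cvgrPdist_lt => e e0; near=> h.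
  have h0 : h != 0 by near: h; exact: nbhs_dnbhs_neq.
  have he : `|h| < e.
    near: h; have := @dnbhs0_lt R R e e0; exact.
  apply: le_lt_trans he; rewrite [h *: 1]mulr1 -[_ *: _]/(_ * _).
  have -> : 2 * pos_part t - h^-1 * (pos_part (h + t) ^+ 2 - pos_part t ^+ 2) =
    h^-1 * (2 * h * pos_part t - (pos_part (h + t) ^+ 2 - pos_part t ^+ 2)).
    by field.
  rewrite normrM normfV ler_pdivrMl ?normr_gt0// -expr2 -normrX.
  rewrite [leRHS]ger0_norm ?sqr_ge0// ler_norml.
  by case: (pos_partP t) => -[t0 ->]; case: (pos_partP (h + t)) => -[ht0 ->];
    apply/andP; split; nra.
split; first by apply/cvg_ex; exists (2 * pos_part t).
exact/cvg_lim.
Unshelve. all: by end_near. Qed.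

(** The primitive of the hat function of unit mass on [0, 1]. *)
Definition step t : R :=
  2 * (pos_part t ^+ 2 - 2 * pos_part (t - 2^-1) ^+ 2 + pos_part (t - 1) ^+ 2).

Definition dstep t : R :=
  4 * (pos_part t - 2 * pos_part (t - 2^-1) + pos_part (t - 1)).

Lemma is_derive_step t : is_derive t 1 step (dstep t).
Proof.
have sq a : is_derive t 1 (fun s => pos_part (s - a) ^+ 2) (2 * pos_part (t - a)).
  apply: (@is_derive_reparam _ R R (fun s => pos_part s ^+ 2) (fun s => s - a) t 1 1).
    by move=> h; rewrite addrA.
  exact: is_derive_sqr_pos_part.
have [d0 e0] := is_derive_sqr_pos_part t.
have [d1 e1] := sq 2^-1; have [d2 e2] := sq 1.
pose f0 s := pos_part s ^+ 2; pose f1 s := pos_part (s - 2^-1) ^+ 2.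
pose f2 s := pos_part (s - 1) ^+ 2.
have -> : step = 2 *: (f0 - 2 *: f1 + f2) by apply/funext.
have dz1 : derivable (2 *: f1) t 1 by exact: (derivableZ (k := 2) d1).
have dd1 : derivable (f0 - 2 *: f1) t 1 by exact: (derivableB d0 dz1).
have dd2 : derivable (f0 - 2 *: f1 + f2) t 1 by exact: (derivableD dd1 d2).
split; first exact: (derivableZ (k := 2) dd2).
apply: (etrans (deriveZ 2 dd2)); rewrite (deriveD dd1 d2) (deriveB d0 dz1).
rewrite (deriveZ 2 d1) e0 e1 e2 /dstep -![_ *: _]/(_ * _); ring.
Qed.

Lemma continuous_dstep : continuous dstep.
Proof.
have cs a : continuous (fun s : R => pos_part (s - a)).
  move=> s; apply: (@continuous_comp _ _ _ (fun s => s - a) pos_part).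
    by apply: cvgB; [exact: cvg_id|exact: cvg_cst].
  exact: continuous_pos_part.
move=> t; apply: cvgM; first exact: cvg_cst.
apply: cvgD; last exact: cs.
apply: cvgB; first exact: continuous_pos_part.
by apply: cvgM; [exact: cvg_cst|exact: cs].
Qed.

Lemma step_eq0 t : t <= 0 -> step t = 0.
Proof.
by move=> t0; rewrite /step; case: (pos_partP t) => -[? ->];
 case: (pos_partP (t - 2^-1)) => -[? ->]; case: (pos_partP (t - 1)) => -[? ->]; nra.
Qed.

Lemma step_eq1 t : 1 <= t -> step t = 1.
Proof.
by move=> t0; rewrite /step; case: (pos_partP t) => -[? ->];
 case: (pos_partP (t - 2^-1)) => -[? ->]; case: (pos_partP (t - 1)) => -[? ->]; nra.
Qed.

Lemma step_ge0_le1 t : 0 <= step t <= 1.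
Proof.
rewrite /step; apply/andP; split; case: (pos_partP t) => -[? ->];
 case: (pos_partP (t - 2^-1)) => -[? ->]; case: (pos_partP (t - 1)) => -[? ->]; nra.
Qed.

Lemma dstep_ge0_le2 t : 0 <= dstep t <= 2.
Proof.
rewrite /dstep; apply/andP; split; case: (pos_partP t) => -[? ->];
 case: (pos_partP (t - 2^-1)) => -[? ->]; case: (pos_partP (t - 1)) => -[? ->]; lra.
Qed.

Lemma dstep_eq0 t : t <= 0 \/ 1 <= t -> dstep t = 0.
Proof.
by case=> ?; rewrite /dstep; case: (pos_partP t) => -[? ->];
 case: (pos_partP (t - 2^-1)) => -[? ->]; case: (pos_partP (t - 1)) => -[? ->]; lra.
Qed.

End smooth_step_function.

(** * The divergence theorem in the unit ball *)

Section divergence_in_the_ball.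
Context {R : realType}.
Local Notation tup n := (n.-tuple (measurableTypeR R)).
Local Notation rv := (@rv_of_tuple R _).
Local Notation lebt n := (@lebesgue_tuple R n).

Lemma norm_gt1_dot n (y : 'rV[R]_n) : 1 < `|y| -> 1 < dot y y.
Proof.
rewrite ltNge => y1; rewrite ltNge; apply: contra y1 => y1.
apply: norm_rv_le => // i; rewrite -(@ler_pXn2r _ 2)// ?nnegrE// expr1n.
by rewrite real_normK ?num_real// (le_trans (sqr_coord_le_dot y i)).
Qed.

Lemma dot_delta n (y : 'rV[R]_n) i : dot y (delta_mx 0 i) = y 0 i.
Proof.
rewrite dotE (bigD1 i)//= big1 ?addr0 => [|j ji]; rewrite mxE !eqxx/=.
  by rewrite mulr1.
by rewrite (negbTE ji) mulr0.
Qed.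

Lemma near_dot_gt n (y : 'rV[R]_n) (a : R) : a < dot y y ->
  \forall z \near y, a < dot z z.
Proof.
move=> ay; apply: (@continuous_dot_self R n y [set s | a < s]).
by apply: open_nbhs_nbhs; split => //; exact: open_gt.
Qed.

Lemma near_dot_lt n (y : 'rV[R]_n) (a : R) : dot y y < a ->
  \forall z \near y, dot z z < a.
Proof.
move=> ay; apply: (@continuous_dot_self R n y [set s | s < a]).
by apply: open_nbhs_nbhs; split => //; exact: open_lt.
Qed.

Lemma integral_partial_ball n (i : 'I_n) (f g : 'rV[R]_n -> R) (d : R) : 0 < d ->
  (forall y, dot y y < 1 -> is_derive y (delta_mx 0 i) f (g y)) ->
  (forall y, dot y y < 1 -> {for y, continuous g}) ->
  (forall y, 1 - d < dot y y -> f y = 0) ->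
  (forall y, 1 - d < dot y y -> g y = 0) ->
  (lebt n).-integrable setT (fun t => (g (rv t))%:E) /\
  (\int[lebt n]_t (g (rv t))%:E = 0)%E.
Proof.
move=> d0 fg cg f0 g0.
have out (y : 'rV[R]_n) : 1 <= dot y y -> 1 - d < dot y y.
  by move=> y1; apply: lt_le_trans y1; rewrite ltrBlDr ltrDl.
have near_out (y : 'rV[R]_n) : 1 <= dot y y -> \forall z \near y, 1 - d < dot z z.
  by move=> /out; exact: near_dot_gt.
have cg' : continuous g.
  move=> y; have [y1|y1] := ltP (dot y y) 1; first exact: cg.
  have E : \forall z \near y, cst 0 z = g z.
    have := near_out y y1; apply: filterS => z /g0 ->; by [].
  have := cvg_trans (near_eq_cvg (F := nbhs y) E).
  by apply; rewrite g0; [exact: cvg_cst|exact: out].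
have big (y : 'rV[R]_n) : 1 < `|y| -> 1 - d < dot y y.
  by move=> /norm_gt1_dot/ltW/out.
split; first by apply: (integrable_continuous cg' (M := 1)) => y /big/g0.
apply: (@integral_partial _ _ i f g 1) => //; last 2 first.
- by move=> y /big/f0.
- by move=> y /big/g0.
move=> y; have [y1|y1] := ltP (dot y y) 1; first exact: fg.
rewrite g0; last exact: out.
apply: (@near_eq_is_derive _ _ _ (cst 0)).
by apply: filterS (near_out y y1) => z /f0 ->.
Qed.

(** Equal to 1 where 1 - |y|^2 >= 2 d, and to 0 where 1 - |y|^2 <= d. *)
Definition cutoff n (d : R) (y : 'rV[R]_n) : R := step ((1 - dot y y) / d - 1).

(** The gradient of [cutoff d] at y is - [dcutoff d] y * y. *)
Definition dcutoff n (d : R) (y : 'rV[R]_n) : R :=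
  2 / d * dstep ((1 - dot y y) / d - 1).

Lemma cutoff_diff n (d : R) (y : 'rV[R]_n) :
  differentiable (cutoff d) y /\
  forall e, 'D_e (cutoff d) y = - (dcutoff d y * dot y e).
Proof.
pose p s : R := (1 - s) / d - 1.
have [dp vp] : is_derive (dot y y) 1 (step \o p) (- (dstep (p (dot y y)) / d)).
  have dp : is_derive (dot y y) 1 p (- d^-1).
    rewrite (_ : p = (cst 1 - id) * cst d^-1 - cst 1)//.
    apply: is_derive_eq; rewrite /= !scaler0 !subr0 add0r sub0r.
    by rewrite -[_ *: _]/(_ * _) mulrN1.
  by rewrite -mulrN; exact: is_derive_comp dp (is_derive_step _).
have [d1 d2] := derivable_comp1 (differentiable_dot_self y) dp.
split => // e; rewrite -[cutoff d]/((step \o p) \o (fun z => dot z z)) d2 vp.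
rewrite derive_dot_self /dcutoff /p; ring.
Qed.

Lemma cutoff_eq0 n (d : R) (y : 'rV[R]_n) : 0 < d -> 1 - d < dot y y ->
  cutoff d y = 0 /\ dcutoff d y = 0.
Proof.
move=> d0 yd; have le0 : (1 - dot y y) / d - 1 <= 0.
  by rewrite subr_le0 ler_pdivrMr// mul1r; lra.
by rewrite /cutoff /dcutoff step_eq0// dstep_eq0 ?mulr0//; left.
Qed.

Lemma continuous_dcutoff n (d : R) : continuous (@dcutoff n d).
Proof.
pose K (s : R) : R := 2 / d * dstep ((1 - s) / d - 1).
have cK : continuous K.
  move=> s; apply: cvgM; first exact: cvg_cst.
  apply: (@continuous_comp _ _ _ (fun s : R => (1 - s) / d - 1) dstep);
    last exact: continuous_dstep.
  apply: cvgB; last exact: cvg_cst.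
  apply: cvgM; last exact: cvg_cst.
  by apply: cvgB; [exact: cvg_cst|exact: cvg_id].
move=> y; apply: (@continuous_comp _ _ _ (fun y : 'rV[R]_n => dot y y) K).
  exact: continuous_dot_self.
exact: cK.
Qed.

(** The field [cutoff d * u] has compact support in the open ball, whatever the
    behaviour of u at the unit sphere; P stands for div u and Q for <y, u>. *)
Lemma integral_cutoff_divergence n (d : R) (u : 'I_n -> 'rV[R]_n -> R)
    (P Q : 'rV[R]_n -> R) : 0 < d ->
  (forall i y, dot y y < 1 -> differentiable (u i) y) ->
  (forall i y, dot y y < 1 -> {for y, continuous (partial i (u i))}) ->
  (forall y, dot y y < 1 -> \sum_i partial i (u i) y = P y) ->
  (forall y, dot y y < 1 -> \sum_i y 0 i * u i y = Q y) ->
  (lebt n).-integrable setT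
    (fun t => (cutoff d (rv t) * P (rv t) - dcutoff d (rv t) * Q (rv t))%:E) /\
  (\int[lebt n]_t (cutoff d (rv t) * P (rv t) - dcutoff d (rv t) * Q (rv t))%:E
    = 0)%E.
Proof.
move=> d0 du cu uP uQ.
pose g i : 'rV[R]_n -> R := @cutoff n d * partial i (u i) -
  @dcutoff n d * ((fun y : 'rV[R]_n => y 0 i) * u i).
have gE i y : g i y =
    cutoff d y * partial i (u i) y - dcutoff d y * (y 0 i * u i y) by [].
have H i : (lebt n).-integrable setT (fun t => (g i (rv t))%:E) /\
  (\int[lebt n]_t (g i (rv t))%:E = 0)%E.
  apply: (@integral_partial_ball n i (@cutoff n d * u i) (g i) d d0) => y y1.
  - have [dc vc] := cutoff_diff d y.
    have dci : derivable (cutoff d) y (delta_mx 0 i) by exact: diff_derivable.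
    have dui : derivable (u i) y (delta_mx 0 i) by exact/diff_derivable/du.
    split; first exact: derivableM.
    rewrite (deriveM dci dui) vc dot_delta gE -![_ *: _]/(_ * _).
    ring.
  - have [dc vc] := cutoff_diff d y.
    apply: continuousB; apply: continuousM.
    + exact: differentiable_continuous dc.
    + exact: cu.
    + exact: continuous_dcutoff.
    + apply: continuousM; first exact: coord_continuous.
      exact/differentiable_continuous/du.
  - by rewrite fctE (cutoff_eq0 d0 y1).1 mul0r.
  - by rewrite gE (cutoff_eq0 d0 y1).1 (cutoff_eq0 d0 y1).2 !mul0r subr0.
have E t : (cutoff d (rv t) * P (rv t) - dcutoff d (rv t) * Q (rv t))%:E =
    (\sum_(i < n) (g i (rv t))%:E)%E.
  rewrite sumEFin; congr (_%:E); under eq_bigr do rewrite gE.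
  rewrite sumrB -!mulr_sumr.
  have [y1|y1] := ltP (dot (rv t) (rv t)) 1; first by rewrite uP// uQ.
  have y1d : 1 - d < dot (rv t) (rv t) by apply: lt_le_trans y1; rewrite ltrBlDr ltrDl.
  by have [-> ->] := cutoff_eq0 d0 y1d; rewrite !mul0r.
under eq_fun do rewrite E; split.
  by apply: integrable_sum => // i _; exact: (H i).1.
rewrite integral_sum//; last by move=> i; exact: (H i).1.
by apply: big1 => i _; exact: (H i).2.
Qed.

End divergence_in_the_ball.

(** * The hemisphere charts *)

Section graph_charts.
Context {R : realType}.

Lemma is_derive_inv_comp (f p : R -> R) (a df dp : R) :
  is_derive (p a) 1 f df -> is_derive a 1 p dp -> f (p a) != 0 ->
  is_derive a 1 (fun t => (f (p t))^-1) (- f (p a) ^- 2 * (df * dp)).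
Proof.
move=> Df Dp fp0; have [dfp vfp] := is_derive_comp Dp Df.
split; first exact: (derivableV fp0 dfp).
exact: (etrans (deriveV fp0 dfp) (congr1 ( *%R (- f (p a) ^- 2)) vfp)).
Qed.

Definition unit_ball n : set 'rV[R]_n := [set y | dot y y < 1].

Lemma open_unit_ball n : open (@unit_ball n).
Proof. by rewrite openE => y y1; exact: near_dot_lt. Qed.

Definition height n (y : 'rV[R]_n) : R := Num.sqrt (1 - dot y y).

(** The Riemannian density of the charts, by [hemisphere_densityE] below. *)
Definition density n (y : 'rV[R]_n) : R := (height y)^-1.

Lemma height_gt0 n (y : 'rV[R]_n) : dot y y < 1 -> 0 < height y.
Proof. by move=> y1; rewrite sqrtr_gt0 subr_gt0. Qed.

Lemma height_ge0 n (y : 'rV[R]_n) : 0 <= height y.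
Proof. exact: sqrtr_ge0. Qed.

Lemma sqr_height n (y : 'rV[R]_n) : dot y y < 1 -> height y ^+ 2 = 1 - dot y y.
Proof. by move=> y1; rewrite sqr_sqrtr// subr_ge0 ltW. Qed.

Lemma density_gt0 n (y : 'rV[R]_n) : dot y y < 1 -> 0 < density y.
Proof. by move=> y1; rewrite invr_gt0 height_gt0. Qed.

Lemma density_height n (y : 'rV[R]_n) : dot y y < 1 -> density y * height y = 1.
Proof. by move=> y1; rewrite mulVf// lt0r_neq0// height_gt0. Qed.

Lemma density_diff n (y : 'rV[R]_n) : dot y y < 1 ->
  differentiable (@density n) y /\
  forall e, 'D_e (@density n) y = dot y e * density y ^+ 3.
Proof.
move=> y1; have p0 : 0 < 1 - dot y y by rewrite subr_gt0.
have s0 := height_gt0 y1.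
pose p s : R := 1 - s; pose g s : R := (Num.sqrt (p s))^-1.
have dp : is_derive (dot y y) 1 p (-1).
  rewrite (_ : p = cst 1 - id)//.
  by apply: is_derive_eq; rewrite sub0r.
have [dg vg] : is_derive (dot y y) 1 g (2^-1 * (height y)^-1 ^+ 3).
  have D := @is_derive_inv_comp Num.sqrt p _ _ _ (is_derive1_sqrt p0) dp (lt0r_neq0 s0).
  have inv3 (t : R) : 0 < t -> - t ^- 2 * ((2 * t)^-1 * -1) = 2^-1 * t^-1 ^+ 3.
    by move=> t0; field; exact: lt0r_neq0.
  by move: D; rewrite inv3.
have [d1 d2] := derivable_comp1 (differentiable_dot_self y) dg.
split=> // e; rewrite -[@density n]/(g \o (fun x => dot x x)) d2 derive_dot_self.
by rewrite vg /density [2 * _]mulrC -mulrA; congr (_ * _); rewrite mulrA mulfV ?mul1r.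
Qed.

(** As for [inv_norm]: the derivative of the density r along e is <y, e> r^3. *)
Lemma density_Ck n r : Ck r (@unit_ball n) (@density n).
Proof.
elim: r => [|r IH] /=.
  by move=> x /density_diff[d _]; exact: differentiable_continuous.
split=> [x /density_diff[]//|e].
pose c i := fun x : 'rV[R]_n => x 0 i.
have oN := @open_unit_ball n.
apply: (@Ck_ext _ _ _ _
  ((\sum_(i < n) c i * cst (e 0 i)) * (@density n * (@density n * @density n)))) => //.
  move=> x /density_diff[_ ->]; rewrite !fctE fct_sumE dotE.
  by rewrite !exprS expr0 mulr1.
apply: CkM => //; last by do ?[apply: CkM => //].
apply: Ck_sum => // i; apply: CkM => //; [exact: Ck_coord|exact: Ck_cst].
Qed.

Lemma height_Ck n r : Ck r (@unit_ball n) (@height n).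
Proof.
have oN := @open_unit_ball n.
apply: (@Ck_ext _ _ _ _ (@density n * (cst 1 - (fun y : 'rV[R]_n => dot y y)))) => //.
  move=> y y1; rewrite -[LHS]/(density y * (1 - dot y y)) -sqr_height//.
  by rewrite expr2 mulrA density_height// mul1r.
apply: CkM => //; first exact: density_Ck.
by apply: CkB => //; [exact: Ck_cst|exact: dot_self_Ck].
Qed.

Lemma derive_height n (y e : 'rV[R]_n) : dot y y < 1 ->
  'D_e (@height n) y = - (dot y e * density y).
Proof.
move=> y1; have dh : differentiable (@height n) y.
  exact: (Ck_differentiable (@height_Ck n 1)).
have dd := (density_diff y1).1.
have dhe : derivable (@height n) y e by exact: diff_derivable.
have dde : derivable (@density n) y e by exact: diff_derivable.
have E : 'D_e (@height n * @density n) y = 0.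
  rewrite (@near_eq_derive _ _ _ _ (cst (1 : R))) ?derive_cst//.
  apply: filterS (near_dot_lt y1) => z z1.
  by rewrite -[LHS]/(height z * density z) mulrC density_height.
move: E; rewrite (deriveM dhe dde) (density_diff y1).2 -![_ *: _]/(_ * _).
move=> /eqP; rewrite addrC addr_eq0 => /eqP E.
have E2 := density_height y1.
rewrite -[LHS]mul1r -E2 mulrAC E mulNr; congr (- _).
rewrite !exprS expr0 mulr1; transitivity (dot y e * density y * (density y * height y) ^+ 2); first by ring.
by rewrite E2 expr1n mulr1.
Qed.

Lemma hemisphereE n (c : R) (y : 'rV[R]_n) :
  hemisphere c y = rcons0 (c * height y) y.
Proof. by rewrite rcons0E. Qed.

Lemma continuous_height n : continuous (@height n).
Proof.
move=> y; apply: (@continuous_comp _ _ _ (fun y : 'rV[R]_n => dot y y)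
    (fun s : R => Num.sqrt (1 - s))).
  exact: continuous_dot_self.
apply: (@continuous_comp _ _ _ (fun s : R => 1 - s) Num.sqrt).
  by apply: cvgB; [exact: cvg_cst|exact: cvg_id].
exact: sqrt_continuous.
Qed.

Lemma continuous_hemisphere n (c : R) : continuous (@hemisphere R n c).
Proof.
have oT := @openT 'rV[R]_n.
have ch : Ck 0 setT (@height n) by move=> y _; exact: continuous_height.
move=> y A /nbhs_ballP[e e0 eA].
have cc i : {for y, continuous (fun z => hemisphere c z 0 i)}.
  have -> : (fun z => hemisphere c z 0 i) =
      if unlift 0 i is Some j then (fun z : 'rV[R]_n => z 0 j) else cst c * @height n.
    apply/funext => z; rewrite hemisphereE.
    by case: unliftP => [j|] ->; rewrite ?rcons0_lift ?rcons0_0.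
  case: unliftP => [j _|_]; first exact: coord_continuous.
  by apply: (@CkM _ _ 0 setT) => //; exact: Ck_cst.
have : \forall z \near y, forall i, `|hemisphere c y 0 i - hemisphere c z 0 i| < e.
  apply: (filter_forall (F := nbhs y)) => i.
  by have /cvgrPdist_lt/(_ e e0) := cc i.
apply: filterS => z hz; apply: eA; rewrite -ball_normE /=.
by apply: norm_rv_lt => // i; move: (hz i); rewrite !mxE.
Qed.

Lemma dot_rcons0 n (x : R) (y : 'rV[R]_n) :
  dot (rcons0 x y) (rcons0 x y) = x ^+ 2 + dot y y.
Proof.
rewrite !dotE big_ord_recl rcons0_0 -expr2; congr (_ + _).
by apply: eq_bigr => i _; rewrite rcons0_lift.
Qed.

Lemma hemisphere_sphere n (c : R) (y : 'rV[R]_n) : c ^+ 2 = 1 ->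
  dot y y < 1 -> sphere (hemisphere c y).
Proof.
move=> c1 y1; rewrite /sphere/= hemisphereE dot_rcons0 exprMn c1 mul1r.
by rewrite sqr_height// subrK.
Qed.

Lemma hemisphere_coord_Ck n r (c : R) i :
  Ck r (@unit_ball n) (fun y => hemisphere c y 0 i).
Proof.
have oN := @open_unit_ball n.
case: (unliftP 0 i) => [j|] ->.
  rewrite (_ : (fun y => _) = fun y : 'rV[R]_n => y 0 j); first exact: Ck_coord.
  by apply/funext => y; rewrite hemisphereE rcons0_lift.
rewrite (_ : (fun y => _) = cst c * @height n).
  by apply: CkM => //; [exact: Ck_cst|exact: height_Ck].
by apply/funext => y; rewrite hemisphereE rcons0_0.
Qed.

Lemma derive_hemisphere_coord n (c : R) i (y e : 'rV[R]_n) : dot y y < 1 ->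
  'D_e (fun y => hemisphere c y 0 i) y =
  rcons0 (- (c * dot y e * density y)) e 0 i.
Proof.
move=> y1; case: (unliftP 0 i) => [j|] ->.
  rewrite rcons0_lift (_ : (fun y => _) = fun y : 'rV[R]_n => y 0 j).
    exact: derive_coord.
  by apply/funext => z; rewrite hemisphereE rcons0_lift.
rewrite rcons0_0 (_ : (fun y => _) = c *: @height n).
  have dh : derivable (@height n) y e.
    exact/diff_derivable/(Ck_differentiable (@height_Ck n 1)).
  by rewrite (deriveZ c dh) derive_height// -[_ *: _]/(_ * _) mulrN mulrA.
by apply/funext => z; rewrite hemisphereE rcons0_0.
Qed.

Lemma differentiable_hemisphere n (c : R) (y : 'rV[R]_n) : dot y y < 1 ->
  differentiable (@hemisphere R n c) y.
Proof.
move=> y1; apply: differentiable_rowP => i.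
exact: (Ck_differentiable (@hemisphere_coord_Ck n 1 c i)).
Qed.

Lemma partial_hemisphere n (c : R) (f : 'rV[R]_n.+1 -> R) (y : 'rV[R]_n) i :
  dot y y < 1 -> differentiable f (hemisphere c y) ->
  partial i (f \o @hemisphere R n c) y =
  partial (lift 0 i) f (hemisphere c y) -
    c * y 0 i * density y * partial 0 f (hemisphere c y).
Proof.
move=> y1 df.
apply: etrans (derive_comp_partial _ (differentiable_hemisphere c y1) df) _.
under eq_bigr do rewrite derive_hemisphere_coord//.
rewrite big_ord_recl rcons0_0 dot_delta mulNr addrC; congr (_ - _).
rewrite (bigD1 i)//= rcons0_lift mxE !eqxx mul1r big1 ?addr0// => j ji.
by rewrite rcons0_lift mxE (negbTE ji) mul0r.
Qed.

End graph_charts.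

(** * The Riemannian density is integrable over the ball *)

Section integration_over_the_ball.
Context {R : realType}.
Local Notation tup n := (n.-tuple (measurableTypeR R)).
Local Notation rv := (@rv_of_tuple R _).
Local Notation lebt n := (@lebesgue_tuple R n).

Definition tuple_ball n : set (tup n) := rv @^-1` @unit_ball R n.

Arguments tuple_ball : clear implicits.

Lemma measurable_tuple_ball n : measurable (tuple_ball n).
Proof. by apply: measurable_preimage_rv; exact: open_unit_ball. Qed.

Lemma lebesgue_tuple_ball n : (lebt n (tuple_ball n) < +oo)%E.
Proof.
have sub : tuple_ball n `<=` cube n 1.
  move=> t; rewrite /tuple_ball/= /unit_ball/= => t1; rewrite /cube/= leNgt.
  by apply/negP => /norm_gt1_dot/(lt_trans t1); rewrite ltxx.
apply: le_lt_trans (@lebesgue_cube R n 1); apply: le_measure sub; rewrite inE.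
  exact: measurable_tuple_ball.
exact: measurable_cube.
Qed.

Lemma measurable_ball_fun n (f : 'rV[R]_n -> R) :
  (forall y, dot y y < 1 -> {for y, continuous f}) ->
  measurable_fun (tuple_ball n) (fun t => (f (rv t))%:E).
Proof.
move=> cf; apply/measurable_EFinP.
by apply: measurable_fun_rv => //; exact: open_unit_ball.
Qed.

Lemma integral_cutoff_ball n (d : R) (u : 'I_n -> 'rV[R]_n -> R)
    (P Q : 'rV[R]_n -> R) : 0 < d ->
  (forall i, Ck 1 (@unit_ball R n) (u i)) ->
  (forall y, dot y y < 1 -> \sum_i partial i (u i) y = P y) ->
  (forall y, dot y y < 1 -> \sum_i y 0 i * u i y = Q y) ->
  (lebt n).-integrable (tuple_ball n)
    (fun t => (cutoff d (rv t) * P (rv t) - dcutoff d (rv t) * Q (rv t))%:E) /\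
  (\int[lebt n]_(t in tuple_ball n)
     (cutoff d (rv t) * P (rv t) - dcutoff d (rv t) * Q (rv t))%:E = 0)%E.
Proof.
move=> d0 Cu uP uQ.
have [iG G0] := integral_cutoff_divergence d0
  (fun i y y1 => Ck_differentiable (Cu i) y1)
  (fun i y y1 => (Cu i).2 (delta_mx 0 i) y y1) uP uQ.
split.
  exact: integrableS measurableT (@measurable_tuple_ball n) (@subsetT _ _) iG.
rewrite -[RHS]G0 integral_mkcond; apply: eq_integral => t _.
rewrite patchE; case: ifPn => // /negP tB.
have t1 : 1 <= dot (rv t) (rv t).
  by rewrite leNgt; apply/negP => t1; apply: tB; rewrite inE.
have t1d : 1 - d < dot (rv t) (rv t) by apply: lt_le_trans t1; rewrite ltrBlDr ltrDl.
by have [-> ->] := cutoff_eq0 d0 t1d; rewrite !mul0r subr0.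
Qed.

Lemma cutoff_ge0_le1 n (d : R) (y : 'rV[R]_n) : 0 <= cutoff d y <= 1.
Proof. exact: step_ge0_le1. Qed.

Lemma dcutoff_ge0 n (d : R) (y : 'rV[R]_n) : 0 < d -> 0 <= dcutoff d y.
Proof.
move=> d0; have /andP[h _] := dstep_ge0_le2 ((1 - dot y y) / d - 1).
by apply: mulr_ge0 h; rewrite divr_ge0// ltW.
Qed.

Lemma continuous_cutoff n (d : R) : continuous (@cutoff R n d).
Proof.
by move=> y; have [dc _] := cutoff_diff d y; exact: differentiable_continuous.
Qed.

Definition radius_seq (j : nat) : R := 4^-1 * harmonic j.

Lemma radius_seq_gt0 j : 0 < radius_seq j.
Proof. by rewrite mulr_gt0// harmonic_gt0. Qed.

Lemma radius_seq_le j : radius_seq j <= 4^-1.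
Proof.
by rewrite /radius_seq ler_piMr// /harmonic invf_le1 ?ltr0n// ler1n.
Qed.

Lemma cvg_radius_seq : radius_seq j @[j --> \oo] --> 0.
Proof.
by rewrite -[X in _ --> X](mulr0 4^-1); apply: cvgM; [exact: cvg_cst|exact: cvg_harmonic].
Qed.

Lemma near_cutoff_eq1 n (y : 'rV[R]_n) : dot y y < 1 ->
  \forall j \near \oo, cutoff (radius_seq j) y = 1.
Proof.
move=> y1; have e0 : 0 < (1 - dot y y) / 2 by rewrite divr_gt0// subr_gt0.
have /cvgrPdist_lt/(_ _ e0) := cvg_radius_seq.
apply: filterS => j; have d0 := radius_seq_gt0 j.
rewrite sub0r normrN gtr0_norm// => jd; apply: step_eq1.
rewrite lerBrDr ler_pdivlMr//; lra.
Qed.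

Lemma cvg_cutoffM n (y : 'rV[R]_n) (a : R) : dot y y < 1 ->
  (cutoff (radius_seq j) y * a)%:E @[j --> \oo] --> a%:E.
Proof.
move=> y1; apply: cvg_trans (@cvg_cst _ a%:E _ \oo _).
apply: near_eq_cvg; have := near_cutoff_eq1 y1; apply: filterS => j ->.
by rewrite mul1r.
Qed.

(** The divergence of the field y |-> height y * y is n height - |y|^2 density.
    With a cutoff the integral of this divergence vanishes up to a term of
    favourable sign, because the cutoff decreases with |y|; hence the integrals
    of |y|^2 density are bounded by n times the volume of the ball, and Fatou's
    lemma removes the cutoff. Near the centre the density is at most 2. *)
Lemma integrable_density n :
  (lebt n).-integrable (tuple_ball n) (fun t => (density (rv t))%:E).
Proof.
set D := tuple_ball n; have mD : measurable D := @measurable_tuple_ball n.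
have oB := @open_unit_ball R n.
pose c i := fun y : 'rV[R]_n => y 0 i.
pose u i : 'rV[R]_n -> R := @height R n * c i.
pose P (y : 'rV[R]_n) := n%:R * height y - dot y y * density y.
pose Q (y : 'rV[R]_n) := dot y y * height y.
have Cu r i : Ck r (@unit_ball R n) (u i).
  by apply: CkM => //; [exact: height_Ck|exact: Ck_coord].
have uP y : dot y y < 1 -> \sum_i partial i (u i) y = P y.
  move=> y1; have nh : n%:R * height y = \sum_(i < n) height y.
    by rewrite sumr_const card_ord mulr_natl.
  rewrite /P nh dotE mulr_suml -sumrB.
  apply: eq_bigr => i _.
  have d1 : derivable (@height R n) y (delta_mx 0 i).
    exact/diff_derivable/(Ck_differentiable (@height_Ck R n 1)).
  have d2 : derivable (c i) y (delta_mx 0 i) by exact/diff_derivable/differentiable_coord.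
  rewrite (deriveM d1 d2) derive_height// dot_delta derive_coord mxE !eqxx.
  rewrite -![_ *: _]/(_ * _) /c /=; ring.
have uQ y : dot y y < 1 -> \sum_i y 0 i * u i y = Q y.
  move=> _; rewrite /Q dotE mulr_suml; apply: eq_bigr => i _.
  by rewrite -[u i y]/(height y * y 0 i) mulrCA mulrC mulrAC.
pose A j (y : 'rV[R]_n) := cutoff (radius_seq j) y * (dot y y * density y).
have A0 j t : D t -> (0 <= (A j (rv t))%:E)%E.
  move=> Dt; rewrite lee_fin mulr_ge0//; first by have /andP[] := cutoff_ge0_le1 (radius_seq j) (rv t).
  by rewrite mulr_ge0 ?dot_ge0// ltW// density_gt0.
have mA j : measurable_fun D (fun t => (A j (rv t))%:E).
  apply: measurable_ball_fun => y y1; apply: continuousM.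
    exact: continuous_cutoff.
  apply: continuousM; first exact: continuous_dot_self.
  exact: (@density_Ck R n 0).
have bound j : (\int[lebt n]_(t in D) (A j (rv t))%:E <= n%:R%:E * lebt n D)%E.
  have d0 := radius_seq_gt0 j.
  have [iG G0] := integral_cutoff_ball d0 (Cu 1) uP uQ.
  pose G y := cutoff (radius_seq j) y * P y - dcutoff (radius_seq j) y * Q y.
  have iC : (lebt n).-integrable D (EFin \o cst (n%:R : R)).
    apply: measurable_bounded_integrable => //; first exact: lebesgue_tuple_ball.
    exact: bounded_cst.
  have E : (\int[lebt n]_(t in D) (n%:R%:E - (G (rv t))%:E) = n%:R%:E * lebt n D)%E.
    rewrite (integralB_EFin mD iC iG) -[X in (_ - X)%E]/(\int[lebt n]_(t in D) (G (rv t))%:E)%E.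
    by rewrite G0 sube0 /= integral_cst.
  rewrite -E; apply: ge0_le_integral => //.
  - exact: A0.
  - exact: measurable_int (integrableB mD iC iG).
  - move=> t Dt; rewrite -EFinB lee_fin.
    have /andP[x0 x1] := cutoff_ge0_le1 (radius_seq j) (rv t).
    have h1 : 0 <= dcutoff (radius_seq j) (rv t) * Q (rv t).
      by rewrite mulr_ge0 ?dcutoff_ge0// /Q mulr_ge0 ?dot_ge0 ?height_ge0.
    have hle1 : height (rv t) <= 1.
      rewrite -(@ler_pXn2r _ 2)// ?nnegrE ?height_ge0// expr1n sqr_height//.
      by rewrite gerBl dot_ge0.
    have h2 : cutoff (radius_seq j) (rv t) * (n%:R * height (rv t)) <= n%:R.
      have n0 : 0 <= n%:R :> R by [].
      have nh : 0 <= n%:R * height (rv t) by rewrite mulr_ge0// height_ge0.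
      by apply: le_trans (ler_piMl nh x1) _; apply: ler_piMr.
    move: h1 h2; rewrite /A /G /P; set x := cutoff _ _; set z := dcutoff _ _ * _.
    rewrite mulrBr => h1 h2; lra.
have fat := @fatou _ _ R (lebt n) D mD (fun j t => (A j (rv t))%:E) mA A0.
have lim t : D t -> limn_einf (fun j => (A j (rv t))%:E) =
    (dot (rv t) (rv t) * density (rv t))%:E.
  move=> Dt; have cA := @cvg_cutoffM n (rv t) (dot (rv t) (rv t) * density (rv t)) Dt.
  rewrite is_cvg_limn_einfE; last by apply/cvg_ex; eexists; exact: cA.
  exact/cvg_lim.
have mdens : measurable_fun D (fun t => (density (rv t))%:E).
  by apply: measurable_ball_fun => y y1; exact: (@density_Ck R n 0).
have mdd : measurable_fun D (fun t => (dot (rv t) (rv t) * density (rv t))%:E).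
  apply: (@measurable_ball_fun n (fun y => dot y y * density y)) => y y1.
  apply: continuousM; first exact: continuous_dot_self.
  exact: (@density_Ck R n 0).
have fin : (\int[lebt n]_(t in D) (dot (rv t) (rv t) * density (rv t))%:E < +oo)%E.
  rewrite (eq_integral (fun t => limn_einf (fun j => (A j (rv t))%:E))); last first.
    by move=> t; rewrite inE => /lim ->.
  have le_lim : (limn_einf (fun j => \int[lebt n]_(t in D) (A j (rv t))%:E)
      <= n%:R%:E * lebt n D)%E.
    rewrite limn_einf_lim; apply: lime_le; first exact: is_cvg_einfs.
    apply: nearW => j; apply: le_trans (bound j); apply: ereal_inf_lbound.
    by exists j => /=.
  apply: le_lt_trans fat (le_lt_trans le_lim _).
  by rewrite lte_mul_pinfty// lebesgue_tuple_ball.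
have iq : (lebt n).-integrable D (fun t => (dot (rv t) (rv t) * density (rv t))%:E).
  apply/integrableP; split => //.
  rewrite (eq_integral (fun t => (dot (rv t) (rv t) * density (rv t))%:E))//.
  move=> t; rewrite inE => Dt; rewrite /= ger0_norm// mulr_ge0 ?dot_ge0//.
  by rewrite ltW// density_gt0.
have i2 : (lebt n).-integrable D (EFin \o cst (2 : R)).
  apply: measurable_bounded_integrable => //; first exact: lebesgue_tuple_ball.
  exact: bounded_cst.
have i3 := integrableD mD i2 (integrableZl mD 2 iq).
apply: le_integrable i3 => // t Dt.
rewrite /= lee_fin ger0_norm; last by rewrite ltW// density_gt0.
apply: le_trans (ler_norm _).
have r0 := density_gt0 Dt; have s0 := dot_ge0 (rv t); have E := density_height Dt.
have h0 := height_gt0 Dt; have h2 := sqr_height Dt.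
have [s2|s2] := leP (dot (rv t) (rv t)) 2^-1; last first.
  rewrite mulrA; set r := density _ in r0 *; set s := dot _ _ in s2 *; nra.
have h12 : 2^-1 <= height (rv t).
  rewrite -(@ler_pXn2r _ 2)// ?nnegrE ?height_ge0// h2; lra.
have : density (rv t) <= 2.
  have : density (rv t) * 2^-1 <= density (rv t) * height (rv t) by rewrite ler_pM2l.
  rewrite E; lra.
have := mulr_ge0 s0 (ltW r0); lra.
Qed.

End integration_over_the_ball.
Arguments tuple_ball {R} n _.

(** * The divergence theorem on the sphere *)

Section divergence_on_the_sphere.
Context {R : realType}.
Local Notation tup n := (n.-tuple (measurableTypeR R)).
Local Notation rv := (@rv_of_tuple R _).
Local Notation lebt n := (@lebesgue_tuple R n).

Lemma compact_bound n (K : set 'rV[R]_n) (f : 'rV[R]_n -> R) : compact K ->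
  (forall x, K x -> {for x, continuous f}) ->
  exists2 C, 0 <= C & forall x, K x -> `|f x| <= C.
Proof.
move=> cK cf.
have [C [Cr fC]] : bounded_set (f @` K).
  apply/compact_bounded/continuous_compact => //.
  by apply: continuous_in_subspaceT => x; rewrite inE; exact: cf.
exists (`|C| + 1) => [|x Kx]; first exact: addr_ge0.
by apply: (fC (`|C| + 1)); [rewrite (le_lt_trans (ler_norm C))// ltrDl|exists x].
Qed.

Lemma compact_annulus n (a : R) :
  compact [set x : 'rV[R]_n | a <= dot x x <= 1].
Proof.
apply: bounded_closed_compact.
  exists 1; split; first exact: num_real.
  move=> e e1 x /= /andP[_ x1]; apply: le_trans (ltW e1).
  by rewrite leNgt; apply/negP => /norm_gt1_dot; rewrite ltNge x1.
rewrite (_ : [set _ | _] =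
    (fun x : 'rV[R]_n => dot x x) @^-1` [set s | a <= s] `&`
    (fun x : 'rV[R]_n => dot x x) @^-1` [set s | s <= 1]).
  apply: closedI.
    apply: (@closed_comp _ _ (fun x : 'rV[R]_n => dot x x)); last exact: closed_ge.
    by move=> x _; exact: continuous_dot_self.
  apply: (@closed_comp _ _ (fun x : 'rV[R]_n => dot x x)); last exact: closed_le.
  by move=> x _; exact: continuous_dot_self.
by apply/seteqP; split => x /=; [move=> /andP[]|move=> [-> ->]].
Qed.

Lemma compact_sphere n : compact (@sphere R n).
Proof.
rewrite (_ : @sphere R n = [set x | 1 <= dot x x <= 1]); first exact: compact_annulus.
apply/seteqP; split => x; rewrite /sphere/=; first by move=> ->; rewrite lexx.
by rewrite -eq_le => /eqP.
Qed.

Context {n : nat} (Y : 'I_n.+1 -> 'rV[R]_n.+1 -> R).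
Hypothesis CY : forall i, Ck 1 nonzero (Y i).
Hypothesis tanY : forall x : 'rV[R]_n.+1, x != 0 -> \sum_i x 0 i * Y i x = 0.

Local Notation h c := (@hemisphere R n c).

(** For a field tangent to all the spheres centred at 0 this is, on the unit
    sphere, the Riemannian divergence of the restriction. *)
Definition ambient_div (x : 'rV[R]_n.+1) : R := \sum_i partial i (Y i) x.

Lemma hemisphere_neq0 (c : R) (y : 'rV[R]_n) : c ^+ 2 = 1 -> dot y y < 1 ->
  hemisphere c y != 0.
Proof. by move=> c1 y1; apply/sphere_neq0/hemisphere_sphere. Qed.

Lemma ambient_div_continuous x : x != 0 -> {for x, continuous ambient_div}.
Proof.
move=> x0; rewrite (_ : ambient_div = \sum_i partial i (Y i)).
  apply: (@Ck_sum _ _ 0 nonzero) => // [|i]; first exact: open_nonzero.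
  exact: (CY i).2.
by apply/funext => z; rewrite fct_sumE.
Qed.

(** Differentiating the tangency condition along the axis of the charts. *)
Lemma tangent_partial0 x : x != 0 ->
  Y 0 x + \sum_i x 0 i * partial 0 (Y i) x = 0.
Proof.
move=> x0; pose c i := fun x : 'rV[R]_n.+1 => x 0 i.
have dY i : derivable (Y i) x (delta_mx 0 0).
  exact/diff_derivable/(Ck_differentiable (CY i)).
have dc i : derivable (c i) x (delta_mx 0 0) by exact/diff_derivable/differentiable_coord.
have : partial 0 (\sum_(i < n.+1) c i * Y i) x = 0.
  rewrite (@near_eq_derive _ _ _ _ (cst (0 : R))) ?derive_cst//.
  have : nbhs x nonzero by apply: open_nbhs_nbhs; split => //; exact: open_nonzero.
  by apply: filterS => z z0; rewrite fct_sumE tanY.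
rewrite derive_sum; last by move=> i; exact: derivableM.
under eq_bigr do rewrite (deriveM (dc _) (dY _)) derive_coord -![_ *: _]/(_ * _).
rewrite big_split/= => E; apply: etrans E; rewrite addrC; congr (_ + _).
apply: esym; rewrite (bigD1 0)//= mxE !eqxx mulr1 big1 ?addr0// => i i0.
by rewrite mxE (negbTE i0) mulr0.
Qed.

(** In a chart the components of Y other than the first one, times the density,
    form a field whose divergence is the density times [ambient_div Y]: the
    derivatives of the density compensate the derivative of the tangency
    condition. The radial component of that field is - c Y_0 by tangency, which
    is bounded although the density is not. *)
Lemma integral_cutoff_hemisphere (c d : R) : c ^+ 2 = 1 -> 0 < d ->
  let G y := cutoff d y * (density y * ambient_div (h c y)) -
             dcutoff d y * (- (c * Y 0 (h c y))) in
  (lebt n).-integrable (tuple_ball n) (fun t => (G (rv t))%:E) /\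
  (\int[lebt n]_(t in tuple_ball n) (G (rv t))%:E = 0)%E.
Proof.
move=> c1 d0; have oB := @open_unit_ball R n.
pose u i : 'rV[R]_n -> R := @density R n * (Y (lift 0 i) \o h c).
apply: (@integral_cutoff_ball R n d u
  (fun y => density y * ambient_div (h c y)) (fun y => - (c * Y 0 (h c y)))) => //.
- move=> i; apply: CkM => //; first exact: density_Ck.
  apply: (@Ck_comp _ _ _ _ _ nonzero) => //.
    by move=> y y1; exact: hemisphere_neq0.
  by move=> j; exact: hemisphere_coord_Ck.
- move=> y y1; set x := hemisphere c y.
  have x0 : x != 0 by exact: hemisphere_neq0.
  have xi i : x 0 (lift 0 i) = y 0 i by rewrite /x hemisphereE rcons0_lift.
  have x00 : x 0 0 = c * height y by rewrite /x hemisphereE rcons0_0.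
  have r1 := density_height y1.
  have E i : partial i (u i) y = density y * partial (lift 0 i) (Y (lift 0 i)) x +
     (density y ^+ 3 * (x 0 (lift 0 i) * Y (lift 0 i) x) -
      c * density y ^+ 2 * (x 0 (lift 0 i) * partial 0 (Y (lift 0 i)) x)).
    have dYx : differentiable (Y (lift 0 i)) x by exact: (Ck_differentiable (CY _)).
    have dYh : differentiable (Y (lift 0 i) \o h c) y.
      by apply: differentiable_comp => //; exact: differentiable_hemisphere.
    have dr := (density_diff y1).1.
    have d1 : derivable (@density R n) y (delta_mx 0 i) by exact: diff_derivable.
    have d2 : derivable (Y (lift 0 i) \o h c) y (delta_mx 0 i) by exact: diff_derivable.
    rewrite (deriveM d1 d2) (partial_hemisphere i y1 dYx) (density_diff y1).2.
    by rewrite dot_delta -![_ *: _]/(_ * _) -[(_ \o _) y]/(Y _ x) xi; ring.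
  under eq_bigr do rewrite E.
  rewrite big_split/= sumrB -!mulr_sumr.
  have t1 : \sum_(i < n) x 0 (lift 0 i) * Y (lift 0 i) x = - (c * height y * Y 0 x).
    have := tanY x0; rewrite big_ord_recl x00 => /eqP.
    by rewrite addrC addr_eq0 => /eqP.
  have t2 : \sum_(i < n) x 0 (lift 0 i) * partial 0 (Y (lift 0 i)) x =
      - Y 0 x - c * height y * partial 0 (Y 0) x.
    have := tangent_partial0 x0; rewrite big_ord_recl x00 => /eqP.
    by rewrite addrA addrC addr_eq0 => /eqP ->; rewrite opprD.
  rewrite t1 t2 /ambient_div [in RHS]big_ord_recl.
  set S := \sum_(i < n) _; set a := Y 0 x; set b := partial 0 (Y 0) x.
  have e1 : density y ^+ 3 * - (c * height y * a) =
      - (c * density y ^+ 2 * a) * (density y * height y) by ring.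
  have e2 : c * density y ^+ 2 * (- a - c * height y * b) =
      - (c * density y ^+ 2 * a) - c ^+ 2 * density y * b * (density y * height y) by ring.
  by rewrite e1 e2 r1 c1; ring.
move=> y y1; set x := hemisphere c y.
have x0 : x != 0 by exact: hemisphere_neq0.
have xi i : x 0 (lift 0 i) = y 0 i by rewrite /x hemisphereE rcons0_lift.
have x00 : x 0 0 = c * height y by rewrite /x hemisphereE rcons0_0.
have r1 := density_height y1.
have t1 : \sum_(i < n) x 0 (lift 0 i) * Y (lift 0 i) x = - (c * height y * Y 0 x).
  have := tanY x0; rewrite big_ord_recl x00 => /eqP.
  by rewrite addrC addr_eq0 => /eqP.
transitivity (density y * \sum_(i < n) x 0 (lift 0 i) * Y (lift 0 i) x).
  rewrite mulr_sumr; apply: eq_bigr => i _; rewrite xi.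
  by rewrite -[u i y]/(density y * Y (lift 0 i) x) mulrCA.
rewrite t1 mulrN; congr (- _).
by rewrite -[RHS]mul1r -r1; ring.
Qed.

End divergence_on_the_sphere.

Section sphere_divergence_theorem.
Context {R : realType}.
Local Notation tup n := (n.-tuple (measurableTypeR R)).
Local Notation rv := (@rv_of_tuple R _).
Local Notation lebt n := (@lebesgue_tuple R n).

(** The flux of the field [cutoff d * id]: the shells where the cutoff varies
    become thin, but the mass of its gradient stays bounded. *)
Lemma integral_dcutoff_le n (d : R) : 0 < d ->
  (lebt n).-integrable (tuple_ball n)
    (fun t => (dcutoff d (rv t) * dot (rv t) (rv t))%:E) /\
  (\int[lebt n]_(t in tuple_ball n) (dcutoff d (rv t) * dot (rv t) (rv t))%:E
    <= n%:R%:E * lebt n (tuple_ball n))%E.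
Proof.
move=> d0; set D := tuple_ball n; have mD : measurable D := @measurable_tuple_ball R n.
have mu_D : (lebt n D < +oo)%E := @lebesgue_tuple_ball R n.
pose c i := fun y : 'rV[R]_n => y 0 i.
have cP y : dot y y < 1 -> \sum_i partial i (c i) y = n%:R.
  move=> _; under eq_bigr do rewrite derive_coord mxE !eqxx.
  by rewrite sumr_const card_ord.
have cQ y : dot y y < 1 -> \sum_i y 0 i * c i y = dot y y by rewrite dotE.
have [iG G0] := integral_cutoff_ball d0 (fun i => Ck_coord 1 _ i) cP cQ.
pose G (y : 'rV[R]_n) := cutoff d y * n%:R - dcutoff d y * dot y y.
have iC : (lebt n).-integrable D (fun t => (cutoff d (rv t) * n%:R)%:E).
  apply: measurable_bounded_integrable => //.
    apply/measurable_EFinP; apply: (@measurable_ball_fun R n (fun y => cutoff d y * n%:R)).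
    move=> y _; apply: continuousM; [exact: continuous_cutoff|exact: cst_continuous].
  exists n%:R; split; first exact: num_real.
  move=> x nx t _ /=; apply: le_trans (ltW nx); rewrite normrM normr_nat.
  have /andP[x0 x1] := cutoff_ge0_le1 d (rv t).
  by rewrite ger0_norm// ler_piMl.
have E (t : tup n) : (dcutoff d (rv t) * dot (rv t) (rv t))%:E =
    ((cutoff d (rv t) * n%:R)%:E - (G (rv t))%:E)%E.
  by rewrite -EFinB /G opprB addrC subrK.
have iE := integrableB mD iC iG.
have iE' : (lebt n).-integrable D
    (fun t => (dcutoff d (rv t) * dot (rv t) (rv t))%:E).
  by apply: eq_integrable iE => // t _; rewrite E.
split => //; under eq_integral do rewrite E.
rewrite (integralB mD iC iG) -[X in (_ - X)%E]/(\int[lebt n]_(t in D) (G (rv t))%:E)%E.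
rewrite G0 sube0 -integral_cst//; apply: le_integral => //.
  apply: (@measurable_bounded_integrable _ _ _ _ (cst (n%:R : R))) => //.
  exact: bounded_cst.
move=> t _; rewrite lee_fin; have /andP[x0 x1] := cutoff_ge0_le1 d (rv t).
by apply: ler_piMl.
Qed.

Context {n : nat} (Y : 'I_n.+1 -> 'rV[R]_n.+1 -> R).
Hypothesis CY : forall i, Ck 1 nonzero (Y i).
Hypothesis tanY : forall x : 'rV[R]_n.+1, x != 0 -> \sum_i x 0 i * Y i x = 0.

Local Notation h c := (@hemisphere R n c).

(** The two points above y are 2 [height y] apart on a vertical segment that
    stays away from 0 as long as |y|^2 >= 1/2. *)
Lemma hemisphere_jump : exists2 C, 0 <= C & forall y, 2^-1 <= dot y y -> dot y y < 1 ->
  `|Y 0 (h 1 y) - Y 0 (h (-1) y)| <= C * height y.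
Proof.
have annulus_neq0 (x : 'rV[R]_n.+1) : 2^-1 <= dot x x <= 1 -> x != 0.
  move=> /andP[x2 _]; apply: contraTneq x2 => ->.
  by rewrite /dot mul0mx mxE -ltNge invr_gt0 ltr0n.
have [C C0 HC] := compact_bound (@compact_annulus R n.+1 2^-1)
  (fun x xA => (CY 0).2 (delta_mx 0 0) x (annulus_neq0 x xA)).
exists (C * 2) => [|y y2 y1]; first by rewrite mulr_ge0.
have s0 : 0 < 2 * height y by rewrite mulr_gt0// height_gt0.
have line t : h (-1) y + t *: delta_mx 0 0 = rcons0 (t - height y) y.
  by rewrite hemisphereE addrC rcons0_delta0 mulN1r.
have inA t : 0 <= t <= 2 * height y ->
    2^-1 <= dot (h (-1) y + t *: delta_mx 0 0) (h (-1) y + t *: delta_mx 0 0) <= 1.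
  move=> /andP[t0 t1]; rewrite line dot_rcons0; have h2 := sqr_height y1.
  have q0 := sqr_ge0 (t - height y).
  have q1 : 0 <= t * (2 * height y - t) by rewrite mulr_ge0// subr_ge0.
  apply/andP; split; first by lra.
  have -> : (t - height y) ^+ 2 = height y ^+ 2 - t * (2 * height y - t) by ring.
  by rewrite h2; lra.
have [t it E] : exists2 t, 0 <= t <= 2 * height y &
    Y 0 (h (-1) y + (2 * height y) *: delta_mx 0 0) - Y 0 (h (-1) y) =
    2 * height y * partial 0 (Y 0) (h (-1) y + t *: delta_mx 0 0).
  apply: mvt_line => // t it; apply: (Ck_differentiable (CY 0)).
  exact/annulus_neq0/inA.
have -> : h 1 y = h (-1) y + (2 * height y) *: delta_mx 0 0.
  by rewrite line hemisphereE mul1r; congr rcons0; ring.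
rewrite E normrM gtr0_norm// mulrC mulrA ler_wpM2r ?height_ge0//.
by rewrite ler_wpM2r// HC//=; exact: inA.
Qed.

(** With a cutoff near the equator, the two charts contribute boundary terms of
    opposite signs. Their sum involves the jump of Y_0 between the charts, which
    is of the order of the height, that is of sqrt d, against a gradient of the
    cutoff of bounded mass; it vanishes in the limit. *)
Theorem sphere_divergence :
  (\int[lebt n]_(t in tuple_ball n) (density (rv t) *
     (ambient_div Y (h 1 (rv t)) + ambient_div Y (h (-1) (rv t))))%:E = 0)%E.
Proof.
set D := tuple_ball n; have mD : measurable D := @measurable_tuple_ball R n.
have mu_D : (lebt n D < +oo)%E := @lebesgue_tuple_ball R n.
pose E (y : 'rV[R]_n) := density y * (ambient_div Y (h 1 y) + ambient_div Y (h (-1) y)).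
pose J (y : 'rV[R]_n) := Y 0 (h 1 y) - Y 0 (h (-1) y).
pose A j (y : 'rV[R]_n) := cutoff (radius_seq j) y * E y.
pose B j (y : 'rV[R]_n) := dcutoff (radius_seq j) y * J y.
have sq1 : (1 : R) ^+ 2 = 1 by rewrite expr1n.
have sqN1 : (-1 : R) ^+ 2 = 1 by rewrite sqrrN expr1n.
have [C C0 HC] := compact_bound (@compact_sphere R n)
  (fun x Sx => ambient_div_continuous CY (sphere_neq0 Sx)).
have cE y : dot y y < 1 -> {for y, continuous E}.
  move=> y1; apply: continuousM; first exact: (@density_Ck R n 0).
  apply: continuousD; apply: continuous_comp; try exact: continuous_hemisphere.
    by apply: ambient_div_continuous => //; exact: hemisphere_neq0.
  by apply: ambient_div_continuous => //; exact: hemisphere_neq0.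
have iE : (lebt n).-integrable D (fun t => (E (rv t))%:E).
  have iD := integrableZl mD (C + C) (@integrable_density R n).
  apply: le_integrable iD => //; first exact: measurable_ball_fun.
  move=> t Dt; rewrite /= lee_fin; apply: le_trans (ler_norm _).
  have r0 := density_gt0 Dt.
  rewrite /E normrM gtr0_norm// mulrC ler_wpM2r ?(ltW r0)//.
  apply: le_trans (ler_normD _ _) _.
  by apply: lerD; apply: HC; exact: hemisphere_sphere.
have mA j : measurable_fun D (fun t => (A j (rv t))%:E).
  apply: (@measurable_ball_fun R n (A j)) => y y1.
  by apply: continuousM; [exact: continuous_cutoff|exact: cE].
have leA j t : D t -> (`|(A j (rv t))%:E| <= `|(E (rv t))%:E|)%E.
  move=> Dt; rewrite lee_fin /A normrM.
  have /andP[x0 x1] := cutoff_ge0_le1 (radius_seq j) (rv t).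
  by rewrite ger0_norm// ler_piMl.
have iA j : (lebt n).-integrable D (fun t => (A j (rv t))%:E).
  by apply: le_integrable iE => // t Dt; exact: leA.
have AB j : (lebt n).-integrable D (fun t => (B j (rv t))%:E) /\
    (\int[lebt n]_(t in D) (A j (rv t))%:E =
     - \int[lebt n]_(t in D) (B j (rv t))%:E)%E.
  have [i1 e1] := integral_cutoff_hemisphere CY tanY sq1 (radius_seq_gt0 j).
  have [i2 e2] := integral_cutoff_hemisphere CY tanY sqN1 (radius_seq_gt0 j).
  have i12 := integrableD mD i1 i2.
  have e12 := integralD mD i1 i2.
  rewrite [X in (X + _)%E]e1 [X in (_ + X)%E]e2 adde0 in e12.
  have iAB : (lebt n).-integrable D (fun t => (A j (rv t) + B j (rv t))%:E).
    apply: eq_integrable i12 => // t _; rewrite -EFinD; congr (_%:E).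
    rewrite /A /B /E /J; ring.
  have eAB : (\int[lebt n]_(t in D) (A j (rv t) + B j (rv t))%:E = 0)%E.
    rewrite -[RHS]e12; apply: eq_integral => t _; rewrite -EFinD; congr (_%:E).
    rewrite /A /B /E /J; ring.
  have iB : (lebt n).-integrable D (fun t => (B j (rv t))%:E).
    have := integrableB mD iAB (iA j); apply: eq_integrable => // t _.
    by rewrite -EFinB addrC addKr.
  split => //; rewrite -[RHS]sub0e -eAB -(integralB mD iAB iB).
  by apply: eq_integral => t _; rewrite -EFinB addrK.
have [C' C'0 HJ] := hemisphere_jump.
(* On the support of the gradient of the cutoff the height is at most
   sqrt (2 d), and |y|^2 >= 1/2 since d <= 1/4. *)
pose k j := 2 * C' * Num.sqrt (2 * radius_seq j).
have k0 j : 0 <= k j by rewrite mulr_ge0 ?sqrtr_ge0// mulr_ge0.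
have leB j t : D t -> `|B j (rv t)| <=
    k j * (dcutoff (radius_seq j) (rv t) * dot (rv t) (rv t)).
  move=> Dt; set d := radius_seq j; set y := rv t.
  have d0 : 0 < d := radius_seq_gt0 j; have d4 : d <= 4^-1 := radius_seq_le j.
  have dc0 := dcutoff_ge0 y d0.
  have [yd|yd] := leP (2 * d) (1 - dot y y).
    have z0 : dcutoff d y = 0.
      rewrite /dcutoff dstep_eq0 ?mulr0//; right.
      by rewrite lerBrDr ler_pdivlMr//; lra.
    by rewrite /B -/d -/y z0 mul0r normr0 !mul0r mulr0.
  have y2 : 2^-1 <= dot y y by lra.
  have hd : height y <= Num.sqrt (2 * d) by rewrite ler_wsqrtr// ltW.
  rewrite /B -/d -/y normrM ger0_norm// mulrCA ler_wpM2l//.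
  apply: le_trans (HJ y y2 Dt) _.
  have h1 : C' * height y <= C' * Num.sqrt (2 * d) by rewrite ler_wpM2l.
  have h2 : 0 <= C' * Num.sqrt (2 * d) by rewrite mulr_ge0 ?sqrtr_ge0.
  rewrite /k -/d; nra.
have leI j : (`|\int[lebt n]_(t in D) (A j (rv t))%:E| <=
    (k j)%:E * (n%:R%:E * lebt n D))%E.
  have [iB ->] := AB j; rewrite abseN.
  have [iQ leQ] := @integral_dcutoff_le n _ (radius_seq_gt0 j).
  apply: le_trans (le_abse_integral _ mD (measurable_int _ iB)) _.
  apply: le_trans (_ : (_ <= \int[lebt n]_(t in D) ((k j)%:E *
     (dcutoff (radius_seq j) (rv t) * dot (rv t) (rv t))%:E))%E) _.
    apply: le_integral => //; first exact: integrable_abse.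
      exact: integrableZl.
    by move=> t; rewrite inE => Dt; rewrite /= lee_fin leB.
  by rewrite integralZl//; apply: lee_wpmul2l => //; rewrite lee_fin.
have cvgA : (\int[lebt n]_(t in D) (A j (rv t))%:E)%E @[j --> \oo] -->
    (\int[lebt n]_(t in D) (E (rv t))%:E)%E.
  have ae1 : {ae lebt n, forall t, D t ->
      (A j (rv t))%:E @[j --> \oo] --> (E (rv t))%:E}.
    by apply: aeW => t Dt; exact: cvg_cutoffM.
  have ae2 : {ae lebt n, forall t j, D t ->
      `|(A j (rv t))%:E| <= `|(E (rv t))%:E|}%E.
    by apply: aeW => t j Dt; exact: leA.
  by have [] := @dominated_convergence _ _ R (lebt n) D mD
    (fun j t => (A j (rv t))%:E) (fun t => (E (rv t))%:E)
    (fun t => `|(E (rv t))%:E|%E) mA (measurable_int _ iE) ae1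
    (integrable_abse iE) ae2.
have cvg0 : (\int[lebt n]_(t in D) (A j (rv t))%:E)%E @[j --> \oo] --> 0%E.
  apply/cvg_abse0P.
  apply: (@squeeze_cvge _ _ _ _ (fun=> 0%E) _ (fun j => (k j)%:E * (n%:R%:E * lebt n D))%E).
  - by apply: nearW => j; rewrite abse_ge0 leI.
  - exact: cvg_cst.
  - have -> : (n%:R%:E * lebt n D)%E = (n%:R * fine (lebt n D))%:E.
      by rewrite EFinM fineK// ge0_fin_numE.
    have k_to0 : k j @[j --> \oo] --> 0.
      rewrite -[X in _ --> X](mulr0 (2 * C')); apply: cvgM; first exact: cvg_cst.
      rewrite -[X in _ --> X]sqrtr0 -[X in Num.sqrt X](mulr0 (2 : R)).
      apply: (@cvg_comp _ _ _ (fun j => 2 * radius_seq j) Num.sqrt).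
        by apply: cvgM; [exact: cvg_cst|exact: cvg_radius_seq].
      exact: sqrt_continuous.
    under eq_fun do rewrite -EFinM.
    apply: cvg_EFin; first exact: nearW.
    rewrite -[X in _ --> X](mul0r (n%:R * fine (lebt n D))).
    by apply: cvgM; [exact: k_to0|exact: cvg_cst].
exact: (cvg_unique _ cvgA cvg0).
Qed.

End sphere_divergence_theorem.

(** * Regular zeros are negligible *)

Section regular_zeros_are_negligible.
Context {R : realType}.
Local Notation tup n := (n.-tuple (measurableTypeR R)).
Local Notation rv := (@rv_of_tuple R _).
Local Notation lebt n := (@lebesgue_tuple R n).

(** Two rationals around a point, chosen within its isolation radius,
    determine the point. *)
Lemma countable_isolated (A : set R) :
  (forall a, A a -> exists2 r, 0 < r & forall b, A b -> `|b - a| < r -> b = a) ->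
  countable A.
Proof.
move=> isoA.
have /choice[c cP] (a : R) : exists pq : rat * rat, A a ->
    ratr pq.1 < a < ratr pq.2 /\
    forall b, A b -> ratr pq.1 < b < ratr pq.2 -> b = a.
  have [Aa|nAa] := pselect (A a); last by exists (0%R, 0%R).
  have [r r0 rA] := isoA a Aa.
  have [p] : exists p, ratr p \in `]a - r, a[ by apply: rat_in_itvoo; rewrite ltrBlDr ltrDl.
  have [q] : exists q, ratr q \in `]a, a + r[ by apply: rat_in_itvoo; rewrite ltrDl.
  rewrite !in_itv/= => /andP[q1 q2] /andP[p1 p2]; exists (p, q) => _.
  split => [|b Ab /andP[b1 b2]]; first by rewrite /= p2 q1.
  apply: rA => //; rewrite ltr_distl.
  by rewrite (lt_trans p1 b1) (lt_trans b2 q2).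
apply/countable_injP; exists (pickle \o c) => a b; rewrite !inE => Aa Ab.
move=> /(pcan_inj pickleK) cab; have [_ ca] := cP a Aa; have [cb _] := cP b Ab.
by apply: esym; apply: ca => //; rewrite cab.
Qed.

Lemma isolated_zero (f : R -> R) (a d : R) : is_derive a 1 f d -> d != 0 ->
  f a = 0 -> exists2 r, 0 < r & forall b, f b = 0 -> `|b - a| < r -> b = a.
Proof.
move=> [df <-] d0 fa.
have d0' : 0 < `|'D_1 f a| by rewrite normr_gt0.
have /cvgrPdist_lt/(_ _ d0') : h^-1 *: (f (h *: 1 + a) - f a) @[h --> 0^'] --> 'D_1 f a.
  exact: df.
rewrite near_withinE => /nbhs_ballP[r /= r0 Hr]; exists r => // b fb ba.
apply/eqP; apply: contraT => neq_ba.
have := Hr (b - a); rewrite -ball_normE /= sub0r normrN subr_eq0 => /(_ ba neq_ba).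
by rewrite [_ *: 1]mulr1 subrK fb fa subrr scaler0 subr0 ltxx.
Qed.

(** On each line in direction i the zeros with nonzero derivative are isolated. *)
Lemma regular_zeros_negligible n (O : set 'rV[R]_n) (g : 'rV[R]_n -> R) i :
  open O -> Ck 1 O g ->
  (lebt n).-negligible (rv @^-1` [set y | [/\ O y, g y = 0 & partial i g y != 0]]).
Proof.
move=> oO Cg; set S := [set y | _].
have mS : measurable (rv @^-1` S : set (tup n)).
  have m1 : measurable_fun (rv @^-1` O : set (tup n)) (g \o rv).
    by apply: measurable_fun_rv => // y Oy; exact: Ck_continuous Cg Oy.
  have m2 : measurable_fun (rv @^-1` O : set (tup n)) (partial i g \o rv).
    by apply: measurable_fun_rv => // y Oy; exact: (Cg.2 (delta_mx 0 i) y Oy).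
  have mO : measurable (rv @^-1` O : set (tup n)) by exact: measurable_preimage_rv.
  rewrite [X in measurable X](_ : _ =
    (rv @^-1` O `&` (g \o rv) @^-1` [set 0]) `&`
    (rv @^-1` O `&` (partial i g \o rv) @^-1` (~` [set 0]))).
    apply: measurableI; first exact: (m1 mO _ (measurable_set1 0)).
    exact: (m2 mO _ (measurableC (measurable_set1 0))).
  apply/seteqP; split => t /=; first by move=> [? ? /eqP].
  by move=> [[? ?] [_ /eqP]].
exists (rv @^-1` S); split => //; apply: (null_of_countable_slices mS (i := i)) => y.
apply: countable_isolated => s [Os gs dgs].
have [r r0 Hr] : exists2 r, 0 < r & forall b, g (y + b *: delta_mx 0 i) = 0 ->
    `|b - s| < r -> b = s.
  have E : s *: delta_mx 0 i + y = y + s *: delta_mx 0 i by rewrite addrC.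
  apply: (@isolated_zero (fun s => g (y + s *: delta_mx 0 i)) s
            (partial i g (y + s *: delta_mx 0 i))); rewrite -?E//.
  rewrite E; apply: is_derive_line; rewrite -E; exact: (Ck_differentiable Cg).
by exists r => // b [_ gb _]; apply: Hr; rewrite addrC.
Qed.

End regular_zeros_are_negligible.

(** * Integration over compact subsets of the sphere *)

Section charts_and_compact_sets.
Context {R : realType}.
Local Notation tup n := (n.-tuple (measurableTypeR R)).
Local Notation rv := (@rv_of_tuple R _).
Local Notation lebt n := (@lebesgue_tuple R n).

Lemma measurable_hemisphere_domain n (c : R) (K : set 'rV[R]_n.+1) : closed K ->
  measurable (hemisphere_domain c K).
Proof.
move=> cK; rewrite (_ : hemisphere_domain c K =
    tuple_ball n `&` rv @^-1` (@hemisphere R n c @^-1` K))//.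
apply: measurableI; first exact: measurable_tuple_ball.
apply: measurable_closed_rv; apply: closed_comp => // y _.
exact: continuous_hemisphere.
Qed.

Lemma hemisphere_domain_ball n (c : R) (K : set 'rV[R]_n.+1) :
  hemisphere_domain c K `<=` tuple_ball n.
Proof. by move=> t []. Qed.

Lemma measurable_domain_fun n (c : R) (K O : set 'rV[R]_n.+1) (f : 'rV[R]_n.+1 -> R) :
  closed K -> open O -> K `<=` O -> (forall x, O x -> {for x, continuous f}) ->
  measurable_fun (hemisphere_domain c K)
    (fun t => (density (rv t) * f (hemisphere c (rv t)))%:E).
Proof.
move=> cK oO KO cf; apply/measurable_EFinP.
pose W := @unit_ball R n `&` @hemisphere R n c @^-1` O.
have oW : open W.
  apply: openI; first exact: open_unit_ball.
  by apply: open_comp => // y _; exact: continuous_hemisphere.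
apply: (@measurable_funS _ _ _ _ (rv @^-1` W)).
- exact: measurable_preimage_rv.
- by move=> t [t1 /KO Ot].
- apply: (@measurable_fun_rv _ _ W (fun y => density y * f (hemisphere c y))) => //.
  move=> y [y1 Oy]; apply: continuousM; first exact: (@density_Ck R n 0).
  apply: continuous_comp; first exact: continuous_hemisphere.
  exact: cf.
Qed.

Lemma integrable_domain_density n (c : R) (K : set 'rV[R]_n.+1) : closed K ->
  (lebt n).-integrable (hemisphere_domain c K) (fun t => (density (rv t))%:E).
Proof.
move=> cK; apply: integrableS (@integrable_density R n) => //.
- exact: measurable_tuple_ball.
- exact: measurable_hemisphere_domain.
- exact: hemisphere_domain_ball.
Qed.

Lemma integrable_domain_fun n (c : R) (K O : set 'rV[R]_n.+1) (f : 'rV[R]_n.+1 -> R) :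
  compact K -> open O -> K `<=` O -> (forall x, O x -> {for x, continuous f}) ->
  (lebt n).-integrable (hemisphere_domain c K)
    (fun t => (density (rv t) * f (hemisphere c (rv t)))%:E).
Proof.
move=> cK oO KO cf.
have clK : closed K by apply: compact_closed => //; exact: norm_hausdorff.
have mD := measurable_hemisphere_domain c clK.
have [C C0 HC] := compact_bound cK (fun x Kx => cf x (KO x Kx)).
have iC := integrableZl mD C (@integrable_domain_density n c K clK).
apply: le_integrable iC => //; first exact: (@measurable_domain_fun n c K O f clK oO KO cf).
move=> t [t1 Kt]; rewrite /= lee_fin; apply: le_trans (ler_norm _).
have r0 := density_gt0 t1; rewrite normrM gtr0_norm// mulrC ler_wpM2r ?(ltW r0)//.
exact: HC.
Qed.

(** In a chart around a point that is not on the boundary the first coordinate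
    is positive, and it stays so nearby. *)
Lemma interior_or_boundary m (K : set 'rV[R]_m.+2) : submanifold_with_boundary K ->
  forall x, K x -> manifold_boundary K x \/
    exists W, [/\ open W, W x & W `&` @sphere R m.+1 `<=` K].
Proof.
move=> [KS chartK] x Kx; have [phi chart_phi] := chartK x Kx.
have [phi0|phi0] := eqVneq (phi x 0 0) 0; first by left; split => //; exists phi.
right; have [W [V [psi [oW Wx oV [[sphi _] _ _ _] KW]]]] := chart_phi.
have Sx : sphere x by exact: KS.
have [W' [F [oW' W'x CF Fphi]]] := sphi x (conj Wx Sx).
have cF : {for x, continuous (fun z => F z 0 0)}.
  by apply: (Ck_continuous (Cr_on_Ck 0 oW' (CF 0))).
have F0 : 0 < F x 0 0.
  rewrite Fphi// lt_neqAle eq_sym phi0/=.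
  by apply/(KW x (conj Wx Sx)).
have n1 : nbhs x (fun z => 0 < F z 0 0).
  apply: (cF [set s | 0 < s]).
  by apply: open_nbhs_nbhs; split => //; exact: open_gt.
have n2 : nbhs x W by exact: open_nbhs_nbhs.
have n3 : nbhs x W' by exact: open_nbhs_nbhs.
have : nbhs x [set z | [/\ 0 < F z 0 0, W z & W' z]].
  by apply: filterS3 n1 n2 n3 => z; split.
rewrite nbhsE => -[B [oB Bx] BF]; exists B; split => // z [/BF[Fz Wz W'z] Sz].
by apply/(KW z (conj Wz Sz)); rewrite -Fphi//; exact: ltW.
Qed.

End charts_and_compact_sets.

(** * The divergence theorem for fields vanishing on the frontier of a compact set *)

Section divergence_on_compact_sets.
Context {R : realType} {n : nat}.
Local Notation tup n := (n.-tuple (measurableTypeR R)).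
Local Notation rv := (@rv_of_tuple R _).
Local Notation lebt n := (@lebesgue_tuple R n).
Local Notation V := 'rV[R]_n.+1.
Local Notation h c := (@hemisphere R n c).

Variables (W K : set V).
Hypotheses (oW : open W) (cK : compact K) (KS : K `<=` @sphere R n) (KW : K `<=` W).
Let O := cone W.

Variable Y : 'I_n.+1 -> V -> R.
Hypothesis CY : forall i, Ck 1 O (Y i).
Hypothesis tanY : forall x : V, O x -> \sum_i x 0 i * Y i x = 0.

Variable w : 'I_n.+1 -> V -> R.
Hypothesis Cw : forall j, Ck 1 O (w j).
Hypothesis wZ : forall j (a : R) z, 0 < a -> w j (a *: z) = w j z.
Hypothesis w_frontier : forall x, K x -> (forall j, w j x = 0) \/
  exists W', [/\ open W', W' x & W' `&` @sphere R n `<=` K].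

Let q : V -> R := \sum_j w j * w j.
Hypothesis Yq : exists2 C, 0 <= C & forall x, K x ->
  `|\sum_i partial i q x * Y i x| <= C * q x.
Hypothesis Yw : forall x, K x -> (forall j, w j x = 0) ->
  (forall i j, partial i (w j) x = 0) -> ambient_div Y x = 0.

Let oO : open O. Proof. exact: open_cone. Qed.

Let KO : K `<=` O.
Proof. by move=> x Kx; apply: cone_sphere; [exact: KS|exact: KW]. Qed.

Let clK : closed K.
Proof. by apply: compact_closed => //; exact: norm_hausdorff. Qed.

Let qE x : q x = \sum_j w j x ^+ 2.
Proof. by rewrite /q fct_sumE. Qed.

Let q_ge0 x : 0 <= q x.
Proof. by rewrite qE sumr_ge0// => j _; exact: sqr_ge0. Qed.

Let q_eq0 x : q x = 0 -> forall j, w j x = 0.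
Proof.
rewrite qE => /eqP; rewrite psumr_eq0 => [/allP h j|j _]; last exact: sqr_ge0.
by have := h j (mem_index_enum _); rewrite sqrf_eq0 => /eqP.
Qed.

Let Cq : Ck 1 O q.
Proof. by apply: (Ck_sum oO) => j; exact: (CkM oO (Cw j) (Cw j)). Qed.

(** [Ye e] is Y multiplied by a cutoff that vanishes where q <= e, extended by 0
    outside the cone over K. It is of class C^1 off the origin, since w and
    hence the cutoff vanish near the frontier of K. *)
Let S (e : R) (x : V) : R := step (e^-1 * q x - 1).
Let Ye (e : R) i (x : V) : R := if `[< K (radial x) >] then S e x * Y i x else 0.

Let S_diff e x : O x -> differentiable (S e) x /\
  forall d, 'D_d (S e) x = 'D_d q x * (e^-1 * dstep (e^-1 * q x - 1)).
Proof.
move=> Ox; pose p s : R := e^-1 * s - 1.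
have dp : is_derive (q x) 1 p e^-1.
  rewrite (_ : p = e^-1 *: id - cst 1)//.
  by apply: is_derive_eq; rewrite subr0 -[_ *: _]/(_ * _) mulr1.
have [dsp vsp] := is_derive_comp dp (is_derive_step (p (q x))).
have [d1 d2] := derivable_comp1 (Ck_differentiable Cq Ox) dsp.
split => // d; rewrite -[S e]/((step \o p) \o q) d2 vsp.
by congr (_ * _); rewrite mulrC.
Qed.

Let S_Ck e : Ck 1 O (S e).
Proof.
split=> [x Ox|d]; first exact: (S_diff e Ox).1.
apply: (@Ck_ext _ _ 0 O ('D_d q * (fun x => e^-1 * dstep (e^-1 * q x - 1)))) => //.
  by move=> x Ox; rewrite (S_diff e Ox).2.
move=> x Ox; apply: continuousM; first exact: (Cq.2 d).
apply: (@continuous_comp _ _ _ q (fun s => e^-1 * dstep (e^-1 * s - 1))).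
  exact: Ck_continuous Cq Ox.
apply: cvgM; first exact: cvg_cst.
apply: (@continuous_comp _ _ _ (fun s => e^-1 * s - 1) dstep).
  by apply: cvgB; [apply: cvgM; [exact: cvg_cst|exact: cvg_id]|exact: cvg_cst].
exact: continuous_dstep.
Qed.

Let Ye_near e x : 0 < e -> K (radial x) -> O x -> exists D, [/\ open D, D x &
  forall z, D z -> O z /\ forall i, Ye e i z = S e z * Y i z].
Proof.
move=> e0 Kx Ox; have x0 := cone_nonzero Ox.
have qx : q x = q (radial x).
  by rewrite !qE; apply: eq_bigr => j _; rewrite wZ// inv_norm_gt0.
have [wx|[W' [oW' W'x W'K]]] := w_frontier Kx.
  have q0 : q x = 0 by rewrite qx qE big1// => j _; rewrite wx expr0n.
  have n1 : nbhs x (fun z => q z < e).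
    have cq := Ck_continuous Cq Ox; apply: (cq [set s | s < e]).
    by rewrite q0; apply: open_nbhs_nbhs; split => //; exact: open_lt.
  have n2 : nbhs x O by exact: open_nbhs_nbhs.
  have : nbhs x [set z | q z < e /\ O z] by apply: filterS2 n1 n2 => z; split.
  rewrite nbhsE => -[B [oB Bx] BF]; exists B; split => // z /BF[qz Oz].
  have Sz : S e z = 0.
    by apply: step_eq0; rewrite subr_le0 mulrC ler_pdivrMr// mul1r ltW.
  by split => // i; rewrite /Ye Sz mul0r; case: asboolP.
exists (O `&` cone W'); split; first by apply: openI => //; exact: open_cone.
  by [].
move=> z [Oz [z0 W'z]]; split => // i; rewrite /Ye; case: asboolP => // nK.
by exfalso; apply: nK; apply: W'K; split => //; exact: radial_sphere.
Qed.

Let Ye_out e x : x != 0 -> ~ K (radial x) -> exists D, [/\ open D, D x &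
  forall z, D z -> forall i, Ye e i z = 0].
Proof.
move=> x0 nK; exists (cone (~` K)); split => //.
  by apply: open_cone; rewrite openC.
by move=> z [_ nKz] i; rewrite /Ye; case: asboolP.
Qed.

Let Ye_Ck e i : 0 < e -> Ck 1 nonzero (Ye e i).
Proof.
move=> e0; apply: Ck_local => x x0.
have [Kx|nK] := pselect (K (radial x)).
  have Ox : O x by split => //; exact: KW.
  have [D [oD Dx H]] := Ye_near e0 Kx Ox; exists D => //.
  apply: (@Ck_ext _ _ 1 D (S e * Y i)) => //.
    by move=> z /H[_ ->].
  have SY : Ck 1 O (S e * Y i) := CkM oO (S_Ck e) (CY i).
  by apply: Ck_sub SY => z /H[].
have [D [oD Dx H]] := Ye_out e x0 nK; exists D => //.
apply: (@Ck_ext _ _ 1 D (cst 0)) => //; last exact: Ck_cst.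
by move=> z /H ->.
Qed.

Let Ye_tan e (x : V) : x != 0 -> \sum_i x 0 i * Ye e i x = 0.
Proof.
move=> x0; rewrite /Ye; case: asboolP => Kx; last by rewrite big1// => i _; rewrite mulr0.
have Ox : O x by split => //; exact: KW.
by under eq_bigr do rewrite mulrCA; rewrite -mulr_sumr tanY// mulr0.
Qed.

Let div_Ye e x : 0 < e -> K x -> ambient_div (Ye e) x =
  S e x * ambient_div Y x +
  e^-1 * dstep (e^-1 * q x - 1) * \sum_i partial i q x * Y i x.
Proof.
move=> e0 Kx; have Ox := KO Kx; have Sx := KS Kx.
have Krx : K (radial x) by rewrite radial_id.
have [D [oD Dx H]] := Ye_near e0 Krx Ox.
rewrite /ambient_div !mulr_sumr -big_split/=; apply: eq_bigr => i _.
rewrite (@near_eq_derive _ _ _ _ (S e * Y i)); last first.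
  by have := open_nbhs_nbhs (conj oD Dx); apply: filterS => z /H[_ ->].
have d1 : derivable (S e) x (delta_mx 0 i) by exact/diff_derivable/(S_diff e Ox).1.
have d2 : derivable (Y i) x (delta_mx 0 i) by exact/diff_derivable/(Ck_differentiable (CY i)).
rewrite (deriveM d1 d2) (S_diff e Ox).2 -![_ *: _]/(_ * _); ring.
Qed.

Let div_Ye_out e x : sphere x -> ~ K x -> ambient_div (Ye e) x = 0.
Proof.
move=> Sx nK; have nKr : ~ K (radial x) by rewrite radial_id.
have [D [oD Dx H]] := Ye_out e (sphere_neq0 Sx) nKr.
rewrite /ambient_div big1// => i _.
rewrite (@near_eq_derive _ _ _ _ (cst (0 : R))) ?derive_cst//.
by have := open_nbhs_nbhs (conj oD Dx); apply: filterS => z /H ->.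
Qed.

Let div_continuous x : O x -> {for x, continuous (ambient_div Y)}.
Proof.
move=> Ox; rewrite (_ : ambient_div Y = \sum_i partial i (Y i)).
  by apply: (@Ck_sum _ _ 0 O) => // i; exact: (CY i).2.
by apply/funext => z; rewrite fct_sumE.
Qed.

(** The derivative of the cutoff is of order 1/e, but it only acts where
    q < 2 e, and its coefficient is of order q by [Yq]. *)
Let div_Ye_bound : exists2 C, 0 <= C & forall e x, 0 < e -> K x ->
  `|ambient_div (Ye e) x| <= C /\ `|ambient_div Y x| <= C.
Proof.
have [C C0 HC] := compact_bound cK (fun x Kx => div_continuous (KO Kx)).
have [C' C'0 HC'] := Yq.
exists (C + 4 * C') => [|e x e0 Kx]; first by rewrite addr_ge0// mulr_ge0.
split; last by apply: le_trans (HC x Kx) _; rewrite lerDl mulr_ge0.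
rewrite div_Ye//; apply: le_trans (ler_normD _ _) _; apply: lerD.
  have /andP[s0 s1] : 0 <= S e x <= 1 := step_ge0_le1 _.
  rewrite normrM ger0_norm//; apply: le_trans (HC x Kx).
  by apply: ler_piMl.
have /andP[d0 d2] := dstep_ge0_le2 (e^-1 * q x - 1).
have [qe|qe] := leP (2 * e) (q x).
  rewrite dstep_eq0 ?mulr0 ?mul0r ?normr0 ?mulr_ge0//; right.
  by rewrite lerBrDr mulrC ler_pdivlMr//; lra.
have ei0 : 0 <= e^-1 by rewrite invr_ge0 ltW.
have de0 : 0 <= e^-1 * dstep (e^-1 * q x - 1) := mulr_ge0 ei0 d0.
rewrite normrM (ger0_norm de0).
apply: (@le_trans _ _ (e^-1 * 2 * (C' * (2 * e)))); last first.
  have -> : e^-1 * 2 * (C' * (2 * e)) = 4 * C' by field; exact: lt0r_neq0.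
  by [].
apply: ler_pM => //; first by rewrite ler_wpM2l.
by apply: le_trans (HC' x Kx) _; rewrite ler_wpM2l// ltW.
Qed.

Let D c : set (tup n) := hemisphere_domain c K.

Let mD c : measurable (D c). Proof. exact: measurable_hemisphere_domain. Qed.

Let iD c : (lebt n).-integrable (D c) (fun t => (density (rv t))%:E).
Proof. exact: integrable_domain_density. Qed.

Let measurable_div_Ye c e : 0 < e -> measurable_fun (D c)
  (fun t => (density (rv t) * ambient_div (Ye e) (h c (rv t)))%:E).
Proof.
move=> e0; apply: (@measurable_domain_fun R n c K nonzero) => //.
- exact: open_nonzero.
- by move=> x /KS; exact: sphere_neq0.
- by move=> x x0; apply: ambient_div_continuous => // i; exact: Ye_Ck.
Qed.

Let measurable_div c : measurable_fun (D c)
  (fun t => (density (rv t) * ambient_div Y (h c (rv t)))%:E).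
Proof. by apply: (@measurable_domain_fun R n c K O) => //; exact: div_continuous. Qed.

Let integrable_div c :
  (lebt n).-integrable (D c)
    (fun t => (density (rv t) * ambient_div Y (h c (rv t)))%:E).
Proof. exact: (@integrable_domain_fun R n c K O _ cK oO KO div_continuous). Qed.

(** Where w does not vanish the cutoff is eventually 1. Where it vanishes, its
    differential does as well off a null set, by [regular_zeros_negligible] in
    the chart and Euler's relation in the radial direction; there both sides
    are 0 by [Yw]. *)
Let cvg_div_Ye c : c ^+ 2 = 1 -> {ae lebt n, forall t, D c t ->
  (density (rv t) * ambient_div (Ye (harmonic j)) (h c (rv t)))%:E @[j --> \oo] -->
  (density (rv t) * ambient_div Y (h c (rv t)))%:E}.
Proof.
move=> c1; pose B := @unit_ball R n `&` h c @^-1` O.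
have oB : open B.
  apply: openI; first exact: open_unit_ball.
  by apply: open_comp => // y _; exact: continuous_hemisphere.
have Cwh j : Ck 1 B (w j \o h c).
  apply: (@Ck_comp _ _ _ 1 B O) => //; first by move=> y [].
  move=> i; apply: (@Ck_sub _ _ _ (@unit_ball R n)); first by move=> y [].
  exact: hemisphere_coord_Ck.
have aeZ : {ae lebt n, forall t, forall ij : 'I_n.+1 * 'I_n,
    ~ [/\ B (rv t), (w ij.1 \o h c) (rv t) = 0 &
       partial ij.2 (w ij.1 \o h c) (rv t) != 0]}.
  apply: filter_forall => ij.
  apply: negligibleS (regular_zeros_negligible ij.2 oB (Cwh ij.1)) => t.
  by move=> /contrapT.
apply: filterS aeZ => t nZ [t1 Kt].
set y := rv t; set x := h c y.
have Ox : O x by exact: KO.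
have Sx : sphere x by exact: KS.
suff cvg_div : ambient_div (Ye (harmonic j)) x @[j --> \oo] --> ambient_div Y x.
  apply: cvg_EFin; first exact: nearW.
  by apply: cvgM; [exact: cvg_cst|exact: cvg_div].
have [q0|q0] := eqVneq (q x) 0.
  have wx := q_eq0 q0.
  have dw i j : partial i (w j) x = 0.
    have dwj : differentiable (w j) x by exact: (Ck_differentiable (Cw j)).
    have dl l : partial (lift 0 l) (w j) x = c * y 0 l * density y * partial 0 (w j) x.
      apply/eqP; rewrite -subr_eq0 -partial_hemisphere//.
      apply: contraT => neq0; exfalso; apply: (nZ (j, l)); split => //.
      exact: wx.
    have d0 : partial 0 (w j) x = 0.
      have := derive_homogeneous0 (wZ j) dwj.
      rewrite derive_partial// big_ord_recl {1}/x hemisphereE rcons0_0.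
      under eq_bigr do rewrite dl {1}/x hemisphereE rcons0_lift.
      have -> : \sum_(l < n) y 0 l * (c * y 0 l * density y * partial 0 (w j) x) =
          dot y y * (c * density y * partial 0 (w j) x).
        by rewrite dotE mulr_suml; apply: eq_bigr => l _; ring.
      have r1 := density_height t1; have h2 := sqr_height t1.
      have -> : c * height y * partial 0 (w j) x +
          dot y y * (c * density y * partial 0 (w j) x) =
          c * density y * partial 0 (w j) x.
        rewrite -[X in X + _]mulr1 -r1 -/y.
        transitivity (c * density y * partial 0 (w j) x * (height y ^+ 2 + dot y y)).
          by ring.
        by rewrite h2 subrK mulr1.
      move=> /eqP; rewrite !mulf_eq0 (gt_eqF (density_gt0 t1)) orbF.
      move=> /orP[/eqP c0|/eqP//]; move: c1; rewrite c0 expr0n/= => /eqP.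
      by rewrite eq_sym oner_eq0.
    by case: (unliftP 0 i) => [l|] ->; rewrite ?dl d0 ?mulr0.
  rewrite (Yw Kt wx dw).
  apply: cvg_trans (@cvg_cst _ (0 : R) _ \oo _); apply: near_eq_cvg.
  apply: nearW => j; rewrite div_Ye ?harmonic_gt0//.
  rewrite (Yw Kt wx dw) mulr0 add0r q0 mulr0 sub0r dstep_eq0 ?mulr0 ?mul0r//.
  by left; rewrite oppr_le0.
have {}q0 : 0 < q x by rewrite lt_neqAle eq_sym q0 q_ge0.
apply: cvg_trans (@cvg_cst _ (ambient_div Y x) _ \oo _); apply: near_eq_cvg.
have q20 : 0 < q x / 2 by rewrite divr_gt0.
have /cvgrPdist_lt/(_ _ q20) := @cvg_harmonic R.
apply: filterS => j; have e0 := @harmonic_gt0 R j.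
rewrite sub0r normrN gtr0_norm// => qj; rewrite div_Ye//.
have le1 : 1 <= (harmonic j)^-1 * q x - 1.
  rewrite lerBrDr mulrC ler_pdivlMr//; lra.
by rewrite /S step_eq1// dstep_eq0 ?mulr0 ?mul0r ?addr0 ?mul1r//; right.
Qed.

(** The field Y vanishes on the frontier of K together with w, but it is not of
    class C^1 when extended by 0. The fields [Ye e] are, so that
    [sphere_divergence] applies to them; let e tend to 0. *)
Theorem divergence_compact :
  (\int[lebt n]_(t in D 1) (density (rv t) * ambient_div Y (h 1 (rv t)))%:E +
   \int[lebt n]_(t in D (-1)) (density (rv t) * ambient_div Y (h (-1) (rv t)))%:E
   = 0)%E.
Proof.
have [C C0 HC] := div_Ye_bound.
pose I c e := (\int[lebt n]_(t in D c)
  (density (rv t) * ambient_div (Ye e) (h c (rv t)))%:E)%E.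
pose L c := (\int[lebt n]_(t in D c)
  (density (rv t) * ambient_div Y (h c (rv t)))%:E)%E.
have bound c e t : 0 < e -> D c t ->
    (`|(density (rv t) * ambient_div (Ye e) (h c (rv t)))%:E| <=
     C%:E * (density (rv t))%:E)%E.
  move=> e0 [t1 Kt]; have r0 := density_gt0 t1.
  rewrite -EFinM lee_fin normrM gtr0_norm// mulrC ler_wpM2r ?(ltW r0)//.
  by have [] := HC e _ e0 Kt.
have iYe c e : 0 < e -> (lebt n).-integrable (D c)
    (fun t => (density (rv t) * ambient_div (Ye e) (h c (rv t)))%:E).
  move=> e0; apply: le_integrable (integrableZl (mD c) C (iD c)) => //.
    exact: measurable_div_Ye.
  by move=> t Dt; apply: le_trans (bound c e t e0 Dt) (lee_abs _).
have cvgI c : c ^+ 2 = 1 -> I c (harmonic j) @[j --> \oo] --> L c.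
  move=> c1; have ae2 : {ae lebt n, forall t j, D c t ->
      `|(density (rv t) * ambient_div (Ye (harmonic j)) (h c (rv t)))%:E| <=
      C%:E * (density (rv t))%:E}%E.
    by apply: aeW => t j Dt; apply: bound => //; exact: harmonic_gt0.
  by have [] := @dominated_convergence _ _ R (lebt n) (D c) (mD c)
    (fun j t => (density (rv t) * ambient_div (Ye (harmonic j)) (h c (rv t)))%:E)
    (fun t => (density (rv t) * ambient_div Y (h c (rv t)))%:E)
    (fun t => C%:E * (density (rv t))%:E)%E
    (fun j => @measurable_div_Ye c _ (harmonic_gt0 j)) (@measurable_div c)
    (cvg_div_Ye c1) (integrableZl (mD c) C (iD c)) ae2.
have sum0 e : 0 < e -> (I 1%R e + I (-1)%R e = 0)%E.
  move=> e0; have E0 := sphere_divergence (fun i => Ye_Ck i e0) (fun x x0 => @Ye_tan e x x0).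
  have CYe := fun i => Ye_Ck i e0.
  have off c t : c ^+ 2 = 1 -> tuple_ball n t -> ~ D c t ->
      ambient_div (Ye e) (h c (rv t)) = 0.
    move=> c1 t1 nDt; apply: div_Ye_out; first exact: hemisphere_sphere.
    by move=> Kt; apply: nDt.
  have iB c : c ^+ 2 = 1 -> (lebt n).-integrable (tuple_ball n)
      (fun t => (density (rv t) * ambient_div (Ye e) (h c (rv t)))%:E).
    move=> c1; apply: le_integrable (integrableZl _ C (@integrable_density R n)) => //.
    - exact: measurable_tuple_ball.
    - apply: (@measurable_ball_fun R n
        (fun y => density y * ambient_div (Ye e) (h c y))) => y y1.
      apply: continuousM; first exact: (@density_Ck R n 0).
      apply: continuous_comp; first exact: continuous_hemisphere.
      by apply: ambient_div_continuous => //; exact: hemisphere_neq0.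
    - move=> t t1; apply: le_trans (lee_abs _).
      have [Dt|nDt] := pselect (D c t); first exact: bound.
      rewrite off// mulr0 abse0 -EFinM lee_fin mulr_ge0//.
      exact/ltW/density_gt0.
    - exact: measurable_tuple_ball.
  have IB c : c ^+ 2 = 1 -> I c e = (\int[lebt n]_(t in tuple_ball n)
      (density (rv t) * ambient_div (Ye e) (h c (rv t)))%:E)%E.
    move=> c1; rewrite /I integral_mkcond [RHS]integral_mkcond.
    apply: eq_integral => t _; rewrite !patchE.
    case: ifPn => [|/negP nDt]; first by rewrite inE => -[t1 _]; rewrite ifT// inE.
    case: ifPn => //; rewrite inE => t1; rewrite off ?mulr0//.
    by move=> Dt; apply: nDt; rewrite inE.
  rewrite IB ?expr1n// IB ?sqrrN ?expr1n//.
  rewrite -integralD ?iB ?expr1n ?sqrrN ?expr1n//; last exact: measurable_tuple_ball.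
  rewrite -[RHS]E0; apply: eq_integral => t _.
  by rewrite -EFinD -mulrDr.
have sq1 : (1 : R) ^+ 2 = 1 by rewrite expr1n.
have sqN1 : (-1 : R) ^+ 2 = 1 by rewrite sqrrN expr1n.
have fin c : L c \is a fin_num by apply: integrable_fin_num => //; exact: integrable_div.
suff : (L 1%R + L (-1)%R = 0)%E by [].
have [c1 c2] := (cvgI _ sq1, cvgI _ sqN1); have fin2 := fin (-1).
clear bound iYe cvgI fin; clearbody I L.
have cvgS : (I 1%R (harmonic j) + I (-1)%R (harmonic j))%E @[j --> \oo] -->
    (L 1%R + L (-1)%R)%E.
  by apply: cvgeD => //; exact: fin_num_adde_defl.
have cvg0 : (I 1%R (harmonic j) + I (-1)%R (harmonic j))%E @[j --> \oo] --> (0 : \bar R).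
  under eq_fun do rewrite sum0 ?harmonic_gt0//.
  exact: cvg_cst.
exact: (cvg_unique _ cvgS cvg0).
Qed.

End divergence_on_compact_sets.

(** * The covariant derivative at a point *)

Section covariant_derivative.
Context {R : realType} {n : nat}.
Local Notation V := 'rV[R]_n.+1.
Implicit Types (X : V -> V) (x z e : V).

(** Components of the extension that [nabla] differentiates; it is homogeneous
    of degree 0. *)
Definition hom_ext X i (z : V) : R := X (radial z) 0 i.

(** Transposed differential: row vectors e are mapped to e *m jac X x. *)
Definition jac X (x : V) : 'M[R]_n.+1 := \matrix_(j, i) partial j (hom_ext X i) x.

Lemma hom_extZ X i (a : R) z : 0 < a -> hom_ext X i (a *: z) = hom_ext X i z.
Proof. by move=> a0; rewrite /hom_ext radialZ. Qed.

Lemma mulmx_dot x z : x *m z^T = (dot x z)%:M.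
Proof. by apply/matrixP => a b; rewrite !ord1 [RHS]mxE. Qed.

(** The difference of the two sides is half of the squared norm of B + B^T. *)
Lemma mxtrace_sqr_ge p (B : 'M[R]_p) : - \tr (B *m B) <= \tr (B *m B^T).
Proof.
rewrite -subr_ge0 opprK.
have sum_ge0 : 0 <= \tr ((B + B^T) *m (B + B^T)^T).
  rewrite /mxtrace sumr_ge0// => i _; rewrite mxE sumr_ge0// => j _.
  by rewrite [X in _ * X]mxE -expr2 sqr_ge0.
suff E : \tr ((B + B^T) *m (B + B^T)^T) = 2 * (\tr (B *m B^T) + \tr (B *m B)).
  by rewrite E pmulr_rge0 in sum_ge0.
rewrite linearD/= trmxK mulmxDl !mulmxDr !linearD/=.
have -> : \tr (B^T *m B^T) = \tr (B *m B) by rewrite -trmx_mul mxtrace_tr.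
have -> : \tr (B^T *m B) = \tr (B *m B^T) by rewrite mxtrace_mulC.
by ring.
Qed.

Section at_a_point.
Variables (X : V -> V) (x : V).
Hypotheses (Sx : sphere x) (dX : forall i, differentiable (hom_ext X i) x).
Local Notation J := (jac X x).
(* The orthogonal projection onto the tangent space. *)
Let P : 'M[R]_n.+1 := 1%:M - x^T *m x.

Let xx : x *m x^T = 1%:M.
Proof. by rewrite mulmx_dot Sx. Qed.

Let PT : P^T = P.
Proof. by rewrite /P linearB/= trmx1 trmx_mul trmxK. Qed.

Let PP : P *m P = P.
Proof.
rewrite /P mulmxBr mulmx1 mulmxBl mul1mx mulmxA -[x^T *m x *m x^T]mulmxA xx mulmx1.
by rewrite subrr subr0.
Qed.

Lemma euler_jac : x *m J = 0.
Proof.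
apply/rowP => i; rewrite !mxE.
under eq_bigr do rewrite mxE.
rewrite -derive_partial//; apply: derive_homogeneous0 => // a z a0.
exact: hom_extZ.
Qed.

Let PJ : P *m J = J.
Proof. by rewrite /P mulmxBl mul1mx -mulmxA euler_jac mulmx0 subr0. Qed.

Lemma nablaE e : nabla X x e = e *m J *m P.
Proof.
rewrite /nabla /tangent_proj.
have dXr : differentiable (X \o @radial R n) x by apply: differentiable_rowP.
have -> : 'D_e (X \o @radial R n) x = e *m J.
  rewrite derive_mx; last exact: diff_derivable.
  apply/rowP => i; rewrite !mxE.
  rewrite -[LHS]/('D_e (hom_ext X i) x) derive_partial//.
  by apply: eq_bigr => j _; rewrite mxE.
rewrite /P mulmxBr mulmx1; congr (_ - _).
by rewrite mulmxA mulmx_dot mul_scalar_mx.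
Qed.

Let sum_frame (A B : 'M[R]_n.+1) :
  \sum_(a < n) dot (row a (frame x) *m A) (row a (frame x) *m B) =
  \tr (A *m B^T *m P).
Proof.
have FF := orthonormal_frame_proj Sx (frameP Sx).
have -> : \tr (A *m B^T *m P) = \tr ((frame x *m A) *m (frame x *m B)^T).
  by rewrite /P -FF trmx_mul mulmxA mxtrace_mulC !mulmxA.
rewrite /mxtrace; apply: eq_bigr => a _.
rewrite -!row_mul dotE mxE; apply: eq_bigr => j _.
by rewrite !mxE.
Qed.

Lemma divergenceE : divergence X x = \tr J.
Proof.
rewrite /divergence; under eq_bigr do rewrite nablaE -mulmxA -[X in dot _ X]mulmx1.
rewrite sum_frame trmx1 mulmx1 -mulmxA PP mxtrace_mulC PJ//.
Qed.

Lemma nabla_norm2E : nabla_norm2 X x = \tr (J *m P *m (J *m P)^T).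
Proof.
rewrite /nabla_norm2; under eq_bigr do rewrite nablaE -mulmxA.
rewrite sum_frame mxtrace_mulC mulmxA; congr (\tr (_ *m _)).
by rewrite mulmxA PJ.
Qed.

Let trJP : \tr (J *m P *m (J *m P)) = \tr (J *m J).
Proof. by rewrite -[J *m P *m _]mulmxA [P *m _]mulmxA PJ mulmxA mxtrace_mulC mulmxA PJ. Qed.

(** [jac X x *m P] is the covariant derivative, and its square has the trace of
    the square of [jac X x] since the differential kills x. *)
Lemma nabla_norm2_ge : - \tr (J *m J) <= nabla_norm2 X x.
Proof. by rewrite nabla_norm2E -trJP; exact: mxtrace_sqr_ge. Qed.

Lemma nabla_norm2_skew : (J *m P)^T = - (J *m P) ->
  nabla_norm2 X x = - \tr (J *m J).
Proof. by move=> skew; rewrite nabla_norm2E skew mulmxN linearN/= trJP. Qed.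

Lemma nabla_norm2_jac : nabla_norm2 X x = \tr (J *m P *m J^T).
Proof. by rewrite nabla_norm2E trmx_mul PT mulmxA -[J *m P *m P]mulmxA PP. Qed.

End at_a_point.
End covariant_derivative.

(** * The interpolating field of two unit solenoidal fields *)

Section interpolating_field.
Context {R : realType} {n : nat}.
Local Notation V := 'rV[R]_n.+1.
Variable O : set V.
Hypothesis oO : open O.

Definition unit_solenoidal (f : 'I_n.+1 -> V -> R) : Prop :=
  [/\ forall i, Ck 2 O (f i),
      forall x : V, O x -> \sum_i x 0 i * f i x = 0,
      forall x : V, O x -> \sum_i f i x ^+ 2 = 1 &
      forall x : V, O x -> \sum_i partial i (f i) x = 0].

Definition trace_sqr (f : 'I_n.+1 -> V -> R) (x : V) : R :=
  \sum_i \sum_j partial j (f i) x * partial i (f j) x.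

Let nearO (x : V) (P : V -> Prop) : O x -> (forall z, O z -> P z) -> \near x, P x.
Proof. by move=> Ox OP; have := open_nbhs_nbhs (conj oO Ox); apply: filterS. Qed.

Lemma derive_zero_on (g : V -> R) x e : O x -> (forall z, O z -> g z = 0) ->
  'D_e g x = 0.
Proof.
move=> Ox g0; rewrite (@near_eq_derive _ _ _ _ (cst (0 : R))) ?derive_cst//.
exact: nearO.
Qed.

Lemma tangent_partial f x j : unit_solenoidal f -> O x ->
  \sum_i x 0 i * partial j (f i) x = - f j x.
Proof.
move=> [Cf tf _ _] Ox; pose c i := fun x : V => x 0 i.
have df i : derivable (f i) x (delta_mx 0 j).
  exact/diff_derivable/(Ck_differentiable (Cf i)).
have dc i : derivable (c i) x (delta_mx 0 j) by exact/diff_derivable/differentiable_coord.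
have E : partial j (\sum_(i < n.+1) c i * f i) x = 0.
  by apply: derive_zero_on => // z Oz; rewrite fct_sumE tf.
move: E; rewrite derive_sum; last by move=> i; exact: derivableM.
under eq_bigr do rewrite (deriveM (dc _) (df _)) derive_coord -![_ *: _]/(_ * _).
rewrite big_split/= [X in _ + X](_ : _ = f j x).
  by move=> /eqP; rewrite addr_eq0 => /eqP.
rewrite (bigD1 j)//= mxE !eqxx mulr1 big1 ?addr0// => i ij.
by rewrite mxE (negbTE ij) mulr0.
Qed.

Lemma partial_div f x j : unit_solenoidal f -> O x ->
  \sum_i partial i (partial j (f i)) x = 0.
Proof.
move=> [Cf _ _ sf] Ox.
under eq_bigr => i _ do rewrite (derive_comm _ _ oO (Cf i) Ox).
have d i : derivable (partial i (f i)) x (delta_mx 0 j).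
  exact/diff_derivable/((Cf i).2 (delta_mx 0 i)).1.
rewrite -derive_sum//; apply: derive_zero_on => // z Oz.
by rewrite fct_sumE sf.
Qed.

Variables f g : 'I_n.+1 -> V -> R.
Hypotheses (Hf : unit_solenoidal f) (Hg : unit_solenoidal g).

Definition difference j : V -> R := f j - g j.

(** With A and B the differentials of f and g this is (A + B)(f - g), a primitive
    of tr A^2 - tr B^2 for the divergence, see [interpolant_div]. *)
Definition interpolant i : V -> R :=
  \sum_j (partial j (f i) + partial j (g i)) * difference j.

Let Cf i : Ck 2 O (f i). Proof. by case: Hf. Qed.
Let Cg i : Ck 2 O (g i). Proof. by case: Hg. Qed.

Lemma difference_Ck j : Ck 2 O (difference j).
Proof. exact: (CkB oO (Cf j) (Cg j)). Qed.

Let sum_Ck i j : Ck 1 O (partial j (f i) + partial j (g i)).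
Proof. by apply: CkD => //; [exact: (Cf i).2|exact: (Cg i).2]. Qed.

Lemma interpolant_Ck i : Ck 1 O (interpolant i).
Proof.
rewrite /interpolant; apply: (Ck_sum oO) => j.
exact: (CkM oO (sum_Ck i j) (CkW (difference_Ck j))).
Qed.

Let interpolantE i x : interpolant i x =
  \sum_j (partial j (f i) x + partial j (g i) x) * (f j x - g j x).
Proof. by rewrite /interpolant fct_sumE. Qed.

(** <x, A w> = - <f, w> by differentiating <x, f> = 0, hence <x, (A + B)(f - g)>
    = - <f + g, f - g> = |g|^2 - |f|^2 = 0. *)
Lemma interpolant_tangent x : O x -> \sum_i x 0 i * interpolant i x = 0.
Proof.
move=> Ox; under eq_bigr do rewrite interpolantE mulr_sumr.
rewrite exchange_big/=.
have E j : \sum_i x 0 i * ((partial j (f i) x + partial j (g i) x) * (f j x - g j x)) =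
    g j x ^+ 2 - f j x ^+ 2.
  rewrite (_ : \sum_i _ = (\sum_i x 0 i * partial j (f i) x +
     \sum_i x 0 i * partial j (g i) x) * (f j x - g j x)).
    by rewrite !tangent_partial//; ring.
  by rewrite -big_split/= mulr_suml; apply: eq_bigr => i _; ring.
under eq_bigr do rewrite E.
by rewrite sumrB; case: Hf => _ _ ->// _; case: Hg => _ _ ->// _; rewrite subrr.
Qed.

Let d_diff j e x : O x -> 'D_e (difference j) x = 'D_e (f j) x - 'D_e (g j) x.
Proof.
move=> Ox; have d1 : derivable (f j) x e by exact/diff_derivable/(Ck_differentiable (Cf j)).
have d2 : derivable (g j) x e by exact/diff_derivable/(Ck_differentiable (Cg j)).
exact: (deriveB d1 d2).
Qed.

(** The second order terms are derivatives of div f and div g, by symmetry of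
    second derivatives; what remains is tr ((A + B)(A - B)), where the mixed
    products cancel. *)
Lemma interpolant_div x : O x ->
  ambient_div interpolant x = trace_sqr f x - trace_sqr g x.
Proof.
move=> Ox; rewrite /ambient_div.
pose A i j := partial j (f i) x; pose B i j := partial j (g i) x.
have E i : partial i (interpolant i) x = \sum_j
    ((partial i (partial j (f i)) x + partial i (partial j (g i)) x) * (f j x - g j x) +
     (A i j + B i j) * (A j i - B j i)).
  rewrite derive_sum; last first.
    move=> j; apply: derivableM; first exact/diff_derivable/(Ck_differentiable (sum_Ck i j)).
    exact/diff_derivable/(Ck_differentiable (difference_Ck j)).
  apply: eq_bigr => j _.
  have d1 : derivable (partial j (f i) + partial j (g i)) x (delta_mx 0 i).
    exact/diff_derivable/(Ck_differentiable (sum_Ck i j)).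
  have d2 : derivable (difference j) x (delta_mx 0 i).
    exact/diff_derivable/(Ck_differentiable (difference_Ck j)).
  rewrite (deriveM d1 d2) d_diff// -![_ *: _]/(_ * _) addrC.
  have d3 : derivable (partial j (f i)) x (delta_mx 0 i).
    exact/diff_derivable/(((Cf i).2 (delta_mx 0 j)).1).
  have d4 : derivable (partial j (g i)) x (delta_mx 0 i).
    exact/diff_derivable/(((Cg i).2 (delta_mx 0 j)).1).
  by rewrite (deriveD d3 d4) mulrC.
under eq_bigr do rewrite E.
under eq_bigr do rewrite big_split/=.
rewrite big_split/= [X in X + _](_ : _ = 0) ?add0r.
  rewrite /trace_sqr.
  transitivity (\sum_i \sum_j (A i j * A j i - B i j * B j i) +
     (\sum_i \sum_j B i j * A j i - \sum_i \sum_j A i j * B j i)).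
    rewrite -sumrB -big_split/=; apply: eq_bigr => i _.
    by rewrite -sumrB -big_split/=; apply: eq_bigr => j _; ring.
  rewrite [X in _ + (X - _)]exchange_big/=.
  rewrite [X in _ + (X - _)](_ : _ = \sum_i \sum_j A i j * B j i).
    by rewrite subrr addr0 -sumrB; apply: eq_bigr => i _; rewrite sumrB.
  by apply: eq_bigr => i _; apply: eq_bigr => j _; rewrite mulrC.
rewrite exchange_big/= big1// => j _; rewrite -mulr_suml big_split/=.
have e0 := congr2 +%R (partial_div j Hf Ox) (partial_div j Hg Ox).
exact: etrans (congr1 ( *%R^~ _) (etrans e0 (addr0 0))) (mul0r _).
Qed.

Lemma interpolant_div_degenerate x : O x ->
  (forall i j, partial i (difference j) x = 0) -> ambient_div interpolant x = 0.
Proof.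
move=> Ox d0; rewrite interpolant_div//.
have E i j : partial i (f j) x = partial i (g j) x.
  by apply/eqP; rewrite -subr_eq0 -d_diff// d0.
apply/eqP; rewrite subr_eq0; apply/eqP.
by apply: eq_bigr => i _; apply: eq_bigr => j _; rewrite !E.
Qed.

(** Both the derivative of q and the interpolant are linear in the difference,
    with coefficients that are bounded on K. *)
Lemma interpolant_quadratic (K : set V) : compact K -> K `<=` O ->
  let q := \sum_j difference j * difference j in
  exists2 C, 0 <= C & forall x, K x ->
    `|\sum_i partial i q x * interpolant i x| <= C * q x.
Proof.
move=> cK KO q.
pose M i l j : V -> R := cst 2 * (partial i (difference l) *
   (partial j (f i) + partial j (g i))).
have CM i l j : Ck 0 O (M i l j).
  have c2 : Ck 1 O (partial i (difference l)) := (difference_Ck l).2 (delta_mx 0 i).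
  have c1 : Ck 0 O (partial i (difference l)) := CkW c2.
  exact: (CkM oO (Ck_cst 0 O 2) (CkM oO c1 (CkW (sum_Ck i j)))).
pose F : V -> R := \sum_i \sum_l \sum_j (fun x => `|M i l j x|).
have CF x : K x -> {for x, continuous F}.
  move=> /KO Ox; apply: (@Ck_sum _ _ 0 O) => // i; apply: Ck_sum => // l.
  apply: Ck_sum => // j z Oz; apply: (@continuous_comp _ _ _ (M i l j) (fun s : R => `|s|)).
    exact: CM.
  exact: norm_continuous.
have [C C0 HC] := compact_bound cK CF; exists C => // x Kx; have Ox := KO x Kx.
have qE : q x = \sum_j difference j x ^+ 2 by rewrite /q fct_sumE.
have q_ge j : difference j x ^+ 2 <= q x.
  by rewrite qE (bigD1 j)//= lerDl sumr_ge0// => ? _; exact: sqr_ge0.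
have q0 : 0 <= q x by rewrite qE sumr_ge0// => ? _; exact: sqr_ge0.
have dq i : partial i q x = \sum_l 2 * (partial i (difference l) x * difference l x).
  have dd l : derivable (difference l) x (delta_mx 0 i).
    exact/diff_derivable/(Ck_differentiable (difference_Ck l)).
  rewrite derive_sum; last by move=> l; exact: derivableM.
  apply: eq_bigr => l _; rewrite (deriveM (dd l) (dd l)) -![_ *: _]/(_ * _); ring.
have -> : \sum_i partial i q x * interpolant i x =
    \sum_i \sum_l \sum_j M i l j x * (difference l x * difference j x).
  apply: eq_bigr => i _; rewrite dq interpolantE mulr_suml; apply: eq_bigr => l _.
  rewrite mulr_sumr; apply: eq_bigr => j _.
  rewrite -[M i l j x]/(2 * (partial i (difference l) x *
    (partial j (f i) x + partial j (g i) x))) -[f j x - g j x]/(difference j x).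
  rewrite /=; ring.
apply: (@le_trans _ _ (F x * q x)); last first.
  by rewrite ler_wpM2r//; apply: le_trans (HC x Kx); exact: ler_norm.
rewrite /F fct_sumE mulr_suml; apply: le_trans (ler_norm_sum _ _ _) _.
apply: ler_sum => i _; rewrite fct_sumE mulr_suml; apply: le_trans (ler_norm_sum _ _ _) _.
apply: ler_sum => l _; rewrite fct_sumE mulr_suml; apply: le_trans (ler_norm_sum _ _ _) _.
apply: ler_sum => j _; rewrite normrM ler_wpM2l// ler_norml.
have := q_ge l; have := q_ge j; set a := difference l x; set b := difference j x => hb ha.
have p1 := sqr_ge0 (a - b); have p2 := sqr_ge0 (a + b).
by apply/andP; split; nra.
Qed.

End interpolating_field.

(** * Unit solenoidal fields on open subsets of the sphere *)

Section fields_on_the_sphere.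
Context {R : realType} {n : nat}.
Local Notation V := 'rV[R]_n.+1.
Implicit Types (X : V -> V) (x z : V) (W U : set V).

Lemma trace_sqr_jac X x : trace_sqr (hom_ext X) x = \tr (jac X x *m jac X x).
Proof.
rewrite /trace_sqr exchange_big/= /mxtrace; apply: eq_bigr => j _.
by rewrite mxE; apply: eq_bigr => i _; rewrite !mxE.
Qed.

Lemma trace_jac X x : \tr (jac X x) = \sum_i partial i (hom_ext X i) x.
Proof. by rewrite /mxtrace; apply: eq_bigr => i _; rewrite mxE. Qed.

Lemma radialK z : z != 0 -> z = (inv_norm z)^-1 *: radial z.
Proof.
move=> z0; rewrite /radial -[(Num.sqrt _)^-1]/(inv_norm z) scalerA mulVf ?scale1r//.
by rewrite lt0r_neq0// inv_norm_gt0.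
Qed.

Lemma hom_ext_Ck r W X : open W -> smooth_on (W `&` @sphere R n) X ->
  forall i, Ck r (cone W) (hom_ext X i).
Proof.
move=> oW sX i; apply: Ck_local => z [z0 Wz].
have Uz : (W `&` @sphere R n) (radial z) by split => //; exact: radial_sphere.
have [W1 [F [oW1 W1z CF FX]]] := sX _ Uz; exists (cone (W1 `&` W)); first by split.
have oI : open (W1 `&` W) by exact: openI.
apply: (@Ck_ext _ _ _ _ ((fun x => F x 0 i) \o @radial R n)).
- exact: open_cone.
- move=> x [x0 [W1x Wx]]; rewrite /hom_ext /= FX//; split => //; split => //.
  exact: radial_sphere.
- apply: Ck_radial => //; apply: (@Ck_sub _ _ _ W1); first by move=> x [].
  exact: Cr_on_Ck.
Qed.

Lemma unit_solenoidal_ext W X : open W -> (forall i, Ck 2 (cone W) (hom_ext X i)) ->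
  tangent_field (W `&` @sphere R n) X -> unit_field (W `&` @sphere R n) X ->
  solenoidal (W `&` @sphere R n) X -> unit_solenoidal (cone W) (hom_ext X).
Proof.
move=> oW CX tX uX sX.
have US z : cone W z -> (W `&` @sphere R n) (radial z).
  by move=> [z0 Wz]; split => //; exact: radial_sphere.
split => // z Wz; have Uz := US z Wz; have z0 := cone_nonzero Wz.
- transitivity (dot z (X (radial z))); first by rewrite dotE.
  by rewrite {1}(radialK z0) dotZl tX// mulr0.
- rewrite -(uX _ Uz) dotE; apply: eq_bigr => i _; exact: expr2.
- have a0 : 0 < (inv_norm z)^-1 by rewrite invr_gt0 inv_norm_gt0.
  have Wr : cone W (radial z) by apply: cone_sphere; case: Uz.
  rewrite (radialK z0).
  under eq_bigr => i _ do rewrite (derive_homogeneous0Z _ a0 (fun z => hom_extZ X i z a0)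
    (Ck_differentiable (CX i) (coneZ a0 Wr))).
  rewrite -mulr_sumr -trace_jac -divergenceE ?sX ?mulr0//; first by case: Uz.
  by move=> i; exact: (Ck_differentiable (CX i) Wr).
Qed.

Lemma nabla_norm2_partials W X x : open W ->
  unit_solenoidal (cone W) (hom_ext X) -> (W `&` @sphere R n) x ->
  nabla_norm2 X x = \sum_i \sum_j partial j (hom_ext X i) x ^+ 2 - 1.
Proof.
move=> oW HX [Wx Sx]; have [CX tX uX sX] := HX.
have Cx : cone W x by exact: cone_sphere.
rewrite nabla_norm2_jac//; last by move=> i; exact: (Ck_differentiable (CX i) Cx).
rewrite mulmxBr mulmx1 mulmxBl linearB/=; congr (_ - _).
  rewrite exchange_big/= /mxtrace; apply: eq_bigr => j _.
  by rewrite mxE; apply: eq_bigr => i _; rewrite !mxE.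
have -> : jac X x *m (x^T *m x) *m (jac X x)^T =
    (jac X x *m x^T) *m (jac X x *m x^T)^T by rewrite trmx_mul trmxK !mulmxA.
rewrite /mxtrace -(uX x Cx); apply: eq_bigr => j _.
have Jx : (jac X x *m x^T) j 0 = - hom_ext X j x.
  have oC : open (cone W) := open_cone oW.
  rewrite -(tangent_partial oC j HX Cx) mxE; apply: eq_bigr => i _.
  by rewrite !mxE mulrC.
by rewrite mxE big_ord1 [X in _ * X]mxE Jx -expr2 sqrrN.
Qed.

End fields_on_the_sphere.

(** * Hopf fields *)

Section hopf_field.
Context {R : realType} {n : nat}.
Local Notation V := 'rV[R]_n.+1.
Variables (J : 'M[R]_n.+1) (H : V -> V).
Hypotheses (JTJ : J^T *m J = 1%:M) (JJ : J *m J = - 1%:M).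
Hypothesis HJ : forall x, sphere x -> (H x)^T = J *m x^T.
Let Q := J^T.

Let HE x : sphere x -> H x = x *m Q.
Proof. by move=> Sx; rewrite -[H x]trmxK HJ// trmx_mul trmxK. Qed.

(* J is orthogonal with J^2 = -1, hence skew. *)
Let QJ : Q = - J.
Proof.
have e : 1%:M = - (J *m J) by rewrite JJ opprK.
by rewrite -[LHS]mulmx1 e mulmxN mulmxA JTJ mul1mx.
Qed.

Let QT : Q^T = - Q. Proof. by rewrite QJ linearN/= -/Q QJ opprK. Qed.

Let QQ : Q *m Q = - 1%:M. Proof. by rewrite QJ mulmxN mulNmx opprK JJ. Qed.

Let xQx (x : V) : x *m Q *m x^T = 0.
Proof.
have E : (x *m Q *m x^T)^T = - (x *m Q *m x^T).
  by rewrite trmx_mul (trmx_mul x Q) QT (trmxK x) mulNmx mulmxN mulmxA.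
apply/matrixP => a b; rewrite !ord1 [RHS]mxE.
move/matrixP : E => /(_ 0 0); rewrite !mxE => /eqP.
by rewrite -addr_eq0 -mulr2n mulrn_eq0/= => /eqP.
Qed.

Let hom_extH i z : z != 0 ->
  hom_ext H i z = inv_norm z * \sum_l z 0 l * Q l i.
Proof.
move=> z0; rewrite /hom_ext HE; last exact: radial_sphere.
by rewrite mxE mulr_sumr; apply: eq_bigr => l _; rewrite radialE mulrA.
Qed.

Let lin i : V -> R := \sum_l (fun z : V => z 0 l) * cst (Q l i).

Let lin_Ck r O i : open O -> Ck r O (lin i).
Proof.
by move=> oO; apply: Ck_sum => // l; apply: CkM => //; [exact: Ck_coord|exact: Ck_cst].
Qed.

Let linE i z : lin i z = \sum_l z 0 l * Q l i.
Proof. by rewrite /lin fct_sumE. Qed.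

Lemma hopf_Ck r i : Ck r nonzero (hom_ext H i).
Proof.
apply: (@Ck_ext _ _ _ _ (@inv_norm R n.+1 * lin i)); first exact: open_nonzero.
  by move=> z z0; rewrite hom_extH// -linE.
apply: CkM; [exact: open_nonzero|exact: inv_norm_Ck|].
by apply: lin_Ck; exact: open_nonzero.
Qed.

Lemma jac_hopf x : sphere x -> jac H x = Q - x^T *m (x *m Q).
Proof.
move=> Sx; have x0 := sphere_neq0 Sx; apply/matrixP => j i; rewrite mxE.
rewrite (@near_eq_derive _ _ _ _ (@inv_norm R n.+1 * lin i)); last first.
  have : nbhs x nonzero by apply: open_nbhs_nbhs; split => //; exact: open_nonzero.
  by apply: filterS => z z0; rewrite hom_extH// -linE.
have [d1 v1] := inv_norm_diff x0.
have dl : differentiable (lin i) x.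
  by apply: (Ck_differentiable (@lin_Ck 1 setT i openT)).
have d1' : derivable (@inv_norm R n.+1) x (delta_mx 0 j) by exact: diff_derivable.
have dl' : derivable (lin i) x (delta_mx 0 j) by exact: diff_derivable.
rewrite (deriveM d1' dl') v1 inv_norm_sphere// dot_delta -![_ *: _]/(_ * _).
have -> : partial j (lin i) x = Q j i.
  have dc l : derivable (fun z : V => z 0 l) x (delta_mx 0 j).
    exact/diff_derivable/differentiable_coord.
  have dQ l : derivable (cst (Q l i) : V -> R) x (delta_mx 0 j) by exact: derivable_cst.
  rewrite derive_sum; last by move=> l; exact: (derivableM (dc l) (dQ l)).
  under eq_bigr => l _ do rewrite (deriveM (dc l) (dQ l)) derive_cst derive_coord
    scaler0 add0r -[_ *: _]/(_ * _).
  rewrite (bigD1 j)//= [delta_mx _ _ _ _]mxE !eqxx mulr1 big1 ?addr0// => l lj.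
  by rewrite [delta_mx _ _ _ _]mxE (negbTE lj) mulr0.
rewrite linE mul1r expr1n mulr1 mulrN mulrC; apply: esym.
by rewrite mxE [in X in _ + X]mxE [in X in _ + X]mxE big_ord1 !mxE.
Qed.

Lemma hopf_trace_sqr x : sphere x -> \tr (jac H x *m jac H x) = 2 - n.+1%:R.
Proof.
move=> Sx; have xx : x *m x^T = 1%:M by rewrite mulmx_dot Sx.
rewrite jac_hopf// mulmxBl !mulmxBr QQ.
have -> : x^T *m (x *m Q) *m Q = - (x^T *m x).
  by rewrite -!mulmxA QQ !mulmxN mulmx1.
have -> : x^T *m (x *m Q) *m (x^T *m (x *m Q)) = 0.
  by rewrite !mulmxA -(mulmxA x^T x Q) -(mulmxA x^T (x *m Q)) xQx mulmx0 !mul0mx.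
rewrite subr0 !linearB/= !linearN/= mxtrace1 (mulmxA Q) mxtrace_mulC mulmxA -(mulmxA x) QQ.
rewrite mulmxN mulmx1 mulNmx linearN/= xx mxtrace_mulC xx mxtrace1.
ring.
Qed.

Lemma hopf_nabla_norm2 x : sphere x -> nabla_norm2 H x = n.+1%:R - 2.
Proof.
move=> Sx; rewrite nabla_norm2_skew//.
- by rewrite hopf_trace_sqr// opprB.
- by move=> i; apply: (Ck_differentiable (hopf_Ck 1 i)); exact: sphere_neq0.
have -> : jac H x = (1%:M - x^T *m x) *m Q.
  by rewrite jac_hopf// mulmxBl mul1mx mulmxA.
have PT : (1%:M - x^T *m x)^T = 1%:M - x^T *m x.
  by rewrite linearB/= trmx1 trmx_mul trmxK.
by rewrite !trmx_mul PT QT mulNmx mulmxN mulmxA.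
Qed.

Lemma hopf_unit_solenoidal W : open W -> unit_solenoidal (cone W) (hom_ext H).
Proof.
move=> oW; apply: unit_solenoidal_ext => //.
- by move=> i; apply: (Ck_sub (O := nonzero)); [move=> z []|exact: hopf_Ck].
- by move=> x [_ Sx]; rewrite HE// dotC /dot xQx mxE.
- move=> x [_ Sx]; rewrite HE// /dot trmx_mul QT mulNmx mulmxN mulmxA -(mulmxA x) QQ.
  by rewrite mulmxN mulmx1 mulNmx opprK mulmx_dot Sx mxE.
move=> x [_ Sx]; rewrite divergenceE//; last first.
  by move=> i; apply: (Ck_differentiable (hopf_Ck 1 i)); exact: sphere_neq0.
rewrite jac_hopf// linearB/= mxtrace_mulC xQx linear0 subr0.
have : \tr Q = - \tr Q by rewrite -{1}mxtrace_tr QT linearN.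
by move=> /eqP; rewrite -addr_eq0 -mulr2n mulrn_eq0/= => /eqP.
Qed.

End hopf_field.

(** * The Riemannian density of the charts *)

Section riemannian_density.
Context {R : realType}.

(** The matrix determinant lemma, by two block triangular factorizations. *)
Lemma det_rank1_update n (a : 'M[R]_(n, 1)) (b : 'M[R]_(1, n)) :
  \det (1%:M + a *m b) = 1 + (b *m a) 0 0.
Proof.
pose M : 'M[R]_(1 + n) := block_mx 1%:M (- b) a 1%:M.
have E1 : M = block_mx 1%:M 0 a 1%:M *m block_mx 1%:M (- b) 0 (1%:M + a *m b).
  rewrite mulmx_block !mulmx1 !mul1mx !mul0mx ?mulmx0 !addr0 ?add0r.
  by rewrite mulmxN addrC addrK.
have E2 : M = block_mx (1%:M + b *m a) (- b) 0 1%:M *m block_mx 1%:M 0 a 1%:M.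
  rewrite mulmx_block !mulmx1 !mul1mx !mul0mx ?mulmx0 ?addr0 ?add0r.
  by rewrite mulNmx addrK.
have : \det M = \det M by [].
rewrite {1}E1 {1}E2 !det_mulmx !det_lblock !det_ublock !det1 !mul1r !mulr1 => ->.
by rewrite det_mx11 !mxE.
Qed.

(** The Gram matrix of the chart is 1 + u^T u with u = density y *: y. *)
Lemma hemisphere_densityE n (c : R) (y : 'rV[R]_n) : c ^+ 2 = 1 -> dot y y < 1 ->
  hemisphere_density c y = density y.
Proof.
move=> c1 y1; have dh := differentiable_hemisphere c y1.
have JE j i : ('J (@hemisphere R n c) y) j i =
    rcons0 (- (c * y 0 j * density y)) (delta_mx 0 j) 0 i.
  have -> : ('J (@hemisphere R n c) y) j i =
      ((delta_mx 0 j : 'rV_n) *m 'J (@hemisphere R n c) y) 0 i.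
    by rewrite -rowE [RHS]mxE.
  rewrite -deriveEjacobian// derive_mx; last exact: diff_derivable.
  rewrite mxE; apply: etrans (derive_hemisphere_coord c i (delta_mx 0 j) y1) _.
  by rewrite dot_delta.
rewrite /hemisphere_density; set M := _ *m _.
have -> : M = 1%:M + (density y *: y)^T *m (density y *: y).
  apply/matrixP => j k.
  have -> : M j k = \sum_i rcons0 (- (c * y 0 j * density y)) (delta_mx 0 j) 0 i *
      rcons0 (- (c * y 0 k * density y)) (delta_mx 0 k) 0 i.
    by rewrite [LHS]mxE; apply: eq_bigr => i _; rewrite [X in _ * X]mxE !JE.
  rewrite big_ord_recl !rcons0_0 !mxE big_ord1 !mxE.
  under eq_bigr do rewrite !rcons0_lift.
  rewrite [LHS]addrC; congr (_ + _).
    rewrite (bigD1 j)//= !mxE !eqxx mul1r big1 ?addr0// => i ij.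
    by rewrite mxE (negbTE ij) mul0r.
  rewrite mulrNN; transitivity (c ^+ 2 * (density y * y 0 j * (density y * y 0 k))).
    by ring.
  by rewrite c1 mul1r.
rewrite det_rank1_update -[X in 1 + X]/(dot _ _) dotZl dotZr.
have r0 := density_gt0 y1; have r1 := density_height y1; have h2 := sqr_height y1.
have -> : 1 + density y * (density y * dot y y) = density y ^+ 2.
  rewrite -[X in X + _](expr1n _ 2) -r1 exprMn h2; ring.
by rewrite sqrtr_sqr gtr0_norm.
Qed.

End riemannian_density.

(** * The energy bound *)

Section energy_bound.
Context {R : realType} {m : nat}.
Local Notation n := m.+1.
Local Notation V := 'rV[R]_m.+2.
Local Notation tup := (n.-tuple (measurableTypeR R)).
Local Notation rv := (@rv_of_tuple R _).
Local Notation lebt := (@lebesgue_tuple R n).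

Lemma sphere_integralE (K : set V) (f : V -> R) :
  sphere_integral K f = (\int[lebt]_(t in hemisphere_domain 1 K)
      (density (rv t) * f (hemisphere 1 (rv t)))%:E +
    \int[lebt]_(t in hemisphere_domain (-1) K)
      (density (rv t) * f (hemisphere (-1) (rv t)))%:E)%E.
Proof.
rewrite /sphere_integral.
rewrite big_cons.
rewrite big_seq1.
congr (_ + _)%E; apply: eq_integral => t; rewrite inE => -[t1 _].
  by rewrite hemisphere_densityE ?expr1n// mulrC.
by rewrite hemisphere_densityE ?sqrrN ?expr1n// mulrC.
Qed.

Lemma eq_sphere_integral (K : set V) (f g : V -> R) : K `<=` @sphere R n ->
  (forall x, K x -> f x = g x) -> sphere_integral K f = sphere_integral K g.
Proof.
move=> KS fg; rewrite !sphere_integralE.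
by congr (_ + _)%E; apply: eq_integral => t; rewrite inE => -[t1 Kt]; rewrite fg.
Qed.

Variables (K W : set V) (v H : V -> V).
Hypotheses (cK : compact K) (KS : K `<=` @sphere R n) (oW : open W) (KW : K `<=` W).

Let O := cone W.
Let oO : open O := open_cone oW.
Let KO : K `<=` O.
Proof. by move=> x Kx; apply: cone_sphere; [exact: KS|exact: KW]. Qed.

Let clK : closed K.
Proof. by apply: compact_closed => //; exact: norm_hausdorff. Qed.

Lemma volume_fin : volume K \is a fin_num.
Proof.
rewrite /volume sphere_integralE fin_numD; apply/andP; split;
  apply: integrable_fin_num => //; try exact: measurable_hemisphere_domain;
  apply: (@integrable_domain_fun R n _ K O (fun=> 1) cK oO KO) => x _;
  exact: cst_continuous.
Qed.

Hypothesis KB : submanifold_with_boundary K.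
Hypothesis vH : forall x, manifold_boundary K x -> v x = H x.
Hypothesis Hv : unit_solenoidal O (hom_ext v).
Hypothesis hopfH : hopf_flow H.

Let trace_sqr_H x : sphere x -> trace_sqr (hom_ext H) x = - m%:R.
Proof.
move=> Sx; have [J [JTJ JJ HJ]] := hopfH.
rewrite trace_sqr_jac (hopf_trace_sqr JTJ JJ HJ)// -[m.+2]addn2 natrD opprD; ring.
Qed.

Let HH : unit_solenoidal O (hom_ext H).
Proof. by have [J [JTJ JJ HJ]] := hopfH; exact: (hopf_unit_solenoidal JTJ JJ HJ). Qed.

Let Y := interpolant (hom_ext v) (hom_ext H).

Let divY x : K x -> ambient_div Y x = trace_sqr (hom_ext v) x + m%:R.
Proof.
move=> Kx; rewrite (interpolant_div oO Hv HH (KO Kx)) trace_sqr_H ?opprK//.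
exact: KS.
Qed.

Let integral_divY :
  (\int[lebt]_(t in hemisphere_domain 1 K)
      (density (rv t) * ambient_div Y (hemisphere 1 (rv t)))%:E +
   \int[lebt]_(t in hemisphere_domain (-1) K)
      (density (rv t) * ambient_div Y (hemisphere (-1) (rv t)))%:E = 0)%E.
Proof.
pose w := difference (hom_ext v) (hom_ext H).
apply: (@divergence_compact R n W K oW cK KS KW Y _ _ w).
- exact: (interpolant_Ck oO Hv HH).
- exact: (interpolant_tangent oO Hv HH).
- by move=> j; apply: CkW; exact: (difference_Ck oO Hv HH).
- by move=> j a z a0; rewrite /w /difference !fctE !hom_extZ.
- move=> x Kx; have [bx|[W' W'P]] := interior_or_boundary KB Kx; last by right; exists W'.
  left => j; rewrite /w /difference !fctE /hom_ext radial_id; last exact: KS.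
  by rewrite vH// subrr.
- exact: (interpolant_quadratic oO Hv HH cK KO).
- move=> x Kx _ dw; exact: (interpolant_div_degenerate oO Hv HH (KO Kx) dw).
Qed.

(** Pointwise |nabla v|^2 >= - tr A^2 = m - div Y, and div Y integrates to 0. *)
Lemma sphere_integral_nabla_ge :
  (m%:R%:E * volume K <= sphere_integral K (nabla_norm2 v))%E.
Proof.
pose N x := \sum_i \sum_j partial j (hom_ext v i) x ^+ 2 - 1 : R.
have [Cv _ _ _] := Hv.
have KN x : K x -> nabla_norm2 v x = N x.
  move=> Kx; apply: (nabla_norm2_partials oW Hv).
  by split; [exact: KW|exact: KS].
have cN x : O x -> {for x, continuous N}.
  have -> : N = \sum_i \sum_j (partial j (hom_ext v i) * partial j (hom_ext v i)) - cst 1.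
    apply/funext => z; rewrite /N !fctE fct_sumE; congr (_ - _).
    by apply: eq_bigr => i _; rewrite fct_sumE; apply: eq_bigr => j _; rewrite expr2.
  apply: (@CkB _ _ 0 O) => //; last exact: Ck_cst.
  apply: Ck_sum => // i; apply: Ck_sum => // j.
  have c : Ck 0 O (partial j (hom_ext v i)) by apply: CkW; exact: (Cv i).2.
  exact: CkM.
have cY x : O x -> {for x, continuous (ambient_div Y)}.
  move=> Ox; rewrite (_ : ambient_div Y = \sum_i partial i (Y i)).
    by apply: (@Ck_sum _ _ 0 O) => // i; exact: (interpolant_Ck oO Hv HH i).2.
  by apply/funext => z; rewrite fct_sumE.
have NY x : K x -> m%:R - ambient_div Y x <= N x.
  move=> Kx; rewrite -KN// divY// opprD addrCA subrr addr0 trace_sqr_jac.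
  apply: nabla_norm2_ge; first exact: KS.
  by move=> i; exact: (Ck_differentiable (Cv i) (KO Kx)).
have mD c := measurable_hemisphere_domain c clK.
have iN c := @integrable_domain_fun R n c K O N cK oO KO cN.
have iY c := @integrable_domain_fun R n c K O _ cK oO KO cY.
have i1 c := @integrable_domain_fun R n c K O (fun=> 1) cK oO KO
  (fun x _ => @cst_continuous _ _ (1 : R) x).
pose a c := (\int[lebt]_(t in hemisphere_domain c K)
  (density (rv t) * N (hemisphere c (rv t)))%:E)%E.
pose b c := (\int[lebt]_(t in hemisphere_domain c K) (density (rv t) * 1)%:E)%E.
pose d c := (\int[lebt]_(t in hemisphere_domain c K)
  (density (rv t) * ambient_div Y (hemisphere c (rv t)))%:E)%E.
have step_c c : (m%:R%:E * b c - d c <= a c)%E.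
  rewrite /a /b /d -integralZl//.
  rewrite -integralB//; last exact: integrableZl.
  apply: le_integral => //.
    by apply: integrableB => //; exact: integrableZl.
  move=> t; rewrite inE => -[t1 Kt]; rewrite -EFinM -EFinB lee_fin.
  have r0 := density_gt0 t1; have := NY _ Kt.
  by rewrite mulr1 [m%:R * _]mulrC -mulrBr => h; rewrite ler_wpM2l// ltW.
have fa c : a c \is a fin_num by apply: integrable_fin_num => //; exact: iN.
have fb c : b c \is a fin_num by apply: integrable_fin_num => //; exact: i1.
have fd c : d c \is a fin_num by apply: integrable_fin_num => //; exact: iY.
have d0 : (d 1%R + d (-1)%R = 0)%E := integral_divY.
rewrite (eq_sphere_integral KS KN) /volume !sphere_integralE.
rewrite -/(a 1) -/(a (-1)) -/(b 1) -/(b (-1)).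
have s1 := step_c 1; have s2 := step_c (-1).
move: s1 s2 d0 (fa 1) (fa (-1)) (fb 1) (fb (-1)) (fd 1) (fd (-1)).
case: (a 1) => [a1||]//; case: (a (-1)) => [a2||]//.
case: (b 1) => [b1||]//; case: (b (-1)) => [b2||]//.
case: (d 1) => [d1||]//; case: (d (-1)) => [d2||]//.
move=> s1 s2 [d0] _ _ _ _ _ _; move: s1 s2.
rewrite !lee_fin => s1 s2; rewrite mulrDr; lra.
Qed.

Lemma sphere_integral_nabla_hopf :
  (sphere_integral K (nabla_norm2 H) = m%:R%:E * volume K)%E.
Proof.
have [J [JTJ JJ HJ]] := hopfH.
rewrite (@eq_sphere_integral K _ (fun=> m%:R) KS); last first.
  move=> x /KS Sx; rewrite (hopf_nabla_norm2 JTJ JJ HJ)//.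
  by rewrite -[m.+2]addn2 natrD addrK.
have i1 c := @integrable_domain_fun R n c K O (fun=> 1) cK oO KO
  (fun x _ => @cst_continuous _ _ (1 : R) x).
have mD c := measurable_hemisphere_domain c clK.
rewrite /volume !sphere_integralE ge0_muleDr; last 2 first.
- by apply: integral_ge0 => t [t1 _]; rewrite lee_fin mulr1 ltW// density_gt0.
- by apply: integral_ge0 => t [t1 _]; rewrite lee_fin mulr1 ltW// density_gt0.
by rewrite -!integralZl//; congr (_ + _)%E; apply: eq_integral => t _;
  rewrite -EFinM mulr1 mulrC.
Qed.

End energy_bound.

Theorem theorem1p6 (R : realType) (k : nat) (k_ge1 : (1 <= k)%N)
  (U K : set 'rV[R]_((2 * k).+2))
  (U_open : open_in_sphere U)
  (KU : K `<=` U) (K_compact : compact K) (K_connected : connected K)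
  (K_submanifold : submanifold_with_boundary K)
  (v : 'rV[R]_((2 * k).+2) -> 'rV[R]_((2 * k).+2))
  (v_tangent : tangent_field U v) (v_smooth : smooth_on U v)
  (v_unit : unit_field U v) (v_solenoidal : solenoidal U v)
  (H : 'rV[R]_((2 * k).+2) -> 'rV[R]_((2 * k).+2))
  (H_hopf : hopf_flow H)
  (vH : forall x, manifold_boundary K x -> v x = H x) :
  ((((2 * k + 1)%:R / 2 + k%:R)%:E * volume K <= energy K v)%E) /\
  ((((2 * k + 1)%:R / 2 + k%:R)%:E * volume K = energy K H)%E).
Proof.
have [W oW UW] := U_open; subst U.
have KS := K_submanifold.1.
have KW : K `<=` W by move=> x /KU[].
have Hv : unit_solenoidal (cone W) (hom_ext v).
  by apply: unit_solenoidal_ext => //; exact: hom_ext_Ck.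
have ge_v := sphere_integral_nabla_ge K_compact KS oW KW K_submanifold vH Hv H_hopf.
have eq_H := sphere_integral_nabla_hopf K_compact KS oW KW H_hopf.
have fin_vol := volume_fin K_compact KS oW KW.
have split_const : ((((2 * k + 1)%:R / 2 + k%:R)%:E * volume K)%E =
    (((2 * k).+1%:R / 2)%:E * volume K + (1 / 2)%:E * ((2 * k)%:R%:E * volume K))%E).
  rewrite -(fineK fin_vol) -!EFinM -EFinD; congr (_%:E).
  by rewrite addn1 natrM; field.
rewrite split_const /energy; split; last by rewrite eq_H.
by rewrite leeD2l// lee_wpmul2l// lee_fin.
Qed.
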